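(* Let $\{(X_i,x_i)\}_{1\le i\le\infty}$ be a sequence of pointed proper geodesic spaces, $R>0$, and $\upsilon_i$ a Radon measure on $X_i$ for every $i\le\infty$, such that (i) $(X_i,x_i,\upsilon_i)\to(X_\infty,x_\infty,\upsilon_\infty)$ in the pointed measured Gromov-Hausdorff sense and $X_\infty\neq\{x_\infty\}$; (ii) for every $\hat R>0$ there exists $\kappa=\kappa(\hat R)\ge0$ such that $\upsilon_i(B_{2r}(z_i))\le2^\kappa\upsilon_i(B_r(z_i))$ for every $i\le\infty$, every $r<\hat R$ and every $z_i\in X_i$; (iii) $\upsilon_i(B_1(x_i))=1$ for every $i\le\infty$. Let $1<p<\infty$. Assume that there exists a family $\{\tau(r)\}_{r>0}$ of positive real numbers such that the weak Poincaré inequality of type $(1,p)$ for $\tau$ holds on $(X_i,\upsilon_i)$ for every $i<\infty$. Then for every sequence $\{f_i\}_{i<\infty}$ of $f_i\in H_{1,p}(B_R(x_i))$ with $\sup_{i<\infty}\|f_i\|_{H_{1,p}}<\infty$, there exist $f_\infty\in L^p(B_R(x_\infty))$ and a subsequence $\{f_{i(j)}\}_j$ of $\{f_i\}_i$ such that $f_{i(j)}$ $L^p$-converges strongly to $f_\infty$ on $B_R(x_\infty)$.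
   Context: Pointed measured Gromov-Hausdorff convergence: there are fixed $\epsilon_i\to0$, $R_i\to\infty$ and maps $\psi_i:B_{R_i}(x_i)\to B_{R_i}(x_\infty)$ with $|d(x,y)-d(\psi_i(x),\psi_i(y))|<\epsilon_i$ for all $x,y\in B_{R_i}(x_i)$, $B_{R_i}(x_\infty)\subset B_{\epsilon_i}(\mathrm{Image}\,\psi_i)$, $\psi_i(x_i)\to x_\infty$, and $\upsilon_i(B_r(y_i))\to\upsilon_\infty(B_r(y_\infty))$ for every $r>0$ and every $y_i\to y_\infty$; here $y_i\to y_\infty$ means $\psi_i(y_i)\to y_\infty$. $H_{1,p}$ is Cheeger's $(1,p)$-Sobolev space, $g_f$ is the minimal generalized upper gradient of $f$, and $\|f\|_{H_{1,p}}=\|f\|_{L^p}+\|g_f\|_{L^p}$. The weak Poincaré inequality of type $(1,p)$ on $(X,\upsilon)$ for $\tau$: for every $r>0$, every $y\in X$, every $t\le r$ and every $f\in H_{1,p}(B_t(y))$, $$\frac1{\upsilon(B_t(y))}\int_{B_t(y)}\left|f-\frac1{\upsilon(B_t(y))}\int_{B_t(y)}f\,d\upsilon\right|d\upsilon\le\tau(r)\,t\left(\frac1{\upsilon(B_t(y))}\int_{B_t(y)}|g_f|^pd\upsilon\right)^{1/p}.$$ Strong convergence. For $f_i\in L^1_{\mathrm{loc}}(B_R(x_i))$ ($i\le\infty$), $f_i$ converges strongly to $f_\infty$ at $z_\infty$ if for every $z_i\to z_\infty$ $$\lim_{t\to0}\limsup_{i\to\infty}\frac1{\upsilon_i(B_t(z_i))}\int_{B_t(z_i)}\Big|f_i-\frac1{\upsilon_\infty(B_t(z_\infty))}\int_{B_t(z_\infty)}f_\infty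 d\upsilon_\infty\Big|d\upsilon_i=0$$ and $$\lim_{t\to0}\limsup_{i\to\infty}\frac1{\upsilon_\infty(B_t(z_\infty))}\int_{B_t(z_\infty)}\Big|f_\infty-\frac1{\upsilon_i(B_t(z_i))}\int_{B_t(z_i)}f_id\upsilon_i\Big|d\upsilon_\infty=0.$$ For $f_\infty\in L^p(B_R(x_\infty))$, an $L^p$-approximate sequence of $f_\infty$ is a family $f_{i,j}\in L^\infty(B_R(x_i))$ ($i\le\infty$, $j<\infty$) with $\sup_{i\le\infty}\|f_{i,j}\|_{L^\infty}<\infty$ for each $j$, with $f_{i,j}$ converging strongly to $f_{\infty,j}$ at a.e. $z_\infty\in B_R(x_\infty)$ as $i\to\infty$ for each $j$, and with $\|f_\infty-f_{\infty,j}\|_{L^p}\to0$ as $j\to\infty$. An $L^p$-bounded sequence $f_i\in L^p(B_R(x_i))$ $L^p$-converges strongly to $f_\infty$ on $B_R(x_\infty)$ if $\lim_{j\to\infty}\limsup_{i\to\infty}\|f_i-f_{i,j}\|_{L^p(B_R(x_i))}=0$ for every (equivalently, some) $L^p$-approximate sequence $\{f_{i,j}\}$ of $f_\infty$. *)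

(* Defs.v *)
From HB Require Import structures.
From mathcomp Require Import all_boot all_order all_algebra.
From mathcomp Require Import all_classical all_reals all_analysis.
From mathcomp Require Import measurable_realfun ess_sup_inf.

Set Implicit Arguments.
Unset Strict Implicit.
Unset Printing Implicit Defensive.

Import Order.TTheory GRing.Theory Num.Theory.
Import numFieldNormedType.Exports.

Local Open Scope classical_set_scope.
Local Open Scope ring_scope.

(* Generated sigma-algebras are only available on pointed types.  The point
   provided by this structure is not the base point of the pointed space. *)
#[short(type="pmetricType")]
HB.structure Definition PointedMetric (K : numDomainType) :=
  { M of Pointed M & Metric K M }.

Definition borel (R : realType) (X : pmetricType R)
    : measurableType (@open X).-sigma :=
  g_sigma_algebraType (@open X).

Record pmmSpace (R : realType) := PMMSpace {
  pmm_space :> pmetricType R ;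
  base : pmm_space ;
  vol : {measure set (borel pmm_space) -> \bar R}
}.

Section metric.
Context (R : realType) (X : pmmSpace R).

Definition proper_space := forall (x : X) (r : R),
  compact [set y : X | mdist x y <= r].

Definition geodesic_space := forall x y : X, exists c : R -> X,
  [/\ c 0 = x, c (mdist x y) = y &
      forall s t, 0 <= s <= mdist x y -> 0 <= t <= mdist x y ->
        mdist (c s) (c t) = `|s - t|].

Definition radon_measure :=
  (forall K : set X, compact K -> (vol X K < +oo)%E) /\
  (forall A : set (borel X), measurable A ->
    vol X A = ereal_sup [set vol X K | K in [set K : set X |
                                             compact K /\ K `<=` A]]).

(* [ball x r] is the open ball, see [ballEmdist]. *)
Definition doubling_up_to (Rhat kappa : R) := forall (z : X) (r : R),
  0 < r < Rhat ->
  (vol X (ball z (2 * r)) <= (2 `^ kappa)%:E * vol X (ball z r))%E.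

Definition emean (A : set X) (f : X -> \bar R) : \bar R :=
  ((fine (vol X A))^-1%:E * \int[vol X]_(x in (A : set (borel X))) f x)%E.

Definition mean (A : set X) (f : X -> R) : R :=
  (fine (vol X A))^-1 * \int[vol X]_(x in (A : set (borel X))) f x.

(* Functions on a subset U of X are represented by functions on all of X, whose
   values outside U are ignored. *)
Definition LpN (U : set X) (p : \bar R) (f : X -> \bar R) : \bar R :=
  ('N[vol X]_p[(f \_ U : borel X -> \bar R)])%E.

Definition inLp (U : set X) (p : \bar R) (f : X -> \bar R) : Prop :=
  measurable_fun (U : set (borel X)) (f : borel X -> \bar R) /\
  (LpN U p f < +oo)%E.

Definition polygon_length (c : R -> X) (a b : R) (s : seq R) : R :=
  \sum_(0 <= k < size s)
    mdist (c (nth b (a :: s) k)) (c (nth b (a :: s) k.+1)).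

Definition curve_length (c : R -> X) (a b : R) : \bar R :=
  ereal_sup [set (polygon_length c a b s)%:E | s in itv_partition a b].

(* Such a curve is 1-Lipschitz on [0, l], hence continuous and rectifiable. *)
Definition arclength_param (c : R -> X) (l : R) := forall s t,
  0 <= s -> s <= t -> t <= l -> curve_length c s t = (t - s)%:E.

Definition upper_gradient (U : set X) (f : X -> R) (g : X -> \bar R) :=
  [/\ measurable_fun (U : set (borel X)) (g : borel X -> \bar R),
      (forall x, U x -> (0 <= g x)%E) &
      forall (l : R) (c : R -> X), 0 <= l ->
        (forall s, 0 <= s <= l -> U (c s)) -> arclength_param c l ->
        (`|f (c l) - f (c 0)|%:E
           <= \int[lebesgue_measure]_(s in `[0%R, l]) g (c s))%E].

Section sobolev.
Context (U : set X) (p : R).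

Definition approx_with_upper_gradients (f : X -> R)
    (fn : nat -> X -> R) (gn : nat -> X -> \bar R) :=
  [/\ (forall n, inLp U p%:E (EFin \o fn n)),
      (forall n, upper_gradient U (fn n) (gn n)) &
      LpN U p%:E (fun x => (fn n x - f x)%:E) @[n --> \oo] --> 0%E].

Definition cheeger_norm (f : X -> R) : \bar R :=
  (LpN U p%:E (EFin \o f) +
   ereal_inf [set e | exists fn gn, approx_with_upper_gradients f fn gn /\
                e = limn_einf (fun n => LpN U p%:E (gn n))])%E.

Definition H1p (f : X -> R) : Prop :=
  inLp U p%:E (EFin \o f) /\ (cheeger_norm f < +oo)%E.

Definition gen_upper_gradient (f : X -> R) (g : X -> \bar R) :=
  inLp U p%:E g /\
  exists fn gn, approx_with_upper_gradients f fn gn /\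
    (forall n, inLp U p%:E (gn n)) /\
    LpN U p%:E (fun x => gn n x - g x)%E @[n --> \oo] --> 0%E.

Definition min_gen_upper_gradient (f : X -> R) (g : X -> \bar R) :=
  gen_upper_gradient f g /\
  (LpN U p%:E (EFin \o f) + LpN U p%:E g)%E = cheeger_norm f.

(* For 1 < p < oo and f in H1p, a minimal generalized upper gradient exists and
   is unique almost everywhere (Cheeger 1999, Theorem 2.10), so the default
   value below is never used for such p and f. *)
Definition min_grad (f : X -> R) : X -> \bar R :=
  xget (cst 0%E) [set g | min_gen_upper_gradient f g].

Definition H1p_norm (f : X -> R) : \bar R :=
  (LpN U p%:E (EFin \o f) + LpN U p%:E (min_grad f))%E.

End sobolev.

Definition weak_poincare (p : R) (tau : R -> R) :=
  forall (r : R) (y : X) (t : R) (f : X -> R), 0 < r -> 0 < t <= r ->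
    H1p (ball y t) p f ->
    (emean (ball y t) (fun x => `|f x - mean (ball y t) f|%:E)
     <= (tau r * t)%:E *
        emean (ball y t) (fun x => `|min_grad (ball y t) p f x| `^ p)
          `^ p^-1)%E.

End metric.

Section convergence.
Context (R : realType) (X : nat -> pmmSpace R) (Xoo : pmmSpace R).
Context (rad : nat -> R) (psi : forall i, X i -> Xoo).

(* [psi i] is only meaningful on the ball of radius [rad i]; as [rad]
   tends to infinity, this is no restriction on convergent sequences. *)
Definition cvg_pts (y : forall i, X i) (yoo : Xoo) :=
  (\forall i \near \oo, ball (base (X i)) (rad i) (y i)) /\
  psi (y i) @[i --> \oo] --> yoo.

Definition pmGH_cvg (eps : nat -> R) :=
  [/\ eps i @[i --> \oo] --> 0,
      rad i @[i --> \oo] --> +oo,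
      (forall i (x : X i), ball (base (X i)) (rad i) x ->
         ball (base Xoo) (rad i) (psi x)) &
  [/\ (forall i (x y : X i), ball (base (X i)) (rad i) x ->
         ball (base (X i)) (rad i) y ->
         `|mdist x y - mdist (psi x) (psi y)| < eps i),
      (forall i (z : Xoo), ball (base Xoo) (rad i) z ->
         exists2 x : X i, ball (base (X i)) (rad i) x &
           mdist z (psi x) < eps i),
      psi (base (X i)) @[i --> \oo] --> base Xoo &
      forall (r : R) (y : forall i, X i) (yoo : Xoo), 0 < r ->
        cvg_pts y yoo ->
        vol (X i) (ball (y i) r) @[i --> \oo] --> vol Xoo (ball yoo r)]].

Definition strong_cvg_at (f : forall i, X i -> R) (foo : Xoo -> R)
    (zoo : Xoo) :=
  forall z : forall i, X i, cvg_pts z zoo ->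
    (limn_esup (fun i => emean (ball (z i) t)
       (fun x => `|f i x - mean (ball zoo t) foo|%:E))
       @[t --> 0^'+] --> 0%E) /\
    (limn_esup (fun i => emean (ball zoo t)
       (fun x => `|foo x - mean (ball (z i) t) (f i)|%:E))
       @[t --> 0^'+] --> 0%E).

Context (r p : R).
Local Notation B i := (ball (base (X i)) r).
Local Notation Boo := (ball (base Xoo) r).

Definition Lp_approx_seq (foo : Xoo -> R)
    (fa : forall i, nat -> X i -> R) (faoo : nat -> Xoo -> R) :=
  [/\ (forall j, (forall i, inLp (B i) +oo%E (EFin \o fa i j)) /\
         inLp Boo +oo%E (EFin \o faoo j)),
      (forall j, exists C : R,
         (forall i, (LpN (B i) +oo (EFin \o fa i j) <= C%:E)%E) /\
         (LpN Boo +oo (EFin \o faoo j) <= C%:E)%E),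
      (forall j, {ae vol Xoo, forall z, Boo z ->
         strong_cvg_at (fun i => fa i j) (faoo j) z}) &
      LpN Boo p%:E (fun x => (foo x - faoo j x)%:E) @[j --> \oo] --> 0%E].

(* For pmGH convergent spaces with a uniform doubling condition, approximate
   sequences exist and the last condition does not depend on the choice of one.
   Asking for existence and for the condition on all of them covers both the
   "every" and the "some" form of the definition. *)
Definition Lp_strong_cvg (f : forall i, X i -> R) (foo : Xoo -> R) :=
  [/\ (forall i, inLp (B i) p%:E (EFin \o f i)) /\
        inLp Boo p%:E (EFin \o foo),
      (exists C : R, forall i, (LpN (B i) p%:E (EFin \o f i) <= C%:E)%E),
      (exists fa faoo, Lp_approx_seq foo fa faoo) &
      forall fa faoo, Lp_approx_seq foo fa faoo ->
        limn_esup (fun i => LpN (B i) p%:E (fun x => (f i x - fa i j x)%:E))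
          @[j --> \oo] --> 0%E].

End convergence.

(* Main.v *)
(* The proof reduces Rellich compactness on varying spaces to approximation by
   finitely many averages.

   Iterating the weak Poincare inequality along a chain of nested balls that moves
   along a geodesic from a small ball to a large one, and summing over a Vitali
   packing of small balls, gives for every measurable [E] in a ball [U] of radius
   [r] and every [rho <= r]
     int_E |f|^p <= c (M^p vol E + rho^p int_U |g_f|^p),
   where [M] bounds the averages of [f] over the balls of radius [rho] in [U].
   With [E = U = ball y t] and [f] replaced by [f - mean f] this is a (p,p)-Poincare
   inequality without enlargement of the ball; with [rho] small it says that
   |f_i|^p is equi-integrable uniformly in [i].

   A Vitali packing of the limit ball by small balls is transported to the spaces
   [X i].  By the two consequences above, [f_i] is L^p-close, for all large [i],
   to the combination of bump functions supported on these balls whose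
   coefficients are the averages of [f_i].  After passing to a diagonal
   subsequence all averages converge, hence so do the combinations, and their
   limits form a Cauchy sequence in L^p of the limit ball; its limit is [foo].
   That L^p distances pass to the limit follows from covering almost all of the
   limit ball by balls on which all functions involved are nearly constant.

   The Poincare inequality on smaller balls is stated with their own minimal
   gradients, so one needs that minimal generalized upper gradients exist: by
   uniform convexity, upper gradients of almost minimal energy are Cauchy. *)

Require Import Defs.
From HB Require Import structures.
From mathcomp Require Import all_boot all_order all_algebra.
From mathcomp Require Import finmap.
From mathcomp Require Import all_classical all_reals all_analysis.
From mathcomp Require Import measurable_realfun ess_sup_inf.
From mathcomp Require Import ring lra.

Set Implicit Arguments.
Unset Strict Implicit.
Unset Printing Implicit Defensive.

Import Order.TTheory GRing.Theory Num.Theory.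
Import numFieldNormedType.Exports.

Local Open Scope classical_set_scope.
Local Open Scope ring_scope.

(** * Inequalities for p-th powers *)

(** Three obstacles shape the argument. The Poincare inequality bounds an [L^1] oscillation, and a
    finite packing always leaves a small set on which nothing is known about [f]. Hence the chain
    estimate is obtained for the truncations [min |f| M], for which the oscillation on tiny balls
    and the leftover set cost arbitrarily little, and [M] is removed by monotone convergence. The
    functions live on [ball x0 r] only, so concentric chains would leave the domain near its
    boundary; geodesics move the centres inwards while the balls grow. Finally, disjointness of
    balls is not stable under Gromov-Hausdorff approximation, whereas strict inequalities between
    radii and distances of centres are. The packings to be transported are therefore stated through
    such inequalities with a margin [e], and it is again a geodesic that turns disjoint balls into
    separated centres. The same margin is the width of the collar on which the bumps decay;
    continuous bumps make the combinations converge strongly at every point, with no discussion of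
    spheres. *)

Section powR_inequalities.
Context {R : realType} (p : R) (p1 : 1 < p).

Let p0 : 0 < p. Proof. exact: lt_trans p1. Qed.
Let pN0 : p != 0. Proof. by rewrite gt_eqF. Qed.

Let one_powR (x : R) : 1 `^ x = 1. Proof. by rewrite powR1. Qed.

Lemma powR_split (a : R) : 0 <= a -> a `^ p = a `^ (p - 1) * a.
Proof.
move=> a0; rewrite -[X in _ * X](powRr1 a0) -powRD subrK//.
by rewrite (negbTE pN0).
Qed.

(** Young's inequality for the conjugate exponents [p] and [p / (p - 1)], applied to [b] and
    [a ^ (p - 1)]. It says that the graph of [t ^ p] lies above its tangent at [a]; the convexity
    estimates of this section are all drawn from it. *)
Lemma powR_tangent (a b : R) : 0 <= a -> 0 <= b ->
  p * a `^ (p - 1) * b <= b `^ p + (p - 1) * a `^ p.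
Proof.
move=> a0 b0; have q0 : 0 < p / (p - 1) by rewrite divr_gt0// subr_gt0.
have := @conjugate_powR _ b (a `^ (p - 1)) p (p / (p - 1)) b0 (powR_ge0 _ _) p0 q0.
have pq : p^-1 + (p / (p - 1))^-1 = 1.
  by rewrite invf_div; field.
move=> /(_ pq); rewrite -powRrM mulrCA mulfV ?subr_eq0 ?gt_eqF// mulr1.
rewrite -(ler_pM2l p0) => h.
have -> : p * a `^ (p - 1) * b = p * (b * a `^ (p - 1)) by ring.
apply: (le_trans h); rewrite le_eqVlt; apply/orP; left; apply/eqP.
by field; rewrite pN0 subr_eq0 gt_eqF.
Qed.

Lemma powRD_le (a b : R) : 0 <= a -> 0 <= b ->
  (a + b) `^ p <= 2 `^ (p - 1) * (a `^ p + b `^ p).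
Proof.
move=> a0 b0; pose m := (a + b) / 2.
have m0 : 0 <= m by rewrite divr_ge0// addr_ge0.
have -> : a + b = 2 * m by rewrite /m; field.
rewrite powRM// (powR_split (ler0n _ 2)) -mulrA ler_wpM2l ?powR_ge0//.
have := powR_tangent m0 a0; have := powR_tangent m0 b0.
have E : p * m `^ (p - 1) * a + p * m `^ (p - 1) * b = 2 * p * m `^ p.
  by rewrite (powR_split m0) /m; field.
nra.
Qed.

(** Jensen's inequality for weights of total mass at most [L]: the tangents at [m = S / L] are
    summed with the weights [l]. Missing mass does no harm, because it only multiplies the
    nonnegative term [(p - 1) * m ^ p]. *)
Lemma powR_sum_le (I : Type) (s : seq I) (l v : I -> R) (L : R) :
  0 < L -> \sum_(i <- s) l i <= L -> (forall i, 0 <= l i) ->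
  (forall i, 0 <= v i) ->
  (\sum_(i <- s) l i * v i) `^ p <= L `^ (p - 1) * \sum_(i <- s) l i * v i `^ p.
Proof.
move=> L0 lL l0 v0; set S := \sum_(i <- s) l i * v i; pose m := S / L.
have S0 : 0 <= S by apply: sumr_ge0 => i _; rewrite mulr_ge0.
have m0 : 0 <= m by rewrite divr_ge0// ltW.
have SE : S = L * m by rewrite /m; field; rewrite gt_eqF.
rewrite [in leLHS]SE powRM ?(ltW L0)// (powR_split (ltW L0)) -mulrA.
rewrite ler_wpM2l ?powR_ge0//.
have : \sum_(i <- s) l i * (p * m `^ (p - 1) * v i) <=
       \sum_(i <- s) l i * (v i `^ p + (p - 1) * m `^ p).
  by apply: ler_sum => i _; rewrite ler_wpM2l// powR_tangent.
under eq_bigr do rewrite mulrCA; rewrite -mulr_sumr -/S.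
under [in leRHS]eq_bigr do rewrite mulrDr; rewrite big_split/= -mulr_suml.
rewrite SE -mulrA [_ * (L * m)]mulrCA -powR_split// => h.
have : (\sum_(i <- s) l i) * ((p - 1) * m `^ p) <= L * ((p - 1) * m `^ p).
  by rewrite ler_wpM2r// mulr_ge0 ?powR_ge0// subr_ge0 ltW.
lra.
Qed.

(** For [b <= a] the tangent at [a] bounds the difference by [p * a ^ (p - 1) * (a - b)]. *)
Lemma powR_lipschitz (a b C : R) : 0 <= a <= C -> 0 <= b <= C ->
  `|a `^ p - b `^ p| <= p * C `^ (p - 1) * `|a - b|.
Proof.
wlog ab : a b / b <= a.
  move=> H aC bC; have [/H|/ltW/H] := leP b a; first exact.
  by move=> h; rewrite distrC [X in _ * X]distrC; exact: h.
move=> /andP[a0 aC] /andP[b0 bC].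
rewrite !ger0_norm ?subr_ge0//; last first.
  by rewrite ge0_ler_powR// ?nnegrE// ltW.
have := powR_tangent a0 b0.
have : p * a `^ (p - 1) * (a - b) <= p * C `^ (p - 1) * (a - b).
  rewrite ler_wpM2r ?subr_ge0// ler_wpM2l ?(ltW p0)// ge0_ler_powR//.
  - by rewrite subr_ge0 ltW.
  - by rewrite nnegrE (le_trans a0).
rewrite (powR_split a0); lra.
Qed.

(* Quantitative strict convexity: for [a = 1 >= b] the convexity defect is
   bounded below as long as [b] stays away from [1]. *)
Lemma powR_uniform_convex (e : R) : 0 < e -> exists2 k : R, 0 < k &
  forall a b : R, 0 <= a -> 0 <= b ->
  `|a - b| `^ p <=
    e * (a `^ p + b `^ p) + k * ((a `^ p + b `^ p) / 2 - ((a + b) / 2) `^ p).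
Proof.
move=> e0; pose h := Num.min 1 e.
have h0 : 0 < h by rewrite lt_min ltr01.
have h1 : h <= 1 by rewrite ge_min lexx.
have he : h <= e by rewrite ge_min lexx orbT.
pose q := p - 1; have q0 : 0 < q by rewrite subr_gt0.
(* [c] is a lower bound for the defect [p / 2 * (b' - b) * (m ^ q - b' ^ q)] found below: there
   [m >= 1 / 2], [b' - b = (1 - b) / 4 >= h / 4] and [b' <= m * (1 - h / 4)]. *)
pose c := p / 2 * (h / 4) * (2^-1 `^ q * (1 - (1 - h / 4) `^ q)).
have c0 : 0 < c.
  rewrite !mulr_gt0 ?invr_gt0 ?powR_gt0 ?invr_gt0// subr_gt0.
  rewrite -[ltRHS](one_powR q) gt0_ltr_powR ?nnegrE//; lra.
have key b : 0 <= b -> b <= 1 -> (1 - b) `^ p <=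
    e * (1 + b `^ p) + c^-1 * ((1 + b `^ p) / 2 - ((1 + b) / 2) `^ p).
  move=> b0 b1; pose m := (1 + b) / 2.
  have m0 : 0 <= m by rewrite /m; lra.
  have hm : 0 <= (1 + b `^ p) / 2 - m `^ p.
    have := powR_tangent m0 b0; have := powR_tangent m0 (ler01).
    have : p * m `^ (p - 1) * 1 + p * m `^ (p - 1) * b = 2 * p * m `^ p.
      by rewrite (powR_split m0) /m; field.
    by rewrite powR1; lra.
  have [hb|hb] := leP (1 - b) h.
    rewrite -[leLHS]addr0 lerD ?mulr_ge0 ?invr_ge0 ?(ltW c0)//.
    apply: (@le_trans _ _ h); last first.
      apply: (le_trans he); rewrite ler_peMr ?(ltW e0)// lerDl powR_ge0//.
    apply: (@le_trans _ _ (h `^ p)).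
      by rewrite ge0_ler_powR ?nnegrE ?(ltW p0)// ?(ltW h0)// subr_ge0.
    by rewrite -[leRHS](powRr1 (ltW h0)) ger_powR// ?h0// ltW.
  have : c <= (1 + b `^ p) / 2 - m `^ p; last first.
    move=> hc; rewrite -[leLHS]add0r lerD ?mulr_ge0 ?addr_ge0 ?powR_ge0 ?(ltW e0)//.
    rewrite ler_pdivlMl//; apply: le_trans hc.
    rewrite ler_piMr ?(ltW c0)// -[leRHS](one_powR p) ge0_ler_powR ?nnegrE ?(ltW p0)//; lra.
  (* Replace [b] by [b'], halfway towards [m]. The tangent at [b'] controls the change of [b ^ p],
     the tangent at [m] the change of the midpoint power, and convexity holds for the pair [1],
     [b']; what remains is the difference of the slopes at [m] and [b']. *)
  pose b' := (b + m) / 2.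
  have b'0 : 0 <= b' by rewrite /b'; lra.
  pose m' := (1 + b') / 2; have m'0 : 0 <= m' by rewrite /m'; lra.
  have h' : 0 <= (1 + b' `^ p) / 2 - m' `^ p.
    have := powR_tangent m'0 b'0; have := powR_tangent m'0 (ler01).
    have : p * m' `^ (p - 1) * 1 + p * m' `^ (p - 1) * b' = 2 * p * m' `^ p.
      by rewrite (powR_split m'0) /m'; field.
    by rewrite powR1; lra.
  have T1 := powR_tangent b'0 b0; have T2 := powR_tangent m0 m'0.
  have D : p / 2 * (b' - b) * (m `^ q - b' `^ q) <= (1 + b `^ p) / 2 - m `^ p.
    have E1 := powR_split b'0; have E2 := powR_split m0.
    have Em : m' = m + (b' - b) / 2 by rewrite /m' /m; field.
    have F : p / 2 * (b' - b) * (m `^ q - b' `^ q) =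
        p * m `^ q * m' - p * (m `^ q * m) +
        (p * b' `^ q * b - p * (b' `^ q * b')) / 2 by rewrite Em; field.
    rewrite F /q -E1 -E2; lra.
  apply: le_trans D; rewrite /c ler_pM ?mulr_ge0 ?invr_ge0 ?powR_ge0 ?(ltW p0)//.
  - by lra.
  - rewrite subr_ge0 -[leRHS](one_powR q) ge0_ler_powR ?nnegrE ?(ltW q0)//; lra.
  - by rewrite ler_wpM2l ?divr_ge0 ?(ltW p0)// /b' /m; lra.
  have : b' `^ q <= (m * (1 - h / 4)) `^ q.
    rewrite ge0_ler_powR ?nnegrE ?(ltW q0)//; first by rewrite mulr_ge0//; lra.
    by rewrite /b' /m; nra.
  rewrite (@powRM _ m)//; last by lra.
  have : 2^-1 `^ q <= m `^ q.
    by rewrite ge0_ler_powR ?nnegrE ?(ltW q0)// /m; lra.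
  have : (1 - h / 4) `^ q <= 1.
    by rewrite -[leRHS](one_powR q) ge0_ler_powR ?nnegrE ?(ltW q0)//; lra.
  move: (b' `^ q) (m `^ q) ((1 - h / 4) `^ q) (2^-1 `^ q) => B M H I H1 IM BMH.
  have : 0 <= (M - I) * (1 - H) by rewrite mulr_ge0// subr_ge0.
  lra.
exists c^-1; first by rewrite invr_gt0.
move=> a b; wlog ab : a b / b <= a.
  move=> H a0 b0; have [/H|/ltW/H] := leP b a; first exact.
  by move=> h'; rewrite distrC (addrC (a `^ p)) (addrC a b); exact: h'.
move=> a0 b0; have [a0'|aN0] := eqVneq a 0.
  have -> : b = 0 by apply/eqP; rewrite eq_le b0 andbT -a0'.
  by rewrite a0' subrr normr0 powR0// !addr0 mul0r powR0// !(mulr0,mul0r,subr0,addr0).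
have {a0 aN0}a0 : 0 < a by rewrite lt_neqAle eq_sym aN0.
have [t [t0 t1 bE]] : exists t, [/\ 0 <= t, t <= 1 & b = a * t].
  exists (b / a); split; first by rewrite divr_ge0// ltW.
    by rewrite ler_pdivrMr// mul1r.
  by field; rewrite gt_eqF.
have H := key t t0 t1.
have t1' : 0 <= 1 - t by rewrite subr_ge0.
have t2' : 0 <= (1 + t) / 2 by rewrite divr_ge0// addr_ge0.
rewrite bE ger0_norm; last by rewrite -bE subr_ge0.
have -> : a - a * t = a * (1 - t) by ring.
have -> : (a + a * t) / 2 = a * ((1 + t) / 2) by ring.
rewrite (powRM p (ltW a0) t0) (powRM p (ltW a0) t1') (powRM p (ltW a0) t2').
have := powR_gt0 p a0; move: (a `^ p) => A A0.
have -> : e * (A + A * t `^ p) + c^-1 * ((A + A * t `^ p) / 2 - A * ((1 + t) / 2) `^ p)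
  = A * (e * (1 + t `^ p) + c^-1 * ((1 + t `^ p) / 2 - ((1 + t) / 2) `^ p)) by ring.
by rewrite ler_pM2l.
Qed.

End powR_inequalities.

(** * Limits of real and extended real sequences *)

Lemma nneseries_lty_cvg {R : realType} (a : nat -> R) :
  (forall n, 0 <= a n) -> (\sum_(n <oo) (a n)%:E < +oo)%E -> cvgn (series a).
Proof.
move=> a0 sfin; apply: nondecreasing_is_cvgn.
  exact: nondecreasing_series.
exists (fine (\sum_(n <oo) (a n)%:E)%E) => _ [n _ <-].
rewrite -lee_fin fineK; last first.
  by rewrite ge0_fin_numE// nneseries_ge0// => i _ _; rewrite lee_fin.
rewrite /series/= -sumEFin.
by apply: nneseries_lim_ge => i _; rewrite lee_fin.
Qed.

Lemma limn_esup_le {R : realType} (u : nat -> \bar R) (e : \bar R) :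
  (exists N, forall n, (N <= n)%N -> (u n <= e)%E) -> (limn_esup u <= e)%E.
Proof.
move=> [N Nu]; apply: (@le_trans _ _ (ereal_sup (u @` [set n | (N <= n)%N]))).
  by apply: ereal_inf_lbound; exists [set n | (N <= n)%N] => //; exists N.
by apply: ge_ereal_sup => _ [n /= Nn <-]; exact: Nu.
Qed.

Lemma limn_esup_lt {R : realType} (u : nat -> \bar R) (e : \bar R) :
  (limn_esup u < e)%E -> exists N, forall n, (N <= n)%N -> (u n < e)%E.
Proof.
move=> /ereal_inf_lt[_ [V [N _ NV] <-] Ve]; exists N => n Nn.
apply: le_lt_trans Ve; apply: ereal_sup_ubound; exists n => //.
exact: NV.
Qed.

Lemma limn_einf_ge {R : realType} (u : nat -> \bar R) (e : \bar R) :
  (exists N, forall n, (N <= n)%N -> (e <= u n)%E) -> (e <= limn_einf u)%E.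
Proof.
move=> [N Nu]; rewrite /limn_einf leeNr; apply: limn_esup_le.
by exists N => n Nn; rewrite leeN2 Nu.
Qed.

Lemma limn_einf_ge0 {R : realType} (u : nat -> \bar R) :
  (forall n, 0 <= u n)%E -> (0 <= limn_einf u)%E.
Proof. by move=> u0; apply: limn_einf_ge; exists 0%N. Qed.

Lemma cvg_powR_norm {R : realType} (p : R) (a : nat -> R) (l : R) : 1 < p ->
  a k @[k --> \oo] --> l -> `|a k| `^ p @[k --> \oo] --> `|l| `^ p.
Proof.
move=> p1 /cvgr_dist_lt al; apply/cvgrPdist_le => e e0.
pose L := p * (`|l| + 1) `^ (p - 1).
have L0 : 0 < L by rewrite mulr_gt0 ?powR_gt0// ?(lt_trans _ p1)// ltr_wpDl.
near=> k.
have k1 : `|l - a k| < 1 by near: k; exact: al.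
have ke : `|l - a k| < e / L by near: k; apply: al; rewrite divr_gt0.
apply: (@le_trans _ _ (L * `| `|l| - `|a k| |)).
  apply: powR_lipschitz; rewrite ?normr_ge0//= ?lerDl//.
  by have := ler_normB l (l - a k); rewrite subKr; lra.
apply: (@le_trans _ _ (L * `|l - a k|)).
  by rewrite ler_wpM2l ?(ltW L0)// ler_dist_dist.
by rewrite mulrC -ler_pdivlMr// ltW.
Unshelve. all: by end_near. Qed.

(** The [p]-th root is omitted: without it the energy is additive over disjoint sets and limit
    theorems for integrals apply directly. [LpN] is recovered from it in [LpN_pint]. *)
Definition pint d (T : measurableType d) (R : realType)
    (mu : {measure set T -> \bar R}) (p : R) (D : set T) (h : T -> R) : \bar R :=
  (\int[mu]_(x in D) (`|h x| `^ p)%:E)%E.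

(** * Integrals of p-th powers *)

Section pint_theory.
Context d (T : measurableType d) (R : realType).
Context (mu : {measure set T -> \bar R}) (p : R) (p1 : 1 < p).
Local Notation Ip := (pint mu p).

Let p0 : 0 < p. Proof. exact: lt_trans p1. Qed.

Lemma measurable_powR_norm (D : set T) (h : T -> R) : measurable_fun D h ->
  measurable_fun D (fun x => `|h x| `^ p).
Proof.
move=> mh; apply: (measurableT_comp (measurable_powR p)).
exact: measurableT_comp.
Qed.

Lemma measurable_EFin_powR_norm (D : set T) (h : T -> R) :
  measurable_fun D h -> measurable_fun D (fun x => (`|h x| `^ p)%:E).
Proof. by move=> mh; apply/measurable_EFinP; exact: measurable_powR_norm. Qed.

Lemma pint_ge0 (D : set T) (h : T -> R) : (0 <= Ip D h)%E.
Proof. by apply: integral_ge0 => x _; rewrite lee_fin powR_ge0. Qed.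

Lemma eq_pint (D : set T) (f h : T -> R) : {in D, f =1 h} -> Ip D f = Ip D h.
Proof. by move=> fh; apply: eq_integral => x xD; rewrite fh. Qed.

Lemma pint_distrC (D : set T) (f h : T -> R) :
  Ip D (fun x => f x - h x) = Ip D (fun x => h x - f x).
Proof. by apply: eq_integral => x _; rewrite distrC. Qed.

Lemma subset_pint (D E : set T) (h : T -> R) : measurable D -> measurable E ->
  measurable_fun E h -> D `<=` E -> (Ip D h <= Ip E h)%E.
Proof.
move=> mD mE mh DE; apply: ge0_subset_integral => //.
exact: measurable_EFin_powR_norm.
Qed.

Lemma le_pint (D : set T) (f h : T -> R) : measurable D ->
  measurable_fun D f -> measurable_fun D h ->
  (forall x, D x -> `|f x| <= `|h x|) -> (Ip D f <= Ip D h)%E.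
Proof.
move=> mD mf mh fh; apply: ge0_le_integral => //.
- exact: measurable_EFin_powR_norm.
- exact: measurable_EFin_powR_norm.
- by move=> x Dx; rewrite lee_fin ge0_ler_powR ?nnegrE ?(ltW p0)// fh.
Qed.

Lemma pintD_le (D : set T) (f h : T -> R) : measurable D ->
  measurable_fun D f -> measurable_fun D h ->
  (Ip D (fun x => f x + h x)%R <= (2 `^ (p - 1))%:E * (Ip D f + Ip D h))%E.
Proof.
move=> mD mf mh; rewrite /pint -ge0_integralD//; last 2 first.
- exact: measurable_EFin_powR_norm.
- exact: measurable_EFin_powR_norm.
rewrite -ge0_integralZl_EFin ?powR_ge0//; last 2 first.
- by move=> x _; rewrite adde_ge0.
- by apply: emeasurable_funD; exact: measurable_EFin_powR_norm.
apply: ge0_le_integral => //.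
- by apply: measurable_EFin_powR_norm; exact: measurable_funD.
- apply: measurable_funeM; apply: emeasurable_funD; exact: measurable_EFin_powR_norm.
- move=> x _; rewrite -EFinD -EFinM lee_fin.
  apply: le_trans (powRD_le p1 _ _) => //.
  by rewrite ge0_ler_powR ?nnegrE ?(ltW p0) ?addr_ge0// ler_normD.
Qed.

Lemma pintB_le (D : set T) (f g h : T -> R) : measurable D ->
  measurable_fun D f -> measurable_fun D g -> measurable_fun D h ->
  (Ip D (fun x => f x - h x)%R <=
    (2 `^ (p - 1))%:E *
      (Ip D (fun x => f x - g x)%R + Ip D (fun x => g x - h x)%R))%E.
Proof.
move=> mD mf mg mh.
have := @pintD_le D (fun x => f x - g x) (fun x => g x - h x) mD.
have -> : (fun x => f x - g x + (g x - h x)) = (fun x => f x - h x).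
  by apply/funext => x; rewrite subrKA.
by apply; exact: measurable_funB.
Qed.

(* Chebyshev weights: [v <= 1 + v^p] applied to [v = 2^k |H_(k+1) - H_k|]
   turns the summability of the energies into almost sure summability. *)
Lemma pint_fast_cauchy_cvg (D : set T) (H : nat -> T -> R) : measurable D ->
  (forall n, measurable_fun D (H n)) ->
  (forall k, (Ip D (fun x => H k.+1 x - H k x)%R <=
     (2^-1 ^+ k * (2^-1 ^+ k) `^ p)%:E)%E) ->
  {ae mu, forall x, D x -> cvgn (fun k => H k x)}.
Proof.
move=> mD mH HH.
pose u k x := (((2 ^+ k) `^ p * `|H k.+1 x - H k x| `^ p) * 2^-1 ^+ k)%:E.
have mu_ k : measurable_fun D (u k).
  apply/measurable_EFinP; apply: measurable_funM => //.
  apply: measurable_funM => //; apply: measurable_powR_norm.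
  exact: measurable_funB.
have u0 k x : (0 <= u k x)%E.
  by rewrite lee_fin !mulr_ge0 ?powR_ge0// exprn_ge0// invr_ge0.
have iu k : (\int[mu]_(x in D) u k x <= (1 / 2 ^+ k * 2^-1 ^+ k)%:E)%E.
  under eq_integral do rewrite /u mulrAC EFinM.
  rewrite ge0_integralZl_EFin//; last first.
    by apply: measurable_EFin_powR_norm; exact: measurable_funB.
  apply: (@le_trans _ _ (((2 ^+ k) `^ p * 2^-1 ^+ k)%:E *
      (2^-1 ^+ k * (2^-1 ^+ k) `^ p)%:E)%E).
    by apply: lee_wpmul2l => //; exact: HH.
  rewrite -EFinM lee_fin.
  have E : (2 ^+ k) `^ p * (2^-1 ^+ k) `^ p = 1 :> R.
    rewrite -powRM ?exprn_ge0 ?invr_ge0// -exprMn mulfV// expr1n.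
    by rewrite powR1.
  set A := (2 ^+ k) `^ p in E *; set B := _ `^ p in E *; set c := 2^-1 ^+ k.
  have -> : A * c * (c * B) = A * B * (c * c) by ring.
  by rewrite E mul1r div1r -exprVn.
have su : (\int[mu]_(x in D) (\sum_(k <oo) u k x) < +oo)%E.
  rewrite integral_nneseries//.
  apply: (@le_lt_trans _ _ (\sum_(k <oo) (2 / (2 ^ (k + 1))%:R)%:E)%E).
    apply: lee_nneseries => k _; first by move=> _; exact: integral_ge0.
    apply: (le_trans (iu k)); rewrite lee_fin natrX exprD expr1 invfM mulrCA mulfV// mulr1.
    rewrite div1r ler_piMr// ?invr_ge0 ?exprn_ge0//.
    by rewrite exprn_ile1// ?invr_ge0// invf_le1// ler1n.
  have /cvg_lim := @cvg_geometric_eseries_half R 2 0.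
  by rewrite /eseries/= => ->//; rewrite ltry.
have : mu.-integrable D (fun x => \sum_(k <oo) u k x)%E.
  apply/integrableP; split.
    by apply: ge0_emeasurable_sum => // k x _ _; exact: u0.
  under eq_integral do rewrite gee0_abs ?nneseries_ge0//.
  exact: su.
move=> /(integrable_ae mD); apply: filterS => x /[swap] Dx /(_ Dx) fx.
have c1 : cvgn (series (fun k => (2 ^+ k) `^ p * `|H k.+1 x - H k x| `^ p * 2^-1 ^+ k)).
  apply: nneseries_lty_cvg; last by rewrite ltey_eq fx.
  by move=> k; move: (u0 k x); rewrite lee_fin.
have c2 : cvgn (series (geometric 1 (2^-1 : R))).
  by apply: is_cvg_geometric_series; rewrite ger0_norm ?invr_ge0// invf_lt1// ltr1n.
have c3 : cvgn (series (fun k => `|H k.+1 x - H k x|)).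
  apply: (series_le_cvg _ _ _ (is_cvg_seriesD c2 c1)) => k /=.
  - by [].
  - by rewrite addr_ge0 ?(mulr_ge0, powR_ge0, exprn_ge0)// invr_ge0.
  - pose v : R := `|H k.+1 x - H k x|; have v0 : 0 <= v by rewrite /v.
    rewrite -[leLHS]/v.
    rewrite -[leRHS]/(1 * 2^-1 ^+ k + (2 ^+ k) `^ p * v `^ p * 2^-1 ^+ k).
    rewrite mul1r -powRM ?exprn_ge0//.
    rewrite [leRHS]addrC -[X in _ + X]mul1r -mulrDl exprVn ler_pdivlMr ?exprn_gt0//.
    rewrite mulrC; pose w := 2 ^+ k * v.
    rewrite -/w; have w0 : 0 <= w by rewrite mulr_ge0 ?exprn_ge0.
    have [w1|w1] := leP w 1; first by rewrite (le_trans w1)// lerDr powR_ge0.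
    rewrite -[leLHS]addr0 lerD// -[leLHS](powRr1 w0) ler_powR//; exact: ltW.
have c4 : cvgn (series (telescope (fun k => H k x))) by apply: normed_cvg.
have -> : (fun k => H k x) = (fun k => H 0%N x + series (telescope (fun k => H k x)) k).
  by apply/funext => k; rewrite telescopeK/= subrKC.
by apply: is_cvgD => //; exact: is_cvg_cst.
Qed.


(** Riesz-Fischer: a subsequence with rapidly decaying increments converges almost everywhere, and
    Fatou's lemma along it bounds the distance from each late [h n] to the limit. *)
Lemma pint_complete (D : set T) (h : nat -> T -> R) : measurable D ->
  (forall n, measurable_fun D (h n)) ->
  (forall e : R, 0 < e -> exists N, forall m n, (N <= m)%N -> (N <= n)%N ->
     (Ip D (fun x => h m x - h n x)%R <= e%:E)%E) ->
  exists2 g : T -> R, measurable_fun D g &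
  forall e : R, 0 < e -> exists N, forall n, (N <= n)%N ->
     (Ip D (fun x => h n x - g x)%R <= e%:E)%E.
Proof.
move=> mD mh hC.
pose eps k : R := 2^-1 ^+ k * (2^-1 ^+ k) `^ p.
have eps0 k : 0 < eps k.
  by rewrite mulr_gt0 ?powR_gt0// exprn_gt0// invr_gt0.
have /choice[M MP] : forall k, exists N, forall m n, (N <= m)%N -> (N <= n)%N ->
   (Ip D (fun x => h m x - h n x)%R <= (eps k)%:E)%E by move=> k; exact: hC.
pose s k := (\sum_(i < k.+1) M i + k)%N.
have sM k l : (k <= l)%N -> (M k <= s l)%N.
  move=> kl; rewrite /s (bigD1 (Ordinal (leq_ltn_trans kl (ltnSn l))))//=.
  by rewrite -!addnA leq_addr.
have sk k : (k <= s k)%N by rewrite leq_addl.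
pose H k := h (s k).
have Hc : {ae mu, forall x, D x -> cvgn (fun k => H k x)}.
  apply: pint_fast_cauchy_cvg => // k.
    exact: mh.
  by apply: (MP k (s k.+1) (s k)); apply: sM; rewrite ?leqnSn.
(* The upper limit is measurable on [D] whether or not the subsequence converges; off a null set it
   is the limit. *)
pose g x := fine (limn_esup (fun k => (H k x)%:E)).
have mg : measurable_fun D g.
  apply: (@measurableT_comp _ _ _ _ _ _ (@fine R)) => //.
  apply: measurable_fun_limn_esup => k.
  by apply/measurable_EFinP; exact: mh.
have Hg : {ae mu, forall x, D x -> H k x @[k --> \oo] --> g x}.
  move: Hc; apply: filterS => x + Dx => /(_ Dx) /cvg_ex[l Hl].
  suff -> : g x = l by [].
  have Hl' : (H k x)%:E @[k --> \oo] --> l%:E.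
    by apply/fine_cvgP; split; [exact: nearW|exact: Hl].
  by rewrite /g (cvg_limn_einf_sup Hl').2.
exists g => // e e0; have [N NP] := hC e e0; exists N => n Nn.
pose F k x := (`|h n x - H k x| `^ p)%:E.
have mF k : measurable_fun D (F k).
  by apply: measurable_EFin_powR_norm; apply: measurable_funB; exact: mh.
apply: (@le_trans _ _ (\int[mu]_(x in D) limn_einf (F^~ x))%E).
  apply: ae_ge0_le_integral => //.
  - by apply: measurable_EFin_powR_norm; exact: measurable_funB.
  - by move=> x _; apply: limn_einf_ge0 => k; rewrite lee_fin powR_ge0.
  - apply: measurableT_comp => //.
    by apply: measurable_fun_limn_esup => k; exact: measurableT_comp.
  - move: Hg; apply: filterS => x + Dx => /(_ Dx) Hx.
    have : F k x @[k --> \oo] --> (`|h n x - g x| `^ p)%:E.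
      apply: cvg_EFin; first exact: nearW.
      apply: (@cvg_powR_norm _ p (fun k => h n x - H k x) _ p1).
      by apply: cvgB => //; exact: cvg_cst.
    by move=> /cvg_limn_einf_sup[-> _].
apply: le_trans (fatou mu mD mF _) _; first by move=> k x _; rewrite lee_fin powR_ge0.
apply: (le_trans (limn_einf_sup _)); apply: limn_esup_le; exists N => k Nk.
by apply: NP => //; rewrite (leq_trans Nk).
Qed.

(** The energies are at most [I + dl] while midpoints keep at least [I - dl], so the integrated
    convexity defect is at most [2 * dl]. Pointwise uniform convexity turns a small defect into a
    small distance. *)
Lemma pint_uniform_convex_cauchy (D : set T) (h : nat -> T -> R) (I : R) :
  measurable D -> (forall n, measurable_fun D (h n)) ->
  (forall n x, D x -> 0 <= h n x) -> 0 <= I ->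
  (forall e : R, 0 < e -> exists N, forall n, (N <= n)%N ->
     (Ip D (h n) <= (I + e)%:E)%E) ->
  (forall e : R, 0 < e -> exists N, forall m n, (N <= m)%N -> (N <= n)%N ->
     ((I - e)%:E <= Ip D (fun x => (h m x + h n x) / 2)%R)%E) ->
  forall e : R, 0 < e -> exists N, forall m n, (N <= m)%N -> (N <= n)%N ->
     (Ip D (fun x => h m x - h n x)%R <= e%:E)%E.
Proof.
move=> mD mh h0 I0 hup hlo e e0.
pose e' := e / (4 * (I + 1)).
have e'0 : 0 < e' by rewrite divr_gt0// mulr_gt0// ltr_wpDl.
have [k k0 kP] := powR_uniform_convex p1 e'0.
(* The error terms are [2 * e' * (I + dl)] and [2 * k * dl]; with [e' * (I + 1) = e / 4] and
   [k * dl <= e / 4] each is at most [e / 2]. *)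
pose dl := Num.min 1 (e / (4 * k)).
have dl0 : 0 < dl by rewrite lt_min ltr01 divr_gt0// mulr_gt0.
have dl1 : dl <= 1 by rewrite ge_min lexx.
have dk : k * dl <= e / 4.
  rewrite mulrC -ler_pdivlMr// -mulrA -invfM ge_min lexx orbT//.
have [N1 N1P] := hup dl dl0; have [N2 N2P] := hlo dl dl0.
exists (N1 + N2)%N => m n Nm Nn.
have Nm1 : (N1 <= m)%N by rewrite (leq_trans _ Nm)// leq_addr.
have Nn1 : (N1 <= n)%N by rewrite (leq_trans _ Nn)// leq_addr.
have Nm2 : (N2 <= m)%N by rewrite (leq_trans _ Nm)// leq_addl.
have Nn2 : (N2 <= n)%N by rewrite (leq_trans _ Nn)// leq_addl.
have mB : measurable_fun D (fun x => h m x - h n x) by exact: measurable_funB.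
have mM : measurable_fun D (fun x => (h m x + h n x) / 2).
  by apply: measurable_funM => //; exact: measurable_funD.
have key : (Ip D (fun x => h m x - h n x)%R +
     k%:E * Ip D (fun x => (h m x + h n x) / 2)%R <=
   (e' + k / 2)%:E * (Ip D (h m) + Ip D (h n)))%E.
  rewrite /pint -ge0_integralZl_EFin ?(ltW k0)//; last first.
    exact: measurable_EFin_powR_norm.
  rewrite -ge0_integralD//; last 3 first.
  - exact: measurable_EFin_powR_norm.
  - by move=> x _; rewrite mule_ge0// lee_fin ltW.
  - by apply: measurable_funeM; exact: measurable_EFin_powR_norm.
  rewrite -ge0_integralD//; [|exact: measurable_EFin_powR_norm..].
  rewrite -ge0_integralZl_EFin//; last 3 first.
  - by move=> x _; rewrite adde_ge0.
  - by apply: emeasurable_funD; exact: measurable_EFin_powR_norm.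
  - by rewrite ltW// addr_gt0// divr_gt0.
  apply: ge0_le_integral => //.
  - by move=> x _; rewrite adde_ge0// mule_ge0// lee_fin ltW.
  - apply: emeasurable_funD; first exact: measurable_EFin_powR_norm.
    by apply: measurable_funeM; exact: measurable_EFin_powR_norm.
  - by apply: measurable_funeM; apply: emeasurable_funD; exact: measurable_EFin_powR_norm.
  move=> x Dx; rewrite -EFinM -!EFinD -EFinM lee_fin.
  have := kP _ _ (h0 m x Dx) (h0 n x Dx).
  rewrite (ger0_norm (h0 m x Dx)) (ger0_norm (h0 n x Dx)).
  rewrite (@ger0_norm _ ((h m x + h n x) / 2)) ?divr_ge0 ?addr_ge0 ?h0//.
  lra.
have B : (Ip D (fun x => h m x - h n x)%R + k%:E * (I - dl)%:E <=
   (e' + k / 2)%:E * ((I + dl)%:E + (I + dl)%:E))%E.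
  apply: (le_trans _ (le_trans key _)).
    by rewrite leeD2l// lee_wpmul2l ?N2P// lee_fin ltW.
  rewrite lee_wpmul2l//; first by rewrite lee_fin ltW// addr_gt0// divr_gt0.
  by rewrite leeD ?N1P.
move: B; move: (Ip D _) (pint_ge0 D (fun x => h m x - h n x)) => [x||]//.
rewrite -EFinM -!EFinD -EFinM !lee_fin => x0 xB.
have E : e' * (I + 1) = e / 4 by rewrite /e'; field; rewrite gt_eqF// ltr_wpDl.
have : e' * dl <= e' * 1 by rewrite ler_wpM2l// ltW.
lra.
Qed.

End pint_theory.

(** * Convergence to zero and [p]-th roots in the extended reals *)

Section ereal_convergence.
Context {R : realType}.
Implicit Type u : nat -> \bar R.

Lemma cvg0_geP u : (forall n, 0 <= u n)%E ->
  u n @[n --> \oo] --> 0%E <->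
  forall e : R, 0 < e -> exists N, forall n, (N <= n)%N -> (u n <= e%:E)%E.
Proof.
move=> u0; split=> [u_cvg e e0|H].
  have /fine_cvgP[[N _ NP] /cvgrPdist_le /(_ e e0)[M _ MP]] : u n @[n --> \oo] --> 0%:E by [].
  exists (N + M)%N => n Nn; rewrite -(fineK (NP n _)) ?lee_fin; last first.
    by rewrite /= (leq_trans _ Nn)// leq_addr.
  have := MP n; rewrite /= sub0r normrN => /(_ (leq_trans (leq_addl _ _) Nn)).
  by apply: le_trans; exact: ler_norm.
apply/fine_cvgP; split.
  have [N NP] := H 1 ltr01; exists N => // n /= Nn.
  by rewrite ge0_fin_numE// (le_lt_trans (NP n Nn))// ltry.
apply/cvgrPdist_le => e e0; have [N NP] := H e e0; exists N => // n /= Nn.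
rewrite sub0r normrN ger0_norm ?fine_ge0//.
rewrite -lee_fin fineK ?NP//.
by rewrite ge0_fin_numE// (le_lt_trans (NP n Nn))// ltry.
Qed.

Lemma lee_poweRV (p : R) (x : \bar R) (e : R) : 0 < p -> (0 <= x)%E -> 0 <= e ->
  (x `^ p^-1 <= e%:E)%E = (x <= (e `^ p)%:E)%E.
Proof.
move=> p0 x0 e0; apply/idP/idP => h.
  have := @gt0_ler_poweR R p (ltW p0) (x `^ p^-1)%E e%:E.
  rewrite -poweRrM mulVf ?gt_eqF// poweRe1//; apply => //.
    by rewrite in_itv/= poweR_ge0 leey.
  by rewrite in_itv/= lee_fin e0 leey.
have := @gt0_ler_poweR R p^-1 _ x (e `^ p)%:E.
rewrite invr_ge0 ltW// poweR_EFin -powRrM mulfV ?gt_eqF// powRr1//; apply => //.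
  by rewrite in_itv/= x0 leey.
by rewrite in_itv/= lee_fin powR_ge0 leey.
Qed.

Lemma le_poweRV (p : R) (x y : \bar R) : 0 < p -> (0 <= x)%E -> (x <= y)%E ->
  (x `^ p^-1 <= y `^ p^-1)%E.
Proof.
move=> p0 x0 xy; apply: gt0_ler_poweR => //; first by rewrite invr_ge0 ltW.
  by rewrite in_itv/= x0 leey.
by rewrite in_itv/= (le_trans x0) ?leey.
Qed.

Lemma cvg0_poweRVP (p : R) u : 0 < p -> (forall n, 0 <= u n)%E ->
  (u n `^ p^-1)%E @[n --> \oo] --> 0%E <->
  forall e : R, 0 < e -> exists N, forall n, (N <= n)%N -> (u n <= e%:E)%E.
Proof.
move=> p0 u0; rewrite cvg0_geP; last by move=> n; exact: poweR_ge0.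
split=> H e e0.
  have [|N NP] := H (e `^ p^-1); first by rewrite powR_gt0.
  exists N => n /NP; rewrite lee_poweRV ?powR_ge0//.
  by rewrite -powRrM mulVf ?gt_eqF// powRr1// ltW.
have [|N NP] := H (e `^ p); first by rewrite powR_gt0.
by exists N => n /NP; rewrite lee_poweRV// ltW.
Qed.

End ereal_convergence.

(** * Balls, Borel sets and curves in a metric space *)

Section metric_facts.
Context {R : realType} {X : pmetricType R}.
Implicit Types x y z : X.

Lemma in_ball x (r : R) y : ball x r y = (mdist x y < r) :> Prop.
Proof. by rewrite ballEmdist. Qed.

Lemma mdist_open_ball x (r : R) : open (ball x r).
Proof.
rewrite openE => y; rewrite in_ball => xy; apply/nbhs_ballP.
exists (r - mdist x y) => /=; first by rewrite subr_gt0.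
move=> z; rewrite !in_ball => yz; apply: le_lt_trans (metric_triangle _ y _) _.
by rewrite -ltrBrDl.
Qed.

Lemma mdist_closed_ball x (r : R) : closed [set y : X | mdist x y <= r].
Proof.
rewrite -openC openE => y /= /negP; rewrite -ltNge => ry; apply/nbhs_ballP.
exists (mdist x y - r) => /=; first by rewrite subr_gt0.
move=> z; rewrite in_ball => yz /=; apply/negP; rewrite -ltNge.
have := metric_triangle x z y; rewrite (metric_sym z y); lra.
Qed.

Lemma open_borel (A : set X) : open A -> measurable (A : set (borel X)).
Proof. by move=> oA; apply: sub_sigma_algebra. Qed.

Lemma closed_borel (A : set X) : closed A -> measurable (A : set (borel X)).
Proof. by rewrite -openC => /open_borel/measurableC; rewrite setCK. Qed.

Lemma measurable_mball x (r : R) : measurable (ball x r : set (borel X)).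
Proof. by apply: open_borel; exact: mdist_open_ball. Qed.

Lemma mball_sub x y (r s : R) : mdist x y + r <= s -> ball y r `<=` ball x s.
Proof.
move=> rs z; rewrite !in_ball => yz; apply: le_lt_trans (metric_triangle _ y _) _.
by apply: lt_le_trans rs; rewrite ltrD2l.
Qed.

Lemma continuous_borel (f : X -> R) : continuous f ->
  measurable_fun [set: borel X] (f : borel X -> R).
Proof.
move=> /continuousP cf; apply: (measurability _ (RGenOpens.measurableE R)).
move=> _ [_ [a [b ->] <-]]; rewrite setTI; apply: open_borel.
by apply: cf; exact: interval_open.
Qed.

(** The curve is controlled on [[0, l]] only. Composing with the clamp [k] to that interval gives a
    1-Lipschitz map of the whole line, for which preimages of open sets are open. *)
Lemma continuous_measurable_curve (c : R -> X) (l : R) :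
  (forall s t, 0 <= s -> s <= t -> t <= l -> mdist (c s) (c t) <= t - s) ->
  measurable_fun `[0, l] (c : R -> borel X).
Proof.
move=> cL; pose k s := Num.min (Num.max s 0) l.
have [l0|l0] := ltP l 0.
  by rewrite set_itv_ge ?bnd_simp -?ltNge//; exact: measurable_fun_set0.
have kE s : s \in `[0, l] -> k s = s.
  by rewrite in_itv/= => /andP[s0 sl]; rewrite /k max_l// min_l.
have k0 s : 0 <= k s by rewrite /k le_min l0 andbT le_max lexx orbT.
have kl s : k s <= l by rewrite /k ge_min lexx orbT.
have kd s t : s <= t -> 0 <= k t - k s <= t - s.
  move=> st; rewrite /k.
  have [?|?] := leP s 0; have [?|?] := leP t 0; have [?|?] := leP s l;
    have [?|?] := leP t l; have [?|?] := leP 0 l; by apply/andP; split; lra.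
have dk s t : mdist (c (k s)) (c (k t)) <= `|s - t|.
  wlog st : s t / s <= t.
    move=> H; have [/H//|/ltW/H] := leP s t; by rewrite metric_sym distrC.
  have /andP[h1 h2] := kd s t st; rewrite distrC ger0_norm ?subr_ge0//.
  by apply: le_trans h2; apply: cL => //; rewrite -subr_ge0.
suff mk : measurable_fun [set: R] (c \o k : R -> borel X).
  apply: (@eq_measurable_fun _ _ _ _ _ (c \o k : R -> borel X)); last exact: measurable_funTS.
  by move=> s; rewrite inE/= => /kE E; rewrite /= E.
apply: (@measurability _ _ _ (borel X) _ _ (@open X)) => // _ [A oA <-].
rewrite setTI; apply: open_measurable; rewrite openE => s As.
have /nbhs_ballP[e e0 eA] : nbhs (c (k s) : X) (A : set X) by exact: open_nbhs_nbhs.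
apply/nbhs_ballP; exists e => // t; rewrite /ball/= => st; apply: eA.
by rewrite in_ball; apply: le_lt_trans st; exact: dk.
Qed.

End metric_facts.

(** * [L^p] norms over a subset *)

Section LpN_theory.
Context {R : realType} {X : pmmSpace R}.
Implicit Types (U V : set X) (p : R).
Local Notation mu := (vol X).

Lemma LpNE U p (g : X -> \bar R) : p != 0 -> measurable (U : set (borel X)) ->
  LpN U p%:E g = ((\int[mu]_(x in (U : set (borel X))) (`|g x| `^ p)) `^ p^-1)%E.
Proof.
move=> p0 mU; rewrite /LpN unlock; congr (_ `^ _)%E.
rewrite [RHS]integral_mkcond; apply: eq_integral => x _.
by rewrite /patch; case: ifPn => // _; rewrite abse0 poweR0r.
Qed.

Lemma LpN_pint U p (h : X -> R) : p != 0 -> measurable (U : set (borel X)) ->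
  LpN U p%:E (EFin \o h) = (pint mu p (U : set (borel X)) h `^ p^-1)%E.
Proof. by move=> p0 mU; rewrite LpNE. Qed.

Lemma measurable_poweR_abse U p (g : X -> \bar R) :
  measurable_fun (U : set (borel X)) (g : borel X -> \bar R) ->
  measurable_fun (U : set (borel X)) (fun x : borel X => `|g x| `^ p)%E.
Proof.
move=> mg; apply: (measurableT_comp (measurable_poweR p)).
exact: measurableT_comp.
Qed.

Lemma LpN_lty U p (g : X -> \bar R) : 0 < p -> measurable (U : set (borel X)) ->
  (LpN U p%:E g < +oo)%E =
  (\int[mu]_(x in (U : set (borel X))) (`|g x| `^ p) < +oo)%E.
Proof.
move=> p0 mU; rewrite LpNE ?gt_eqF//; apply/idP/idP.
  by apply: lty_poweRy; rewrite invr_neq0// gt_eqF.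
exact: poweR_lty.
Qed.

Lemma inLp_ae_fin U p (g : X -> \bar R) : 0 < p -> measurable (U : set (borel X)) ->
  inLp U p%:E g -> {ae mu, forall x : borel X, U x -> g x \is a fin_num}.
Proof.
move=> p0 mU [mg]; rewrite LpN_lty// => gfin.
have : mu.-integrable (U : set (borel X)) (fun x : borel X => `|g x| `^ p)%E.
  apply/integrableP; split; first exact: measurable_poweR_abse.
  by under eq_integral do rewrite gee0_abs ?poweR_ge0//.
move=> /(integrable_ae mU); apply: filterS => x /[swap] Ux /(_ Ux).
rewrite ge0_fin_numE ?poweR_ge0// => /lty_poweRy; rewrite gt_eqF// => /(_ isT).
by rewrite -ge0_fin_numE// abse_fin_num.
Qed.

End LpN_theory.

Lemma fin_num_addeI {R : realType} (a b c : \bar R) : a \is a fin_num ->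
  (a + b = a + c -> b = c)%E.
Proof.
by move=> afin E; apply/eqP; rewrite eq_le -(leeD2lE _ _ afin) -(leeD2lE c _ afin) E lexx.
Qed.

Lemma poweRV_le {R : realType} (p : R) (a b : \bar R) : 0 < p ->
  (0 <= a -> 0 <= b -> a `^ p^-1 <= b `^ p^-1 -> a <= b)%E.
Proof.
move=> p0 a0 b0; have := @gt0_ler_poweR R p (ltW p0) (a `^ p^-1)%E (b `^ p^-1)%E.
rewrite -!poweRrM mulVf ?gt_eqF// !poweRe1//; apply;
  by rewrite in_itv/= poweR_ge0 leey.
Qed.

(** * Existence of minimal generalized upper gradients *)

Section minimal_gradient.
Context {R : realType} {X : pmmSpace R} (p : R) (p1 : 1 < p).
Local Notation mu := (vol X).
Local Notation bset U := (U : set (borel X)).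
Local Notation I p U h := (pint mu p (bset U) h).

Let p0 : 0 < p. Proof. exact: lt_trans p1. Qed.
Let pN0 : p != 0. Proof. by rewrite gt_eqF. Qed.

(** An upper gradient of finite energy may still be infinite on a null set; this replaces it by a
    real function, for which [pint] is available. *)
Lemma pint_ae_fin (U : set X) (G : X -> \bar R) (h : X -> R) :
  measurable (bset U) -> measurable_fun (bset U) (G : borel X -> \bar R) ->
  measurable_fun (bset U) (h : borel X -> R) ->
  {ae mu, forall x : borel X, U x -> G x = (h x)%:E} ->
  (\int[mu]_(x in bset U) (`|G x| `^ p))%E = I p U h.
Proof.
move=> mU mG mh Gh; apply: ge0_ae_eq_integral => //.
- exact: measurable_poweR_abse.
- exact: measurable_EFin_powR_norm.
- by move=> x _; exact: poweR_ge0.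
- by move: Gh; apply: filterS => x /= GE Ux; rewrite GE.
Qed.

Lemma measurable_inLp (U : set X) (h : X -> R) (q : \bar R) : inLp U q (EFin \o h) ->
  measurable_fun (bset U) (h : borel X -> R).
Proof. by move=> [/measurable_EFinP]. Qed.

Lemma inLp_pint (U : set X) (h : X -> R) : measurable (bset U) ->
  inLp U p%:E (EFin \o h) <->
  measurable_fun (bset U) (h : borel X -> R) /\ (I p U h < +oo)%E.
Proof.
by move=> mU; split=> -[/measurable_EFinP mh hfin]; split => //;
  move: hfin; rewrite LpN_lty.
Qed.

Lemma inLp_fine (U : set X) (G : X -> \bar R) : measurable (bset U) ->
  inLp U p%:E G -> (\int[mu]_(x in bset U) (`|G x| `^ p))%E = I p U (fine \o G).
Proof.
move=> mU GL; apply: pint_ae_fin => //; first exact: GL.1.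
  by apply: (@measurableT_comp _ _ _ _ _ _ (@fine R)) => //; exact: GL.1.
by move: (inLp_ae_fin p0 mU GL); apply: filterS => x /= + Ux => /(_ Ux) /fineK ->.
Qed.

Lemma LpND (U : set X) (u v : X -> R) : measurable (bset U) ->
  measurable_fun (bset U) (u : borel X -> R) ->
  measurable_fun (bset U) (v : borel X -> R) ->
  (LpN U p%:E (EFin \o (fun x => u x + v x)%R) <=
   LpN U p%:E (EFin \o u) + LpN U p%:E (EFin \o v))%E.
Proof.
move=> mU mu_ mv; pose u' : borel X -> R := u \_ U; pose v' : borel X -> R := v \_ U.
have E (w : X -> R) : ((EFin \o w) \_ U : borel X -> \bar R) = EFin \o (w \_ U).
  by apply/funext => x /=; rewrite /patch; case: ifP.
rewrite /LpN !E.
have -> : (fun x => u x + v x) \_ U = (u' \+ v' : borel X -> R).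
  apply/funext => x /=; rewrite /u' /v' /patch; case: ifP => //.
  by rewrite addr0.
apply: minkowski_EFin; rewrite ?ltW//.
- exact/(measurable_restrictT _ _).1.
- exact/(measurable_restrictT _ _).1.
Qed.

Lemma LpN_cvg (U : set X) (h : nat -> X -> R) (g : X -> R) : measurable (bset U) ->
  (forall n, measurable_fun (bset U) (h n : borel X -> R)) ->
  inLp U p%:E (EFin \o g) ->
  (forall e : R, 0 < e -> exists N, forall n, (N <= n)%N ->
     (I p U (fun x => h n x - g x)%R <= e%:E)%E) ->
  LpN U p%:E (EFin \o h n) @[n --> \oo] --> LpN U p%:E (EFin \o g).
Proof.
move=> mU mh gL hg; have mg := measurable_inLp gL.
have gfin : LpN U p%:E (EFin \o g) \is a fin_num.
  by rewrite ge0_fin_numE ?Lnorm_ge0//; exact: gL.2.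
have b1 n : (LpN U p%:E (EFin \o h n) <= LpN U p%:E (EFin \o g) +
     LpN U p%:E (EFin \o (fun x => h n x - g x)%R))%E.
  have := @LpND U g (fun x => h n x - g x) mU mg.
  have -> : (fun x => g x + (h n x - g x)) = h n.
    by apply/funext => x; rewrite addrC subrK.
  by apply; exact: measurable_funB.
have b2 n : (LpN U p%:E (EFin \o g) <= LpN U p%:E (EFin \o h n) +
     LpN U p%:E (EFin \o (fun x => h n x - g x)%R))%E.
  have := @LpND U (h n) (fun x => g x - h n x) mU (mh n).
  have -> : (fun x => h n x + (g x - h n x)) = g.
    by apply/funext => x; rewrite addrC subrK.
  rewrite !LpN_pint// (pint_distrC mu p _ (g : borel X -> R)); apply; exact: measurable_funB.
have b3 (e : R) : 0 < e -> exists N, forall n, (N <= n)%N ->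
    (LpN U p%:E (EFin \o (fun x => h n x - g x)%R) <= e%:E)%E.
  move=> e0; have [|N NP] := hg (e `^ p); first by rewrite powR_gt0.
  exists N => n Nn; rewrite LpN_pint// lee_poweRV ?pint_ge0 ?NP// ltW//.
rewrite -(fineK gfin); apply/fine_cvgP; split.
  have [N NP] := b3 1 ltr01; exists N => // n /= Nn.
  rewrite ge0_fin_numE ?Lnorm_ge0// (le_lt_trans (b1 n))//.
  by rewrite lte_add_pinfty ?gL.2// (le_lt_trans (NP _ Nn))// ltry.
apply/cvgrPdist_le => e e0; have [N NP] := b3 e e0; exists N => // n /= Nn.
have hfin : LpN U p%:E (EFin \o h n) \is a fin_num.
  rewrite ge0_fin_numE ?Lnorm_ge0// (le_lt_trans (b1 n))//.
  by rewrite lte_add_pinfty ?gL.2// (le_lt_trans (NP _ Nn))// ltry.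
have {}b1 : (LpN U p%:E (EFin \o h n) <= LpN U p%:E (EFin \o g) + e%:E)%E.
  by apply: (le_trans (b1 n)); rewrite leeD2l// NP.
have {}b2 : (LpN U p%:E (EFin \o g) <= LpN U p%:E (EFin \o h n) + e%:E)%E.
  by apply: (le_trans (b2 n)); rewrite leeD2l// NP.
move: b1 b2; rewrite -(fineK gfin) -(fineK hfin) -!EFinD !lee_fin/=.
by rewrite ler_norml; lra.
Qed.

Lemma arclength_lipschitz (c : R -> X) (l : R) : arclength_param c l ->
  forall s t, 0 <= s -> s <= t -> t <= l -> mdist (c s) (c t) <= t - s.
Proof.
move=> cl s t s0 st tl; move: (st); rewrite le_eqVlt => /predU1P[->|slt].
  by rewrite mdistxx subrr.
rewrite -lee_fin -(cl s t s0 st tl); apply: ereal_sup_ubound; exists [:: t].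
  by split => //=; rewrite slt.
by rewrite /polygon_length/= big_nat1.
Qed.

(** Averages of admissible pairs are admissible, which allows midpoints to compete in the
    minimization of energy. Splitting the integral along a curve needs each gradient composed with
    the curve to be measurable, hence the appeal to the Lipschitz bound for arc length curves. *)
Lemma upper_gradient_mid (U : set X) (F1 F2 : X -> R) (G1 G2 : X -> \bar R) :
  measurable (bset U) ->
  upper_gradient U F1 G1 -> upper_gradient U F2 G2 ->
  upper_gradient U (fun x => (F1 x + F2 x) / 2)
    (fun x => (2^-1)%:E * (G1 x + G2 x))%E.
Proof.
move=> mU [mG1 G10 uG1] [mG2 G20 uG2]; split.
- by apply: measurable_funeM; exact: emeasurable_funD.
- by move=> x Ux; rewrite mule_ge0 ?lee_fin ?invr_ge0// adde_ge0 ?G10 ?G20.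
move=> l c l0 cU cl.
have mc := continuous_measurable_curve (arclength_lipschitz cl).
have cU' : (c : R -> borel X) @` `[0, l] `<=` U.
  by move=> _ [s /= + <-]; rewrite in_itv/=; exact: cU.
have mGc (G : X -> \bar R) : measurable_fun (bset U) (G : borel X -> \bar R) ->
    measurable_fun `[0, l] (fun s => G (c s)).
  move=> mG; by apply: (measurable_comp mU cU' mG mc).
have G0 (G : X -> \bar R) : (forall x, U x -> (0 <= G x)%E) ->
    forall s, `[0, l]%classic s -> (0 <= G (c s))%E.
  by move=> H s /= sl; apply: H; apply: cU; move: sl; rewrite in_itv.
rewrite ge0_integralZl_EFin ?invr_ge0//; last 2 first.
- by move=> s sl; rewrite adde_ge0 ?(G0 _ G10) ?(G0 _ G20).
- by apply: emeasurable_funD; exact: mGc.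
rewrite ge0_integralD//; [|exact: G0|exact: mGc|exact: G0|exact: mGc].
apply: (@le_trans _ _ ((2^-1)%:E * (`|F1 (c l) - F1 (c 0)|%:E + `|F2 (c l) - F2 (c 0)|%:E))%E).
  rewrite -EFinD -EFinM lee_fin.
  have -> : (F1 (c l) + F2 (c l)) / 2 - (F1 (c 0) + F2 (c 0)) / 2 =
     2^-1 * ((F1 (c l) - F1 (c 0)) + (F2 (c l) - F2 (c 0))) by field.
  by rewrite normrM ger0_norm ?invr_ge0// ler_wpM2l ?invr_ge0// ler_normD.
rewrite lee_wpmul2l ?lee_fin ?invr_ge0// leeD//; [exact: uG1|exact: uG2].
Qed.

Section energy.
Context (U : set X) (f : X -> R) (i : R).
Hypotheses (mU : measurable (bset U)) (fL : inLp U p%:E (EFin \o f)).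
Hypothesis i0 : 0 <= i.
Hypothesis iE : i%:E = ereal_inf [set e | exists fn gn,
  approx_with_upper_gradients U p f fn gn /\
    e = limn_einf (fun n => LpN U p%:E (gn n))].

Let mf : measurable_fun (bset U) (f : borel X -> R). Proof. exact: measurable_inLp fL. Qed.

(** Otherwise there would be functions converging to [f] in [L^p] with upper gradients of energy
    below [i ^ p - e]; their lower limit would undercut the infimum [i]. *)
Lemma energy_lsc (e : R) : 0 < e -> exists2 d : R, 0 < d & forall F G,
  inLp U p%:E (EFin \o F) -> upper_gradient U F G ->
  (I p U (fun x => F x - f x)%R <= d%:E)%E ->
  ((i `^ p - e)%:E <= \int[mu]_(x in bset U) (`|G x| `^ p))%E.
Proof.
move=> e0; apply/not_exists2P => H.
have {}H : forall k : nat, exists FG : (X -> R) * (X -> \bar R),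
   [/\ inLp U p%:E (EFin \o FG.1), upper_gradient U FG.1 FG.2,
    (I p U (fun x => FG.1 x - f x)%R <= (k.+1%:R^-1)%:E)%E &
    (\int[mu]_(x in bset U) (`|FG.2 x| `^ p) < (i `^ p - e)%:E)%E].
  move=> k; have [] := H k.+1%:R^-1; first by move=> /negP; rewrite invr_gt0 ltr0n.
  move=> /existsNP[F] /existsNP[G] /not_implyP[FL] /not_implyP[FG] /not_implyP[Fd].
  by move=> /negP; rewrite -ltNge => Gi; exists (F, G).
move: H => /choice[FG FGP].
have e1 : 0 <= i `^ p - e.
  have [_ _ _ h] := FGP 0%N; rewrite -lee_fin; apply: le_trans (ltW h).
  by apply: integral_ge0 => x _; exact: poweR_ge0.
pose c := (i `^ p - e) `^ p^-1.
have : (i%:E <= c%:E)%E.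
  rewrite iE; apply: (@le_trans _ _ (limn_einf (fun n => LpN U p%:E (FG n).2))).
    apply: ereal_inf_lbound; exists (fun n => (FG n).1), (fun n => (FG n).2); split => //.
    split=> [n|n|]; [by case: (FGP n)|by case: (FGP n)|].
    under eq_cvg do rewrite LpN_pint//.
    apply/cvg0_poweRVP => //; first by move=> n; exact: pint_ge0.
    move=> d d0; exists (Num.truncn d^-1) => n dn.
    have [_ _ h _] := FGP n; apply: (le_trans h); rewrite lee_fin.
    rewrite invf_ple ?posrE// ltW// (lt_le_trans (truncnS_gt _))// ler_nat//.
  apply: (le_trans (limn_einf_sup _)); apply: limn_esup_le; exists 0%N => n _.
  rewrite LpNE// lee_poweRV ?powR_ge0//; last first.
    by apply: integral_ge0 => x _; exact: poweR_ge0.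
  rewrite -powRrM mulVf// powRr1//; apply: ltW; by case: (FGP n).
rewrite lee_fin => ic.
have : i `^ p <= c `^ p by rewrite ge0_ler_powR ?nnegrE ?(ltW p0) ?powR_ge0.
by rewrite -powRrM mulVf// powRr1//; lra.
Qed.

Lemma energy_minimizing (d : R) : 0 < d -> exists F G,
  [/\ inLp U p%:E (EFin \o F), upper_gradient U F G,
      (I p U (fun x => F x - f x)%R <= d%:E)%E &
      (\int[mu]_(x in bset U) (`|G x| `^ p) <= (i `^ p + d)%:E)%E].
Proof.
move=> d0; pose c := (i `^ p + d) `^ p^-1.
have ip0 : 0 <= i `^ p by exact: powR_ge0.
have cp : c `^ p = i `^ p + d by rewrite -powRrM mulVf// powRr1//; lra.
have ic : i < c.
  rewrite ltNge; apply/negP => ci.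
  have : c `^ p <= i `^ p by rewrite ge0_ler_powR ?nnegrE ?(ltW p0) ?powR_ge0.
  by rewrite cp; lra.
have : (i%:E < c%:E)%E by rewrite lte_fin.
rewrite iE => /ereal_inf_lt[_ [fn [gn [[fnL fng fnf] ->]]] gnc].
move: fnf; under eq_cvg do rewrite LpN_pint//.
move=> /cvg0_poweRVP-/(_ p0 (fun n => pint_ge0 _ _ _ _))/(_ _ d0)[N NP].
have [n Nn gn_c] : exists2 n, (N <= n)%N & (LpN U p%:E (gn n) < c%:E)%E.
  apply/not_exists2P => H; move: gnc; apply/negP; rewrite -leNgt.
  apply: limn_einf_ge; exists N => n Nn.
  by have [//|/negP] := H n; rewrite -leNgt.
exists (fn n), (gn n); split => //; first exact: NP.
move: gn_c => /ltW; rewrite LpNE// lee_poweRV ?powR_ge0 ?cp//.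
by apply: integral_ge0 => x _; exact: poweR_ge0.
Qed.


(** Midpoints of a minimizing sequence still converge to [f], so by [energy_lsc] their energy is not
    much below [i ^ p], which is what the uniform convexity argument requires. The limit [g] attains
    the infimum: its norm is at least [i] because the sequence itself is a competitor, and at most
    [i] because the energies tend to [i ^ p]. *)
Lemma energy_minimizer : exists2 g : X -> R,
  gen_upper_gradient U p f (EFin \o g) & LpN U p%:E (EFin \o g) = i%:E.
Proof.
have /choice[FG FGP] : forall k : nat, exists FG : (X -> R) * (X -> \bar R),
   [/\ inLp U p%:E (EFin \o FG.1), upper_gradient U FG.1 FG.2,
    (I p U (fun x => FG.1 x - f x)%R <= (k.+1%:R^-1)%:E)%E &
    (\int[mu]_(x in bset U) (`|FG.2 x| `^ p) <= (i `^ p + k.+1%:R^-1)%:E)%E].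
  move=> k; have [|F [G]] := @energy_minimizing k.+1%:R^-1.
    by rewrite invr_gt0 ltr0n.
  by exists (F, G).
pose F k := (FG k).1; pose G k := (FG k).2.
have FL k : inLp U p%:E (EFin \o F k) by case: (FGP k).
have FG_ k : upper_gradient U (F k) (G k) by case: (FGP k).
have mF k := measurable_inLp (FL k).
have small (e : R) : 0 < e -> exists N, forall k, (N <= k)%N -> k.+1%:R^-1 <= e.
  move=> e0; exists (Num.truncn e^-1) => k dk.
  by rewrite invf_ple ?posrE// ltW// (lt_le_trans (truncnS_gt _))// ler_nat.
have GL k : inLp U p%:E (G k).
  split; first by case: (FG_ k).
  rewrite LpN_lty//; case: (FGP k) => _ _ _ /le_lt_trans; apply; exact: ltry.
pose h k := fine \o G k.
have mh k : measurable_fun (bset U) (h k : borel X -> R).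
  by apply: (@measurableT_comp _ _ _ _ _ _ (@fine R)) => //; exact: (GL k).1.
have Gh k : (\int[mu]_(x in bset U) (`|G k x| `^ p))%E = I p U (h k).
  exact: inLp_fine.
have Gfin k := inLp_ae_fin p0 mU (GL k).
have h0 k x : U x -> 0 <= h k x.
  by move=> Ux; apply: fine_ge0; case: (FG_ k) => _ + _; apply.
have Ffcvg (e : R) : 0 < e -> exists N, forall k, (N <= k)%N ->
    (I p U (fun x => F k x - f x)%R <= e%:E)%E.
  move=> e0; have [N NP] := small e e0; exists N => k Nk.
  by case: (FGP k) => _ _ /le_trans + _; apply; rewrite lee_fin NP.
have hup (e : R) : 0 < e -> exists N, forall n, (N <= n)%N ->
     (I p U (h n) <= (i `^ p + e)%:E)%E.
  move=> e0; have [N NP] := small e e0; exists N => k Nk.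
  by rewrite -Gh; case: (FGP k) => _ _ _ /le_trans; apply; rewrite lee_fin lerD2l NP.
have hlo (e : R) : 0 < e -> exists N, forall m n, (N <= m)%N -> (N <= n)%N ->
     ((i `^ p - e)%:E <= I p U (fun x => (h m x + h n x) / 2)%R)%E.
  move=> e0; have [d d0 dP] := energy_lsc e0.
  have d'0 : 0 < d / (2 `^ (p - 1) * 2) by rewrite divr_gt0// mulr_gt0// powR_gt0.
  have [N NP] := Ffcvg _ d'0; exists N => m n Nm Nn.
  have mm : measurable_fun (bset U) (fun x : borel X => (h m x + h n x) / 2 : R).
    by apply: measurable_funM => //; exact: measurable_funD.
  rewrite -(@pint_ae_fin U (fun x => (2^-1)%:E * (G m x + G n x))%E)//; last 2 first.
  - by apply: measurable_funeM; apply: emeasurable_funD; [exact: (GL m).1|exact: (GL n).1].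
  - move: (Gfin m) (Gfin n); apply: filterS2 => x /= + + Ux => /(_ Ux) Gm /(_ Ux) Gn.
    by rewrite -(fineK Gm) -(fineK Gn) -EFinD -EFinM mulrC.
  have mFm : measurable_fun (bset U) (fun x : borel X => (F m x + F n x) / 2 : R).
    by apply: measurable_funM => //; exact: measurable_funD.
  have mFf k : measurable_fun (bset U) (fun x : borel X => F k x - f x).
    exact: measurable_funB.
  have bnd : (I p U (fun x => (F m x + F n x) / 2 - f x)%R <= d%:E)%E.
    apply: (@le_trans _ _ (I p U (fun x => (F m x - f x) + (F n x - f x))%R)).
      apply: le_pint => //; [exact: measurable_funB|exact: measurable_funD|].
      move=> x Ux; have -> : (F m x + F n x) / 2 - f x =
          2^-1 * ((F m x - f x) + (F n x - f x)) by field.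
      by rewrite normrM ger0_norm ?invr_ge0// ler_piMl// invf_le1 ?ler1n.
    apply: (le_trans (pintD_le mu p1 mU (mFf m) (mFf n))).
    apply: (@le_trans _ _ ((2 `^ (p - 1))%:E * ((d / (2 `^ (p - 1) * 2))%:E +
        (d / (2 `^ (p - 1) * 2))%:E))%E).
      by rewrite lee_wpmul2l// leeD// NP.
    rewrite -EFinD -EFinM lee_fin le_eqVlt; apply/orP; left; apply/eqP.
    by field; rewrite gt_eqF// powR_gt0.
  apply: (dP _ _ _ (upper_gradient_mid mU (FG_ m) (FG_ n)) bnd).
  apply/inLp_pint => //; split => //.
  have -> : (fun x => (F m x + F n x) / 2) = (fun x => ((F m x + F n x) / 2 - f x) + f x).
    by apply/funext => x; rewrite subrK.
  apply: le_lt_trans (pintD_le mu p1 mU _ mf) _; first exact: measurable_funB.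
  rewrite lte_mul_pinfty// lte_add_pinfty//; first by rewrite (le_lt_trans bnd)// ltry.
  by have /inLp_pint[] := fL.
have ip0 : 0 <= i `^ p by exact: powR_ge0.
have hC := pint_uniform_convex_cauchy p1 mU mh h0 ip0 hup hlo.
have [g mg hg] := pint_complete p1 mU mh hC.
have gfin : (I p U g < +oo)%E.
  have [N NP] := hg 1 ltr01.
  have -> : g = (fun x => (g x - h N x) + h N x)%R by apply/funext => x; rewrite subrK.
  apply: le_lt_trans (pintD_le mu p1 mU _ (mh N)) _; first exact: measurable_funB.
  rewrite lte_mul_pinfty// lte_add_pinfty//.
    by rewrite (pint_distrC mu p _ (g : borel X -> R)) (le_lt_trans (NP N _))// ltry.
  by rewrite -Gh; move: (GL N).2; rewrite LpN_lty.
have gL : inLp U p%:E (EFin \o g) by apply/inLp_pint.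
have fngn : approx_with_upper_gradients U p f F G.
  split => //; under eq_cvg do rewrite LpN_pint//.
  by apply/cvg0_poweRVP => // n; exact: pint_ge0.
have Ncvg : LpN U p%:E (G n) @[n --> \oo] --> LpN U p%:E (EFin \o g).
  under eq_cvg do rewrite LpNE// Gh -LpN_pint//.
  exact: LpN_cvg.
exists g.
  split=> //; exists F, G; split=> //; split=> //.
  have Gg n : LpN U p%:E (fun x => G n x - (g x)%:E)%E =
      (I p U (fun x => h n x - g x)%R `^ p^-1)%E.
    rewrite LpNE//; congr (_ `^ _)%E; apply: pint_ae_fin => //.
    - by apply: emeasurable_funB; [exact: (GL n).1|exact/measurable_EFinP].
    - exact: measurable_funB.
    - move: (Gfin n); apply: filterS => x /= + Ux => /(_ Ux) Gm.
      by rewrite -(fineK Gm) -EFinB.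
  under eq_cvg do rewrite Gg.
  by apply/cvg0_poweRVP => // n; exact: pint_ge0.
apply/eqP; rewrite eq_le; apply/andP; split; last first.
  rewrite iE; apply: ereal_inf_lbound; exists F, G; split => //.
  by rewrite (cvg_limn_einf_sup Ncvg).1.
rewrite leNgt; apply/negP => ig.
have gf : LpN U p%:E (EFin \o g) \is a fin_num.
  by rewrite ge0_fin_numE ?Lnorm_ge0//; exact: gL.2.
move: ig Ncvg; rewrite -(fineK gf) lte_fin; set gn := fine _ => ig Ncvg.
have g0 : 0 < gn `^ p - i `^ p.
  by rewrite subr_gt0 gt0_ltr_powR ?nnegrE// (le_trans i0)// ltW.
have [N NP] := hup _ (divr_gt0 g0 (ltr0n _ 2)).
pose c := ((i `^ p + gn `^ p) / 2) `^ p^-1.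
have cg : c < gn.
  rewrite ltNge; apply/negP => gc.
  have : gn `^ p <= c `^ p by rewrite ge0_ler_powR ?nnegrE ?(ltW p0) ?powR_ge0// (le_trans i0)// ltW.
  rewrite -powRrM mulVf// powRr1//; first lra.
  by rewrite divr_ge0// addr_ge0// powR_ge0.
have : (gn%:E <= c%:E)%E.
  rewrite -(cvg_limn_einf_sup Ncvg).2; apply: limn_esup_le.
  exists N => n Nn; rewrite LpNE// Gh lee_poweRV ?pint_ge0 ?powR_ge0//.
  rewrite -powRrM mulVf// powRr1//; last by rewrite divr_ge0// addr_ge0// powR_ge0.
  by apply: (le_trans (NP n Nn)); rewrite lee_fin; lra.
by rewrite lee_fin leNgt cg.
Qed.

End energy.

(** By [energy_minimizer] the set from which [min_grad] chooses is inhabited, so its value is a true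
    minimal gradient and not the default. *)
Lemma min_gradP (U : set X) (f : X -> R) : measurable (bset U) -> H1p U p f ->
  min_gen_upper_gradient U p f (min_grad U p f).
Proof.
move=> mU [fL]; rewrite /cheeger_norm; set E := ereal_inf _ => fE.
have E0 : (0 <= E)%E.
  apply: le_ereal_inf_tmp => _ [fn [gn [_ ->]]]; apply: limn_einf_ge0 => n.
  exact: Lnorm_ge0.
have Efin : E \is a fin_num.
  rewrite ge0_fin_numE//; apply: le_lt_trans fE.
  by rewrite leeDr// Lnorm_ge0.
have [|g gg gE] := @energy_minimizer U f (fine E) mU fL (fine_ge0 E0).
  by rewrite fineK.
by apply: xgetPex; exists (EFin \o g); split => //; rewrite /cheeger_norm -/E gE fineK.
Qed.

Lemma LpN_subset (U V : set X) (g : X -> \bar R) : measurable (bset U) ->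
  measurable (bset V) -> V `<=` U ->
  measurable_fun (bset U) (g : borel X -> \bar R) ->
  (LpN V p%:E g <= LpN U p%:E g)%E.
Proof.
move=> mU mV VU mg; rewrite !LpNE//; apply: le_poweRV => //.
  by apply: integral_ge0 => x _; exact: poweR_ge0.
apply: ge0_subset_integral => //; first exact: measurable_poweR_abse.
by move=> x _; exact: poweR_ge0.
Qed.

Lemma inLp_subset (U V : set X) (g : X -> \bar R) : measurable (bset U) ->
  measurable (bset V) -> V `<=` U -> inLp U p%:E g -> inLp V p%:E g.
Proof.
move=> mU mV VU [mg gfin]; split; first exact: measurable_funS mg.
exact: le_lt_trans (LpN_subset mU mV VU mg) gfin.
Qed.

Lemma approx_subset (U V : set X) (f : X -> R) fn gn : measurable (bset U) ->
  measurable (bset V) -> V `<=` U ->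
  measurable_fun (bset U) (f : borel X -> R) ->
  approx_with_upper_gradients U p f fn gn -> approx_with_upper_gradients V p f fn gn.
Proof.
move=> mU mV VU mf [fnL fng fnf]; split => [n|n|].
- exact: inLp_subset (fnL n).
- have [mg g0 ug] := fng n; split.
  + exact: measurable_funS mg.
  + by move=> x /VU; exact: g0.
  + by move=> l c l0 cV; apply: ug => // s /cV /VU.
apply: (squeeze_cvge _ (cvg_cst 0%E) fnf).
apply: nearW => n; rewrite Lnorm_ge0/=; apply: LpN_subset => //.
apply/measurable_EFinP; apply: measurable_funB => //.
exact: measurable_inLp (fnL n).
Qed.

(** The approximating pairs of [g] on [U] restrict to [V], and since the gradients converge to [g]
    in [L^p], their norms on [V] converge to the norm of [g] there. *)
Lemma gen_upper_gradient_energy (U V : set X) (f : X -> R) (g : X -> \bar R) :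
  measurable (bset U) -> measurable (bset V) -> V `<=` U ->
  measurable_fun (bset U) (f : borel X -> R) ->
  gen_upper_gradient U p f g ->
  (ereal_inf [set e | exists fn gn, approx_with_upper_gradients V p f fn gn /\
     e = limn_einf (fun n => LpN V p%:E (gn n))] <= LpN V p%:E g)%E.
Proof.
move=> mU mV VU mf [gL [fn [gn [fngn [gnL gng]]]]].
have fngnV := approx_subset mU mV VU mf fngn.
apply: ereal_inf_lbound; exists fn, gn; split => //.
have fineE (G : X -> \bar R) : inLp U p%:E G ->
    LpN V p%:E G = LpN V p%:E (EFin \o (fine \o G)).
  move=> GL; rewrite LpNE// LpN_pint//; congr (_ `^ _)%E.
  by apply: inLp_fine => //; exact: inLp_subset GL.
have mfine (W : set X) (G : X -> \bar R) : inLp W p%:E G ->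
    measurable_fun (bset W) (fine \o G : borel X -> R).
  by move=> GL; apply: (@measurableT_comp _ _ _ _ _ _ (@fine R)) => //; exact: GL.1.
have gLV : inLp V p%:E (EFin \o (fine \o g)).
  split; last by rewrite -fineE// (inLp_subset mU mV VU gL).2.
  by apply/measurable_EFinP; apply: mfine; exact: inLp_subset gL.
suff : LpN V p%:E (gn n) @[n --> \oo] --> LpN V p%:E g.
  by move=> /cvg_limn_einf_sup[->].
rewrite fineE//; under eq_cvg do rewrite fineE//.
apply: LpN_cvg => //.
  by move=> n; apply: mfine; exact: inLp_subset (gnL n).
move=> e e0; move: gng.
have Gg n : LpN U p%:E (fun x => gn n x - g x)%E =
    (I p U (fun x => fine (gn n x) - fine (g x))%R `^ p^-1)%E.
  rewrite LpNE//; congr (_ `^ _)%E; apply: pint_ae_fin => //.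
  - by apply: emeasurable_funB; [exact: (gnL n).1|exact: gL.1].
  - by apply: measurable_funB; apply: mfine.
  - move: (inLp_ae_fin p0 mU (gnL n)) (inLp_ae_fin p0 mU gL).
    apply: filterS2 => x /= + + Ux => /(_ Ux) G1 /(_ Ux) G2.
    by rewrite -{1}(fineK G1) -{1}(fineK G2) -EFinB.
under eq_cvg do rewrite Gg.
move=> /cvg0_poweRVP-/(_ p0 (fun n => pint_ge0 _ _ _ _))/(_ _ e0)[N NP].
exists N => n Nn; apply: le_trans (NP n Nn); apply: subset_pint => //.
by apply: measurable_funB; exact: mfine.
Qed.

Lemma H1p_subset (U V : set X) (f : X -> R) : measurable (bset U) ->
  measurable (bset V) -> V `<=` U -> H1p U p f -> H1p V p f.
Proof.
move=> mU mV VU fH; have [gg _] := min_gradP mU fH; have [fL _] := fH.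
have fLV : inLp V p%:E (EFin \o f) by exact: inLp_subset fL.
split => //; rewrite /cheeger_norm lte_add_pinfty ?fLV.2//.
apply: le_lt_trans (gen_upper_gradient_energy mU mV VU (measurable_inLp fL) gg) _.
exact: (inLp_subset mU mV VU gg.1).2.
Qed.

(** The minimal gradient of [U], restricted to [V], competes in the minimization on [V]. The
    Poincare inequality on a small ball, stated with that ball's own gradient, thereby implies the
    one with the fixed gradient of the large ball. *)
Lemma min_grad_subset (U V : set X) (f : X -> R) : measurable (bset U) ->
  measurable (bset V) -> V `<=` U -> H1p U p f ->
  (\int[mu]_(x in bset V) (`|min_grad V p f x| `^ p) <=
   \int[mu]_(x in bset V) (`|min_grad U p f x| `^ p))%E.
Proof.
move=> mU mV VU fH; have [gg _] := min_gradP mU fH; have [fL _] := fH.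
have fHV := H1p_subset mU mV VU fH.
have [_] := min_gradP mV fHV; rewrite /cheeger_norm => E.
have := gen_upper_gradient_energy mU mV VU (measurable_inLp fL) gg.
have fV : LpN V p%:E (EFin \o f) \is a fin_num.
  by rewrite ge0_fin_numE ?Lnorm_ge0//; exact: fHV.1.2.
have {}E : LpN V p%:E (min_grad V p f) = ereal_inf [set e | exists fn gn,
    approx_with_upper_gradients V p f fn gn /\
     e = limn_einf (fun n => LpN V p%:E (gn n))].
  exact: fin_num_addeI fV E.
rewrite -E.
rewrite (LpNE (min_grad V p f) pN0 mV).
rewrite (LpNE (min_grad U p f) pN0 mV).
apply: (poweRV_le p0).
- by apply: integral_ge0 => x _; exact: poweR_ge0.
- by apply: integral_ge0 => x _; exact: poweR_ge0.
Qed.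

End minimal_gradient.

(** * Vitali coverings in doubling spaces *)

Section seq_measure.
Context d (T : measurableType d) (R : realType) (mu : {measure set T -> \bar R}).

Lemma measure_seq_le (I : Type) (s : seq I) (F : I -> set T) (A : set T) :
  measurable A -> (forall i, measurable (F i)) ->
  A `<=` \big[setU/set0]_(i <- s) F i -> (mu A <= \sum_(i <- s) mu (F i))%E.
Proof.
move=> mA mF; elim: s A mA => [|i s IH] A mA.
  by rewrite !big_nil subset0 => ->; rewrite measure0.
rewrite !big_cons => As.
apply: (@le_trans _ _ (mu (F i `|` (A `\` F i)))).
  rewrite le_measure ?inE//; first by apply: measurableU => //; exact: measurableD.
  by move=> x Ax; have [Fx|Fx] := pselect (F i x); [left|right].
apply: (le_trans (measureU2 _ _ _)) => //; first exact: measurableD.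
rewrite leeD2l//; apply: IH; first exact: measurableD.
by move=> x [/As[]].
Qed.

Lemma measure_seq_disjoint (I : eqType) (s : seq I) (F : I -> set T) :
  (forall i, measurable (F i)) -> uniq s ->
  {in s &, forall i j, i != j -> F i `&` F j = set0} ->
  (mu (\big[setU/set0]_(i <- s) F i) = \sum_(i <- s) mu (F i))%E.
Proof.
move=> mF us tF.
have -> : (mu (\big[setU/set0]_(i <- s) F i) =
    \int[mu]_(x in \big[setU/set0]_(i <- s) F i) (cst 1%E x))%E.
  by rewrite integral_cst ?mul1e//; apply: bigsetU_measurable.
rewrite ge0_integral_bigsetU//.
  by apply: eq_bigr => i _; rewrite integral_cst ?mul1e.
move=> i j /= si sj [x Fx]; apply/eqP/negPn/negP => ij.
by move: Fx; rewrite tF.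
Qed.

End seq_measure.

Lemma big_setUP (T : Type) (I : eqType) (s : seq I) (F : I -> set T) (x : T) :
  (\big[setU/set0]_(i <- s) F i) x <-> exists2 i, i \in s & F i x.
Proof.
elim: s => [|i s IH]; first by rewrite big_nil; split=> // -[].
rewrite big_cons; split=> [[Fx|/IH[j js Fx]]|[j + Fx]].
- by exists i; rewrite ?mem_head.
- by exists j; rewrite ?in_cons ?js ?orbT.
by rewrite in_cons => /predU1P[<-|js]; [left|right; apply/IH; exists j].
Qed.

Lemma seq_pos_lower {R : realType} (I : eqType) (s : seq I) (m : I -> R) :
  (forall i, i \in s -> 0 < m i) ->
  exists2 e : R, 0 < e & forall i, i \in s -> e < m i.
Proof.
elim: s => [|i s IH] m0; first by exists 1.
have [|e e0 es] := IH; first by move=> j js; rewrite m0// in_cons js orbT.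
have mi : 0 < m i by rewrite m0// mem_head.
exists (Num.min e (m i / 2)); first by rewrite lt_min e0 divr_gt0.
move=> j; rewrite in_cons => /predU1P[->|/es]; rewrite gt_min.
  by rewrite ltr_pdivrMr// ltr_pMr// ltr1n orbT.
by move=> ->.
Qed.

(** The hypotheses on a single space, with constants that can be shared by the whole sequence and
    its limit. [K] is the doubling factor [2 ^ kappa] itself. *)
Record doubling_space {R : realType} (X : pmmSpace R) (K Rh : R) : Prop := {
  ds_proper : proper_space X;
  ds_geodesic : geodesic_space X;
  ds_radon : radon_measure X;
  ds_ge1 : 1 <= K;
  ds_gt0 : 0 < Rh;
  ds_doubling : forall (z : X) (s : R), 0 < s < Rh ->
    (vol X (ball z (2 * s)) <= K%:E * vol X (ball z s))%E }.

Section doubling_space_theory.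
Context {R : realType} {X : pmmSpace R} (K Rh : R) (HX : doubling_space X K Rh).
Local Notation mu A := (vol X (A : set (borel X))).
Local Notation cball z t := [set y | mdist z y <= t].

Let K0 : 0 < K. Proof. by apply: lt_le_trans (ds_ge1 HX); exact: ltr01. Qed.

Lemma measurable_cball (z : X) (t : R) : measurable (cball z t : set (borel X)).
Proof. by apply: closed_borel; exact: mdist_closed_ball. Qed.

Lemma ball_cball (z : X) (t : R) : ball z t `<=` cball z t.
Proof. by move=> y; rewrite in_ball => /ltW. Qed.

Lemma vol_cball_lty (z : X) (t : R) : (mu (cball z t) < +oo)%E.
Proof. by apply: (ds_radon HX).1; exact: (ds_proper HX). Qed.

Lemma vol_subset (A B : set X) : measurable (A : set (borel X)) ->
  measurable (B : set (borel X)) -> A `<=` B -> (mu A <= mu B)%E.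
Proof. by move=> mA mB AB; rewrite le_measure ?inE. Qed.

Lemma vol_ball_lty (z : X) (t : R) : (mu (ball z t) < +oo)%E.
Proof.
apply: le_lt_trans (vol_cball_lty z t); apply: vol_subset (@ball_cball z t).
  exact: measurable_mball.
exact: measurable_cball.
Qed.

Lemma vol_ball_fin (z : X) (t : R) : mu (ball z t) \is a fin_num.
Proof. by rewrite ge0_fin_numE// vol_ball_lty. Qed.

Lemma vol_ball_iter (z : X) (D : R) (n : nat) : 0 < D <= Rh ->
  (mu (ball z D) <= (K ^+ n)%:E * mu (ball z (D / 2 ^+ n)))%E.
Proof.
move=> /andP[D0 DR]; elim: n => [|n IH]; first by rewrite !expr0 mul1e divr1.
apply: (le_trans IH); rewrite exprSr EFinM -muleA lee_wpmul2l ?lee_fin ?exprn_ge0 ?(ltW K0)//.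
have -> : D / 2 ^+ n = 2 * (D / 2 ^+ n.+1).
  by rewrite exprS; field; rewrite expf_neq0.
apply: (ds_doubling HX); rewrite divr_gt0 ?exprn_gt0//=.
apply: lt_le_trans DR; rewrite ltr_pdivrMr ?exprn_gt0// ltr_pMr//.
by rewrite exprn_egt1// ltr1n.
Qed.

(** The ball of radius [D] about [z] contains the unit ball about [x0], which has volume one. After
    [n = truncn (D / t) + 1] halvings its radius is at most [t], because [2 ^ n >= n > D / t]; each
    halving costs a factor [K]. *)
Lemma vol_ball_lower (x0 : X) (D t : R) : 0 < D <= Rh ->
  mu (ball x0 1) = 1%E -> 0 < t -> forall z : X, mdist z x0 + 1 <= D ->
  (((K ^+ (Num.truncn (D / t)).+1)^-1)%:E <= mu (ball z t))%E.
Proof.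
move=> DR v1 t0 z' z'D.
set n := (Num.truncn _).+1; have := vol_ball_iter z' n DR => h.
have Dt : D / 2 ^+ n <= t.
  rewrite ler_pdivrMr ?exprn_gt0// mulrC -ler_pdivrMr//.
  apply: (@le_trans _ _ n%:R); first by rewrite ltW// truncnS_gt.
  by rewrite -natrX ler_nat ltnW// ltn_expl.
have h' : (mu (ball z' D) <= (K ^+ n)%:E * mu (ball z' t))%E.
  apply: (le_trans h); rewrite lee_wpmul2l ?lee_fin ?exprn_ge0 ?(ltW K0)//.
  by apply: vol_subset; [exact: measurable_mball..|exact: le_ball].
have : (1 <= mu (ball z' D))%E.
  rewrite -v1; apply: vol_subset; [exact: measurable_mball..|exact: mball_sub].
move=> a; move: (le_trans a (h' : (_ <= _ * mu (ball z' t))%E)); rewrite muleC.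
by rewrite -(fineK (vol_ball_fin z' t)) -EFinM !lee_fin -ler_pdivrMr ?exprn_gt0// div1r.
Qed.

(** If the centres were within [s + t], a geodesic between them would carry a point of both balls,
    at distance [min s D] from [x]. Unlike disjointness, the resulting inequality between centres
    and radii can be transported to nearby spaces. *)
Lemma disjoint_cball_sep (x y : X) (s t : R) : 0 <= s -> 0 <= t ->
  cball x s `&` cball y t = set0 -> s + t < mdist x y.
Proof.
move=> s0 t0 dis; rewrite ltNge; apply/negP => dst.
have [c [c0 c1 cd]] := ds_geodesic HX x y.
set D := mdist x y in c1 cd dst; have D0 : 0 <= D by exact: mdist_ge0.
pose u := Num.min s D.
have u0 : 0 <= u <= D by rewrite /u le_min s0 D0 ge_min lexx orbT.
suff : (cball x s `&` cball y t) (c u) by rewrite dis.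
split => /=.
  rewrite -c0 cd ?lexx ?D0// sub0r normrN ger0_norm ?(andP u0).1//.
  by rewrite ge_min lexx.
rewrite -c1 cd ?lexx ?D0// ger0_norm ?subr_ge0 ?(andP u0).2//.
by rewrite /u; have [?|?] := leP s D; lra.
Qed.

(** Vitali's selection: keep a ball of largest radius, discard those too close to it, and continue
    with the rest. Each discarded ball is thus close to a kept one that is no smaller. *)
Lemma greedy_sep (L : seq (X * R)) : (forall x, x \in L -> 0 < x.2) ->
  exists s : seq (X * R), [/\ uniq s, {subset s <= L},
    {in s &, forall x y, x != y -> x.2 + y.2 < mdist x.1 y.1} &
    forall x, x \in L -> exists2 y, y \in s & mdist x.1 y.1 <= x.2 + y.2 /\ x.2 <= y.2].
Proof.
have [n] := ubnP (size L); elim: n L => // n IH L Ln L0.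
have [->|LN] := eqVneq L [::]; first by exists [::]; split.
have [m mL mmax] : exists2 m, m \in L & forall x, x \in L -> x.2 <= m.2.
  elim: L LN {Ln L0 IH} => // a [_ _|b L IH _].
    by exists a; [exact: mem_head|move=> x; rewrite inE => /eqP ->].
  have [m mL mmax] := IH isT; have [am|ma] := leP a.2 m.2.
    exists m; first by rewrite in_cons mL orbT.
    by move=> x; rewrite in_cons => /predU1P[->//|]; exact: mmax.
  exists a; first exact: mem_head.
  move=> x; rewrite in_cons => /predU1P[->//|/mmax h]; exact: le_trans (ltW ma).
pose L' := [seq y <- L | m.2 + y.2 < mdist m.1 y.1].
have m2 := L0 _ mL.
have [||s [us sL' seps covs]] := IH L'.
- rewrite (leq_trans _ (Ln : (size L <= n)%N))// size_filter -(count_predC (fun y => m.2 + y.2 < mdist m.1 y.1) L).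
  rewrite -[X in (X < _)%N]addn0 ltn_add2l -has_count; apply/hasP; exists m => //=.
  by rewrite -leNgt mdistxx; lra.
- by move=> x; rewrite mem_filter => /andP[_]; exact: L0.
have sm y : y \in s -> m.2 + y.2 < mdist m.1 y.1 by move=> /sL'; rewrite mem_filter => /andP[].
exists (m :: s); split.
- rewrite /= us andbT; apply/negP => /sm; rewrite mdistxx; lra.
- move=> x; rewrite in_cons => /predU1P[->//|/sL']; by rewrite mem_filter => /andP[].
- move=> x y; rewrite !in_cons => /predU1P[->|xs] /predU1P[->|ys] xy.
  + by rewrite eqxx in xy.
  + exact: sm.
  + by rewrite addrC metric_sym; exact: sm.
  + exact: seps.
- move=> x xL; have [xm|mx] := ltP (m.2 + x.2) (mdist m.1 x.1).
    have [|y ys yP] := covs x; first by rewrite mem_filter xm.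
    by exists y => //; rewrite in_cons ys orbT.
  exists m; first exact: mem_head.
  by rewrite metric_sym addrC mmax.
Qed.


Section vitali.
Context (x0 : X) (r : R) (G N : set X) (T : X -> R).
Hypothesis (mN : measurable (N : set (borel X))) (N0 : mu N = 0%E).
Hypothesis T0 : forall z, G z -> 0 < T z.

(** Here [G] contains the admissible centres, [T] caps the radii and [N] is a null set absorbing all
    other points. Inner regularity gives a compact set with at least half the volume of [O], covered
    by finitely many balls; after the selection the balls enlarged four times still cover it, and
    two doublings give [K ^+ 2]. *)
Lemma vitali_step (O : set X) : open O -> (mu O < +oo)%E -> O `<=` G `|` N ->
  exists s : seq (X * R), [/\ uniq s,
    forall x, x \in s -> [/\ G x.1, 0 < x.2, x.2 < T x.1 & cball x.1 x.2 `<=` O],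
    {in s &, forall x y, x != y -> x.2 + y.2 < mdist x.1 y.1} &
    (mu O <= (2 * K ^+ 2)%:E * \sum_(x <- s) mu (cball x.1 x.2))%E].
Proof.
move=> oO Ofin OGN; have mO := open_borel oO.
have [muO0|Ogt0] := eqVneq (mu O) 0%E.
  by exists [::]; split => //; rewrite muO0 big_nil mule0.
have /choice[t tP] : forall z, exists t, G z /\ O z ->
    [/\ 0 < t, t < T z, t < Rh / 4 & cball z t `<=` O].
  move=> z; have [[Gz Oz]|nz] := pselect (G z /\ O z); last by exists 0.
  have /nbhs_ballP[e e0 eO] : nbhs z O by exact: open_nbhs_nbhs.
  exists (Num.min (Num.min (T z) (Rh / 4)) e / 2) => _.
  have m0 : 0 < Num.min (Num.min (T z) (Rh / 4)) e.
    by rewrite !lt_min T0// divr_gt0// (ds_gt0 HX).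
  have mlt : Num.min (Num.min (T z) (Rh / 4)) e / 2 < Num.min (Num.min (T z) (Rh / 4)) e.
    by rewrite ltr_pdivrMr// ltr_pMr// ltr1n.
  move: (mlt); rewrite !lt_min => /andP[/andP[h1 h2] h3].
  split => //; first by rewrite divr_gt0.
  by move=> y /= zy; apply: eO; rewrite in_ball (le_lt_trans zy).
pose D := [set z | G z /\ O z].
pose W := \bigcup_(z in D) ball z (t z).
have oW : open W by apply: bigcup_open => z _; exact: mdist_open_ball.
have mW := open_borel oW.
have WO : W `<=` O.
  by move=> y [z Dz zy]; have [_ _ _] := tP z Dz; apply; exact: ball_cball.
have OW : O `<=` W `|` N.
  move=> y Oy; have [Gy|Ny] := OGN y Oy; [left|by right].
  have Dy : D y by split.
  by exists y => //; rewrite in_ball mdistxx; have [] := tP y Dy.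
have muW : mu W = mu O.
  apply/eqP; rewrite eq_le vol_subset//=.
  rewrite -(measureU0 mW mN N0); apply: vol_subset => //; exact: measurableU.
have Ofn : mu O \is a fin_num by rewrite ge0_fin_numE.
have Ogt : (0 < mu O)%E by rewrite lt0e Ogt0/=.
have [k [kc kW] kO] : exists2 k : set X, compact k /\ k `<=` W & (mu O <= 2%:E * mu k)%E.
  have : ((2^-1)%:E * mu O < mu W)%E.
    rewrite muW -[X in (_ < X)%E](mul1e) -(fineK Ofn) -!EFinM lte_fin ltr_pM2r.
      by rewrite invf_lt1// ltr1n.
    by rewrite fine_gt0// Ogt.
  rewrite ((ds_radon HX).2 W mW) => /ereal_sup_gt[_ [k [kc kW] <-] kO].
  exists k => //; apply: ltW; move: kO.
  by rewrite -lte_pdivlMl ?invr_gt0// invrK.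
have mk : measurable (k : set (borel X)).
  by apply: closed_borel; apply: compact_closed kc; exact: metric_hausdorff.
move: kc; rewrite compact_cover => /(_ X D (fun z => ball z (t z))) [].
- by move=> z _; exact: mdist_open_ball.
- exact: kW.
move=> D' D'D kD'.
pose L := [seq (z, t z) | z <- finmap.enum_fset D'].
have LP x : x \in L -> D x.1 /\ x.2 = t x.1.
  by move=> /mapP[z zD' ->]; split => //=; have := D'D _ zD'; rewrite inE.
have [|s [us sL seps covs]] := greedy_sep (L := L).
  by move=> x /LP[Dx ->]; have [] := tP _ Dx.
have sP x : x \in s -> [/\ D x.1, 0 < x.2, x.2 < T x.1, x.2 < Rh / 4 & cball x.1 x.2 `<=` O].
  by move=> /sL /LP[Dx ->]; have [] := tP _ Dx.
exists s; split => //.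
  by move=> x /sP[[? ?] *].
apply: (le_trans kO); rewrite EFinM -muleA lee_wpmul2l//.
have kcov : k `<=` \big[setU/set0]_(x <- s) ball x.1 (4 * x.2).
  move=> y /kD' [z /= zD' zy]; apply/big_setUP.
  have [|x xs [zx tx]] := covs (z, t z); first by apply/mapP; exists z.
  exists x => //; rewrite in_ball; move: zy zx tx; rewrite in_ball /=.
  have := metric_triangle x.1 z y; rewrite (metric_sym x.1 z).
  by have [_ ? _ _ _] := sP _ xs; lra.
apply: (le_trans (@measure_seq_le _ _ _ (vol X) _ s (fun x => ball x.1 (4 * x.2)) k mk _ kcov)).
  by move=> x; exact: measurable_mball.
rewrite ge0_sume_distrr//.
rewrite big_seq [leRHS]big_seq; apply: lee_sum => x xs.
have [Dx x0_ _ xR _] := sP _ xs; have Rh0 := ds_gt0 HX.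
apply: (@le_trans _ _ (K%:E * (K%:E * mu (ball x.1 x.2)))%E).
  have -> : 4 * x.2 = 2 * (2 * x.2) by ring.
  apply: (le_trans (ds_doubling HX _ _)).
    by apply/andP; split; lra.
  rewrite lee_wpmul2l ?lee_fin ?(ltW K0)//; apply: (ds_doubling HX).
  by apply/andP; split; lra.
rewrite muleA -EFinM -expr2 lee_wpmul2l ?lee_fin ?exprn_ge0 ?(ltW K0)//.
by apply: vol_subset; [exact: measurable_mball|exact: measurable_cball|exact: ball_cball].
Qed.


Lemma sep_cball_disjoint (x y : X * R) : x.2 + y.2 < mdist x.1 y.1 ->
  cball x.1 x.2 `&` cball y.1 y.2 = set0.
Proof.
move=> xy; rewrite -subset0 => z [/= xz yz].
by have := metric_triangle x.1 z y.1; rewrite (metric_sym z); lra.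
Qed.

(** The closed balls already chosen leave an open remainder, to which the step applies again; each
    round removes at least the fraction [(2 * K ^+ 2)^-1] of it. New balls are disjoint from old
    ones, and geodesics turn this into separation of centres. *)
Lemma vitali_iter (O : set X) (n : nat) : open O -> (mu O < +oo)%E -> O `<=` G `|` N ->
  exists s : seq (X * R), [/\ uniq s,
    forall x, x \in s -> [/\ G x.1, 0 < x.2 & x.2 < T x.1],
    {in s &, forall x y, x != y -> x.2 + y.2 < mdist x.1 y.1} &
    (mu (O `\` \big[setU/set0]_(x <- s) cball x.1 x.2) <=
       ((1 - (2 * K ^+ 2)^-1) ^+ n)%:E * mu O)%E].
Proof.
move=> oO Ofin OGN; elim: n => [|n [s [us sP seps sO]]].
  by exists [::]; split => //; rewrite big_nil setD0 expr0 mul1e.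
set U := \big[setU/set0]_(x <- s) cball x.1 x.2 in sO.
have cU : closed U by apply: closed_bigsetU => x _; exact: mdist_closed_ball.
pose O' := O `\` U.
have oO' : open O' by rewrite /O' setDE; apply: openI => //; rewrite openC.
have mO' := open_borel oO'; have mO := open_borel oO.
have O'O : O' `<=` O by move=> x [].
have O'fin : (mu O' < +oo)%E by apply: le_lt_trans Ofin; exact: vol_subset.
have [|s' [us' sP' seps' sO']] := vitali_step oO' O'fin.
  by move=> x /O'O; exact: OGN.
have cross x y : x \in s -> y \in s' -> x.2 + y.2 < mdist x.1 y.1.
  move=> xs ys'; have [_ x20 _] := sP _ xs; have [_ y20 _ yO'] := sP' _ ys'.
  apply: disjoint_cball_sep; rewrite ?ltW// -subset0 => z [xz yz].
  by have [_] := yO' z yz; apply; apply/big_setUP; exists x.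
exists (s ++ s'); split.
- rewrite cat_uniq us us' andbT /=; apply/hasPn => y ys'; apply/negP => ys.
  by have := cross _ _ ys ys'; have [_ y20 _ _] := sP' _ ys'; rewrite mdistxx; lra.
- by move=> x; rewrite mem_cat => /orP[/sP//|/sP'[]].
- move=> x y; rewrite !mem_cat => /orP[xs|xs] /orP[ys|ys] xy.
  + exact: seps.
  + exact: cross.
  + by rewrite addrC metric_sym; exact: cross.
  + exact: seps'.
set U' := \big[setU/set0]_(x <- s') cball x.1 x.2.
have mU' : measurable (U' : set (borel X)).
  by apply: closed_borel; apply: closed_bigsetU => x _; exact: mdist_closed_ball.
have U'O' : U' `<=` O'.
  by move=> z /big_setUP[x xs']; have [_ _ _] := sP' _ xs'; apply.
have -> : O `\` \big[setU/set0]_(x <- s ++ s') cball x.1 x.2 = O' `\` U'.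
  by rewrite big_cat/= -setDDl.
rewrite measureD//; last first.
rewrite (setIidr U'O').
have EU' : mu U' = (\sum_(x <- s') mu (cball x.1 x.2))%E.
  apply: (@measure_seq_disjoint _ _ _ (vol X) _ s' (fun x => cball x.1 x.2)) => //.
    by move=> x; exact: measurable_cball.
  by move=> x y xs ys xy; apply: sep_cball_disjoint; exact: seps'.
rewrite -EU' in sO'.
have Ofn : mu O \is a fin_num by rewrite ge0_fin_numE.
have O'fn : mu O' \is a fin_num by rewrite ge0_fin_numE.
have U'fn : mu U' \is a fin_num.
  by rewrite ge0_fin_numE//; apply: le_lt_trans O'fin; exact: vol_subset.
have {}sO : (mu O' <= ((1 - (2 * K ^+ 2)^-1) ^+ n)%:E * mu O)%E by [].
have K2 : 1 <= K ^+ 2 by rewrite exprn_ege1// (ds_ge1 HX).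
have [a Ea] : exists b, mu O = b%:E by exists (fine (mu O)); rewrite fineK.
have [a' Ea'] : exists b, mu O' = b%:E by exists (fine (mu O')); rewrite fineK.
have [u Eu] : exists b, mu U' = b%:E by exists (fine (mu U')); rewrite fineK.
suff H : (a'%:E - u%:E <= ((1 - (2 * K ^+ 2)^-1) ^+ n.+1)%:E * mu O)%E.
  by rewrite -Ea' -Eu in H; exact: H.
rewrite Ea -EFinB -EFinM lee_fin.
move: sO sO'; rewrite Ea Ea' Eu -!EFinM !lee_fin => h1 h2.
have iK : 0 < (2 * K ^+ 2)^-1 by rewrite invr_gt0; lra.
have iK1 : (2 * K ^+ 2)^-1 <= 1 by rewrite invf_le1; lra.
have : (2 * K ^+ 2)^-1 * a' <= u by rewrite ler_pdivrMl//; lra.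
move: iK iK1; set w := (2 * K ^+ 2)^-1 => iK iK1 h3.
rewrite exprS -mulrA.
have : (1 - w) * a' <= (1 - w) * ((1 - w) ^+ n * a) by rewrite ler_wpM2l// subr_ge0.
lra.
Qed.

(** Finitely many strict inequalities hold with some room, of which [e] is a fraction. The radii
    grow by [e], so that open balls contain the earlier closed ones. The remaining room stays in the
    statement: it survives the passage to approximating spaces and leaves space for the collars of
    the bumps. *)
Lemma vitali (O : set X) (eps : R) : open O -> (mu O < +oo)%E -> O `<=` G `|` N ->
  0 < eps ->
  exists s : seq (X * R), exists2 e : R, 0 < e & [/\ uniq s,
    forall x, x \in s -> [/\ G x.1, 0 < x.2 & x.2 + e < T x.1],
    {in s &, forall x y, x != y -> x.2 + y.2 + 2 * e < mdist x.1 y.1} &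
    (mu O <= \sum_(x <- s) mu (ball x.1 x.2) + eps%:E)%E].
Proof.
move=> oO Ofin OGN eps0; have mO := open_borel oO.
have Ofn : mu O \is a fin_num by rewrite ge0_fin_numE.
have K2 : 1 <= K ^+ 2 by rewrite exprn_ege1// (ds_ge1 HX).
pose w := (2 * K ^+ 2)^-1.
have w0 : 0 < w by rewrite invr_gt0; lra.
have w1 : w <= 1 by rewrite invf_le1; lra.
have [n nP] : exists n, (1 - w) ^+ n * fine (mu O) <= eps.
  have : (fun n => (1 - w) ^+ n * fine (mu O)) @ \oo --> 0 * fine (mu O).
    apply: cvgMl; apply: cvg_expr; rewrite ger0_norm; lra.
  rewrite mul0r => /cvgrPdist_le /(_ _ eps0)[n _ nP]; exists n.
  have := nP n (leqnn n); rewrite /= sub0r normrN; apply: le_trans; exact: ler_norm.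
have [s [us sP seps sO]] := vitali_iter n oO Ofin OGN.
have [|e1 e10 e1P] := @seq_pos_lower R _ s (fun x => T x.1 - x.2).
  by move=> x /sP[_ _]; rewrite subr_gt0.
have [|e2 e20 e2P] := @seq_pos_lower R _ [seq xy <- [seq (x, y) | x <- s, y <- s] | xy.1 != xy.2]
    (fun xy => mdist xy.1.1 xy.2.1 - (xy.1.2 + xy.2.2)).
  move=> xy; rewrite mem_filter => /andP[xy12 /allpairsP[[x y] /= [xs ys xyE]]].
  by move: xy12; rewrite xyE /= => xy12; rewrite subr_gt0 seps.
pose e := Num.min e1 e2 / 8.
have m0 : 0 < Num.min e1 e2 by rewrite lt_min e10.
have e0 : 0 < e by rewrite divr_gt0.
have ee1 : 8 * e <= e1 by rewrite /e mulrC divfK// ge_min lexx.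
have ee2 : 8 * e <= e2 by rewrite /e mulrC divfK// ge_min lexx orbT.
exists [seq (x.1, x.2 + e) | x <- s], e => //; split.
- rewrite map_inj_uniq// => -[x a] [y b] /= [-> /addIr ->]//.
- move=> _ /mapP[x xs ->] /=; have [Gx x20 _] := sP _ xs; split => //; first lra.
  by have := e1P x xs; lra.
- move=> _ _ /mapP[x xs ->] /mapP[y ys ->] /= xy.
  have {}xy : x != y by apply: contra xy => /eqP ->.
  have := e2P (x, y); rewrite mem_filter /= xy /= => h.
  by have := h (allpairs_f _ xs ys); lra.
pose U := \big[setU/set0]_(x <- s) cball x.1 x.2.
have mU : measurable (U : set (borel X)).
  by apply: closed_borel; apply: closed_bigsetU => x _; exact: mdist_closed_ball.
rewrite big_map /=.
apply: (@le_trans _ _ (mu (U `|` (O `\` U)))).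
  apply: vol_subset => //; first by apply: measurableU => //; exact: measurableD.
  by move=> x Ox; have [Ux|Ux] := pselect (U x); [left|right].
apply: (le_trans (measureU2 _ _ _)) => //; first exact: measurableD.
apply: leeD; last first.
  by apply: (le_trans sO); rewrite -(fineK Ofn) -EFinM lee_fin.
apply: (le_trans (@measure_seq_le _ _ _ (vol X) _ s (fun x => cball x.1 x.2) U mU _ _)).
- by move=> x; exact: measurable_cball.
- by [].
apply: lee_sum => x _; apply: vol_subset; [exact: measurable_cball|exact: measurable_mball|].
by move=> y /= xy; rewrite in_ball; lra.
Qed.

End vitali.

End doubling_space_theory.

(** * The chain estimate *)

Section finite_volume_integrals.
Context d (T : measurableType d) (R : realType) (mu : {measure set T -> \bar R}).
Implicit Types (A B : set T) (f : T -> R).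

Lemma integrable_cst_lty A (k : R) : measurable A -> (mu A < +oo)%E ->
  mu.-integrable A (EFin \o cst k).
Proof.
move=> mA Afin; apply/integrableP; split; first exact/measurable_EFinP.
by rewrite /= integral_cst// lte_mul_pinfty// ?lee_fin.
Qed.

Lemma integrable_subr_cst A f (k : R) : measurable A -> (mu A < +oo)%E ->
  mu.-integrable A (EFin \o f) -> mu.-integrable A (EFin \o (fun x => f x - k)).
Proof.
move=> mA Afin fi.
have := integrableB mA fi (integrable_cst_lty k mA Afin).
by apply: eq_integrable.
Qed.

Lemma integrable_normr A f : measurable A ->
  mu.-integrable A (EFin \o f) -> mu.-integrable A (EFin \o (fun x => `|f x|)).
Proof. by move=> mA fi; apply: (integrable_abse fi). Qed.

Lemma pint_lty_integrable (p : R) A f : 1 < p -> measurable A -> (mu A < +oo)%E ->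
  measurable_fun A f -> (pint mu p A f < +oo)%E -> mu.-integrable A (EFin \o f).
Proof.
move=> p1 mA Afin mf ffin; apply/integrableP; split; first exact/measurable_EFinP.
apply: (@le_lt_trans _ _ (\int[mu]_(x in A) (cst 1%E x + (`|f x| `^ p)%:E))%E).
  apply: ge0_le_integral => //.
  - by apply: measurableT_comp => //; exact/measurable_EFinP.
  - by apply: emeasurable_funD => //; exact: measurable_EFin_powR_norm.
  - move=> x _ /=; rewrite -EFinD lee_fin.
    have [f1|f1] := leP `|f x| 1; first by rewrite (le_trans f1)// lerDl powR_ge0.
    rewrite -[leLHS]add0r lerD// -[leLHS]powRr1// ler_powR//; exact: ltW.
rewrite ge0_integralD//; last exact: measurable_EFin_powR_norm.
by rewrite integral_cst// mul1e lte_add_pinfty.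
Qed.

Lemma Rintegral_subset A B f : measurable A -> measurable B -> A `<=` B ->
  mu.-integrable B (EFin \o f) -> (forall x, B x -> 0 <= f x) ->
  \int[mu]_(x in A) f x <= \int[mu]_(x in B) f x.
Proof.
move=> mA mB AB fi f0; have fiA := integrableS mB mA AB fi.
rewrite /Rintegral fine_le ?(integrable_fin_num mA fiA) ?(integrable_fin_num mB fi)//.
apply: ge0_subset_integral => //.
by case/integrableP : fi.
Qed.

End finite_volume_integrals.

Lemma integral_seq_cover_le d (T : measurableType d) (R : realType)
    (mu : {measure set T -> \bar R}) (I : Type) (s : seq I) (F : I -> set T)
    (E D : set T) (g : T -> \bar R) :
  measurable E -> measurable D -> (forall i, measurable (F i)) ->
  measurable_fun E g -> (forall x, E x -> (0 <= g x)%E) ->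
  E `<=` \big[setU/set0]_(i <- s) F i `|` D ->
  (\int[mu]_(x in E) g x <=
    \sum_(i <- s) \int[mu]_(x in E `&` F i) g x + \int[mu]_(x in E `&` D) g x)%E.
Proof.
move=> mE mD mF mg g0; elim: s E mE mg g0 => [|i s IH] E mE mg g0.
  by rewrite !big_nil set0U add0e => ED; rewrite setIidl.
rewrite !big_cons => Es.
have mEi : measurable (E `&` F i) by exact: measurableI.
have mEDi : measurable (E `\` F i) by exact: measurableD.
have EE : E = (E `&` F i) `|` (E `\` F i) by rewrite setUIDK.
rewrite {1}EE ge0_integral_setU//; last 3 first.
- by rewrite -EE.
- by rewrite -EE.
- by apply/disj_setPS => x [[_ ?] []].
rewrite -addeA leeD2l//; apply: (le_trans (IH _ mEDi _ _ _)).
- by apply: measurable_funS mg => // x [].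
- by move=> x [/g0].
- by move=> x [Ex nFx]; have [[//|?]|?] := Es x Ex; [left|right].
apply: leeD.
  apply: lee_sum => j _; apply: ge0_subset_integral => //.
  - exact: measurableI.
  - exact: measurableI.
  - by apply: measurable_funS mg => // x [].
  - by move=> x [/g0].
  - by move=> x [[]].
apply: ge0_subset_integral => //.
- exact: measurableI.
- exact: measurableI.
- by apply: measurable_funS mg => // x [].
- by move=> x [/g0].
- by move=> x [[]].
Qed.

Section mean_theory.
Context {R : realType} {X : pmmSpace R}.
Local Notation mu A := (vol X (A : set (borel X))).
Local Notation m A := (fine (vol X (A : set (borel X)))).
Local Notation bset A := (A : set (borel X)).
Local Notation integ A f := ((vol X).-integrable (bset A) (EFin \o (f : borel X -> R))).

Lemma mean_sub (A : set X) (f : X -> R) (c : R) : measurable (bset A) ->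
  (0 < mu A < +oo)%E -> integ A f ->
  mean A f - c = (m A)^-1 * \int[vol X]_(x in bset A) (f x - c).
Proof.
move=> mA /andP[A0 Afin] fi; have mA0 : 0 < m A by rewrite fine_gt0// A0.
rewrite RintegralB//; last exact: integrable_cst_lty.
rewrite Rintegral_cst// /mean; field; rewrite gt_eqF//.
Qed.

Lemma mean_dist_le (A : set X) (f : X -> R) (c : R) : measurable (bset A) ->
  (0 < mu A < +oo)%E -> integ A f ->
  `|mean A f - c| <= (m A)^-1 * \int[vol X]_(x in bset A) `|f x - c|.
Proof.
move=> mA Av fi; have /andP[A0 Afin] := Av.
have mA0 : 0 < m A by rewrite fine_gt0// A0.
rewrite mean_sub// normrM gtr0_norm ?invr_gt0// ler_wpM2l ?invr_ge0 ?(ltW mA0)//.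
by apply: le_normr_Rintegral => //; exact: integrable_subr_cst.
Qed.

Lemma mean_dist_mean_le (A B : set X) (f : X -> R) (C : R) :
  measurable (bset A) -> measurable (bset B) -> A `<=` B ->
  (0 < mu A)%E -> (mu B < +oo)%E -> m B <= C * m A -> integ B f ->
  `|mean A f - mean B f| <= C * ((m B)^-1 * \int[vol X]_(x in bset B) `|f x - mean B f|).
Proof.
move=> mA mB AB A0 Bfin BCA fi.
have Afin : (mu A < +oo)%E by apply: le_lt_trans Bfin; rewrite le_measure ?inE.
have B0 : (0 < mu B)%E by apply: lt_le_trans A0 _; rewrite le_measure ?inE.
have mA0 : 0 < m A by rewrite fine_gt0// A0.
have mB0 : 0 < m B by rewrite fine_gt0// B0.
have fiA := integrableS mB mA AB fi.
apply: (le_trans (mean_dist_le _ _ _ fiA)); rewrite ?A0//.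
have i0 : 0 <= \int[vol X]_(x in bset B) `|f x - mean B f| by exact: Rintegral_ge0.
apply: (@le_trans _ _ ((m A)^-1 * \int[vol X]_(x in bset B) `|f x - mean B f|)).
  rewrite ler_wpM2l ?invr_ge0 ?(ltW mA0)//; apply: Rintegral_subset => //.
  by apply: integrable_normr => //; exact: integrable_subr_cst.
by rewrite mulrA ler_wpM2r// ler_pdivlMr// ler_pdivrMl// mulrC.
Qed.

End mean_theory.

Section chain.
Context {R : realType} {X : pmmSpace R} (K Rh : R) (HX : doubling_space X K Rh).
Local Notation mu A := (vol X (A : set (borel X))).
Local Notation m A := (fine (vol X (A : set (borel X)))).
Local Notation bset A := (A : set (borel X)).
Local Notation integ A f := ((vol X).-integrable (bset A) (EFin \o (f : borel X -> R))).

Let K0 : 0 < K. Proof. by apply: lt_le_trans (ds_ge1 HX); exact: ltr01. Qed.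

(* The centers move along the geodesic from [y] towards [x0]. *)
Lemma chain_centers (x0 y : X) (r t : R) : 0 <= t -> mdist y x0 + t <= r ->
  exists w : R -> X, [/\ w t = y,
    forall s, t <= s -> s <= r -> mdist (w s) x0 + s <= r &
    forall s1 s2, t <= s1 -> s1 <= s2 -> mdist (w s1) (w s2) <= s2 - s1].
Proof.
move=> t0 yr; have [c [c0 c1 cd]] := ds_geodesic HX y x0.
set D := mdist y x0 in yr c1 cd; have D0 : 0 <= D by exact: mdist_ge0.
pose u s := Num.min (s - t) D.
have u0 s : t <= s -> 0 <= u s <= D.
  by move=> ts; rewrite /u le_min D0 andbT subr_ge0 ts ge_min lexx orbT.
exists (fun s => c (u s)); split.
- by rewrite /u subrr min_l.
- move=> s ts sr; rewrite -c1 cd ?lexx ?D0 ?u0//.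
  have /andP[_ uD] := u0 s ts; rewrite distrC ger0_norm ?subr_ge0//.
  by rewrite /u; have [?|?] := leP (s - t) D; lra.
- move=> s1 s2 ts1 s12; have ts2 := le_trans ts1 s12.
  rewrite cd ?u0// distrC ger0_norm ?subr_ge0; rewrite /u;
  by have [?|?] := leP (s1 - t) D; have [?|?] := leP (s2 - t) D; lra.
Qed.

(** [q] stands for the [p]-th power of a gradient, and [HP] is the Poincare inequality multiplied by
    the volume, on balls inside [U] only. In this form the estimate applies both to a Sobolev
    function on the large ball and to [f - mean f] on a smaller one. *)
Context (x0 : X) (r p tau : R) (f q : X -> R).
Local Notation U := (ball x0 r).
Hypotheses (p1 : 1 < p) (tau0 : 0 < tau) (r0 : 0 < r) (rRh : 4 * r < Rh).
Hypothesis vpos : forall z t, mdist z x0 < r -> 0 < t -> (0 < mu (ball z t))%E.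
Hypothesis mf : measurable_fun (bset U) (f : borel X -> R).
Hypothesis fp : (pint (vol X) p (bset U) f < +oo)%E.
Hypothesis qi : integ U q.
Hypothesis q0 : forall x, 0 <= q x.
Hypothesis HP : forall y t, 0 < t -> mdist y x0 + t <= r ->
  \int[vol X]_(x in bset (ball y t)) `|f x - mean (ball y t) f| <=
  tau * t * (m (ball y t) *
    ((m (ball y t))^-1 * \int[vol X]_(x in bset (ball y t)) q x) `^ p^-1).

Let p0 : 0 < p. Proof. exact: lt_trans p1. Qed.

Let mU : measurable (bset U). Proof. exact: measurable_mball. Qed.

Let Ufin : (mu U < +oo)%E. Proof. exact: vol_ball_lty HX _ _. Qed.

Let mB y t : measurable (bset (ball y t)). Proof. exact: measurable_mball. Qed.

Let Bfin y t : (mu (ball y t) < +oo)%E. Proof. exact: vol_ball_lty HX _ _. Qed.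

Let fi : integ U f. Proof. exact: pint_lty_integrable p1 mU Ufin mf fp. Qed.

Let BU y t : mdist y x0 + t <= r -> ball y t `<=` U.
Proof. by rewrite metric_sym; exact: mball_sub. Qed.

Let yU y t : 0 < t -> mdist y x0 + t <= r -> mdist y x0 < r.
Proof. by lra. Qed.

Let fiB y t : mdist y x0 + t <= r -> integ (ball y t) f.
Proof. by move=> yt; exact: integrableS mU (mB _ _) (BU yt) fi. Qed.

Let qiB y t : mdist y x0 + t <= r -> integ (ball y t) q.
Proof. by move=> yt; exact: integrableS mU (mB _ _) (BU yt) qi. Qed.

Let mpos y t : 0 < t -> mdist y x0 + t <= r -> 0 < m (ball y t).
Proof. by move=> t0 yt; rewrite fine_gt0// vpos ?Bfin//; exact: yU yt. Qed.

Definition mean_energy (y : X) (t : R) : R :=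
  (m (ball y t))^-1 * \int[vol X]_(x in bset (ball y t)) q x.

Lemma mean_energy_ge0 y t : 0 <= mean_energy y t.
Proof.
apply: mulr_ge0; first by rewrite invr_ge0 fine_ge0.
by apply: Rintegral_ge0 => x _; exact: q0.
Qed.

Lemma vol_ball_double (z w : X) (s t : R) : 0 < t -> 2 * t < Rh -> mdist w z + s <= 4 * t ->
  m (ball z s) <= K ^+ 2 * m (ball w t).
Proof.
move=> t0 tR sub; rewrite -lee_fin EFinM !fineK ?(vol_ball_fin HX)//.
apply: (@le_trans _ _ (mu (ball w (4 * t)))).
  by apply: vol_subset => //; exact: mball_sub.
have -> : 4 * t = 2 * (2 * t) by ring.
apply: (le_trans (ds_doubling HX _ _)); first by apply/andP; split; lra.
rewrite expr2 EFinM -muleA lee_wpmul2l ?lee_fin ?(ltW K0)//.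
by apply: (ds_doubling HX); apply/andP; split; lra.
Qed.

(** The balls are nested and their radii differ by a factor of at most two, so their volumes differ
    by at most [K ^+ 2]; the difference of means is then controlled by the oscillation on the larger
    ball. *)
Lemma chain_step (w w' : X) (s s' : R) : 0 < s' -> s' <= s -> s <= 2 * s' ->
  mdist w x0 + s <= r -> mdist w' w <= s - s' ->
  `|mean (ball w' s') f - mean (ball w s) f| <=
    K ^+ 2 * tau * s * (mean_energy w s) `^ p^-1.
Proof.
move=> s'0 s's ss' ws ww'; have s0 : 0 < s by apply: lt_le_trans s's.
have w's' : mdist w' x0 + s' <= r.
  by have := metric_triangle w' w x0; lra.
have sr : s <= r by have := mdist_ge0 w x0; lra.
have := @mean_dist_mean_le R X (ball w' s') (ball w s) f (K ^+ 2) (mB _ _) (mB _ _).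
move=> /(_ _ _ (Bfin _ _) _ (fiB ws)) H.
apply: (le_trans (H _ _ _)).
- by apply: mball_sub; rewrite metric_sym; lra.
- by apply: vpos => //; exact: yU w's'.
- apply: vol_ball_double => //.
    have E : s' <= r by lra. have E2 : 2 * s' <= 4 * r by lra. exact: le_lt_trans E2 rRh.
  lra.
have H2 : (m (ball w s))^-1 * \int[vol X]_(x in bset (ball w s)) `|f x - mean (ball w s) f| <=
    tau * s * (mean_energy w s) `^ p^-1.
  rewrite ler_pdivrMl ?mpos// mulrCA; exact: HP.
have K20 : 0 <= K ^+ 2 by rewrite exprn_ge0// ltW.
by apply: (le_trans (ler_wpM2l K20 H2)); rewrite !mulrA.
Qed.

(** The weight vanishes at scales not larger than the final radius [t], where the chain has come to
    rest; thus a common length [N] serves balls of different radii. *)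
Definition chain_weight (w : X) (t s : R) : R := if t < s then mean_energy w s else 0.

Lemma chain_weight_ge0 w t s : 0 <= chain_weight w t s.
Proof. by rewrite /chain_weight; case: ifP => // _; exact: mean_energy_ge0. Qed.

(* The means telescope along a chain of nested balls from [ball y t] to a ball of
   radius [rho]; Jensen's inequality with the weights [2^-n] bounds the p-th
   power of the sum. *)
Lemma chain_ball_bound (y : X) (t rho M0 : R) (N : nat) :
  0 < t -> t <= rho -> rho <= r -> mdist y x0 + t <= r -> rho / 2 ^+ N <= t ->
  0 <= M0 ->
  (forall w', mdist w' x0 + rho <= r -> `|mean (ball w' rho) f| <= M0) ->
  exists w : nat -> X, [/\
    forall n, t < rho / 2 ^+ n -> mdist (w n) x0 + rho / 2 ^+ n <= r,
    forall n, t < rho / 2 ^+ n -> mdist (w n) y + t <= rho / 2 ^+ n &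
    `|mean (ball y t) f| `^ p <= 2 `^ (p - 1) * (M0 `^ p +
      (K ^+ 2 * tau * rho) `^ p * (2 `^ (p - 1) *
        \sum_(n <- iota 0 N) 2^-1 ^+ n * chain_weight (w n) t (rho / 2 ^+ n)))].
Proof.
move=> t0 trho rhor yt rN M00 HM.
have rho0 : 0 < rho by apply: lt_le_trans trho.
have [w [wt wr wd]] := chain_centers (ltW t0) yt.
pose Rn n := Num.max (rho / 2 ^+ n) t.
have tR n : t <= Rn n by rewrite le_max lexx orbT.
have rhoS n : rho / 2 ^+ n = 2 * (rho / 2 ^+ n.+1).
  by rewrite exprS; field; rewrite expf_neq0.
have rho_ge0 n : 0 < rho / 2 ^+ n by rewrite divr_gt0// exprn_gt0.
have rholt n : rho / 2 ^+ n <= rho.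
  by rewrite ler_pdivrMr ?exprn_gt0// ler_peMr ?(ltW rho0)// exprn_ege1// ler1n.
have Rr n : Rn n <= r by rewrite ge_max (le_trans (rholt n)) ?(le_trans trho).
have RS n : Rn n.+1 <= Rn n /\ Rn n <= 2 * Rn n.+1.
  have := rhoS n; have := rho_ge0 n.+1; rewrite /Rn => h1 h2.
  by have [?|?] := leP (rho / 2 ^+ n) t; have [?|?] := leP (rho / 2 ^+ n.+1) t; lra.
have RE n : t < rho / 2 ^+ n -> Rn n = rho / 2 ^+ n by move=> /ltW h; rewrite /Rn max_l.
exists (fun n => w (Rn n)); split.
- by move=> n h; rewrite -RE//; exact: wr.
- move=> n h; rewrite -(RE n h); have := wd t (Rn n) (lexx _) (tR n).
  by rewrite wt metric_sym; lra.
pose mn n := mean (ball (w (Rn n)) (Rn n)) f.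
have RNt : Rn N = t by rewrite /Rn max_r.
have R0rho : Rn 0%N = rho by rewrite /Rn expr0 divr1 max_l.
have mN : mean (ball y t) f = mn N by rewrite /mn RNt wt.
have m0M : `|mn 0%N| <= M0 by rewrite /mn R0rho; apply: HM; rewrite -R0rho; exact: wr.
pose v n := (chain_weight (w (Rn n)) t (rho / 2 ^+ n)) `^ p^-1.
pose C := K ^+ 2 * tau * rho.
have C0 : 0 <= C by rewrite !mulr_ge0 ?exprn_ge0 ?ltW.
have stepn n : `|mn n.+1 - mn n| <= C * (2^-1 ^+ n * v n).
  have [h1 h2] := RS n; rewrite /mn /v /chain_weight; case: ifPn => [tn|tn].
    have := @chain_step (w (Rn n)) (w (Rn n.+1)) (Rn n) (Rn n.+1).
    move=> /(_ (lt_le_trans t0 (tR _)) h1 h2 (wr _ (tR _) (Rr _))) H.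
    apply: (le_trans (H _)); first by apply: wd.
    by rewrite RE// /C -exprVn !mulrA (mulrC _ rho) !mulrA lexx.
  have Rt : Rn n = t by rewrite /Rn max_r// leNgt.
  have Rt' : Rn n.+1 = t by apply/eqP; rewrite eq_le tR andbT -Rt.
  by rewrite Rt Rt' subrr normr0 mulr_ge0// mulr_ge0 ?powR_ge0// exprn_ge0// invr_ge0.
have tele : `|mn N| <= M0 + C * \sum_(n <- iota 0 N) 2^-1 ^+ n * v n.
  have -> : mn N = mn 0%N + \sum_(0 <= n < N) (mn n.+1 - mn n).
    by rewrite telescope_sumr// addrC subrK.
  apply: (le_trans (ler_normD _ _)); rewrite lerD// (le_trans (ler_norm_sum _ _ _))//.
  rewrite mulr_sumr /index_iota subn0; apply: ler_sum => n _; exact: stepn.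
have S0 : 0 <= \sum_(n <- iota 0 N) 2^-1 ^+ n * v n.
  by apply: sumr_ge0 => n _; rewrite mulr_ge0 ?powR_ge0// exprn_ge0// invr_ge0.
rewrite mN; apply: (@le_trans _ _ ((M0 + C * \sum_(n <- iota 0 N) 2^-1 ^+ n * v n) `^ p)).
  by rewrite ge0_ler_powR ?nnegrE ?(ltW p0)// addr_ge0// mulr_ge0.
apply: (le_trans (powRD_le p1 _ _)) => //; first by rewrite mulr_ge0.
rewrite ler_wpM2l ?powR_ge0// lerD2l powRM// -/C ler_wpM2l ?powR_ge0//.
apply: (le_trans (powR_sum_le p1 (L := 2) _ _ _ _)) => //.
- have -> : \sum_(n <- iota 0 N) 2^-1 ^+ n = series (geometric 1 2^-1) N :> R.
    rewrite /series/= /index_iota subn0; apply: eq_bigr => n _; by rewrite mul1r.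
  rewrite geometric_seriesE; last by rewrite lt_eqF// invf_lt1// ltr1n.
  have E2 : 1 - 2^-1 = 2^-1 :> R by field.
  rewrite /= E2 mul1r ler_pdivrMr ?invr_gt0// mulfV// gerBl exprn_ge0// invr_ge0.
- by move=> n; exact: powR_ge0.
- rewrite ler_wpM2l ?powR_ge0//; apply: ler_sum => n _.
  by rewrite /v -powRrM mulVf ?gt_eqF// powRr1 ?chain_weight_ge0.
Qed.

Lemma sep_ball_disjoint (x y : X * R) : x.2 + y.2 <= mdist x.1 y.1 ->
  ball x.1 x.2 `&` ball y.1 y.2 = set0.
Proof.
move=> xy; rewrite -subset0 => z []; rewrite !in_ball => xz yz.
by have := metric_triangle x.1 z y.1; rewrite (metric_sym z); lra.
Qed.

Lemma sum_vol_sep (s : seq (X * R)) (A : set X) : measurable (bset A) ->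
  (mu A < +oo)%E -> uniq s ->
  {in s &, forall x y, x != y -> x.2 + y.2 <= mdist x.1 y.1} ->
  (forall x, x \in s -> ball x.1 x.2 `<=` A) ->
  \sum_(x <- s) m (ball x.1 x.2) <= m A.
Proof.
move=> mA Afin us seps sA.
rewrite -lee_fin -sumEFin.
under eq_bigr do rewrite fineK ?(vol_ball_fin HX)//.
rewrite fineK ?ge0_fin_numE//.
rewrite -(@measure_seq_disjoint _ _ _ (vol X) _ s (fun x => ball x.1 x.2))//; last first.
  by move=> x y xs ys xy; apply: sep_ball_disjoint; exact: seps.
apply: vol_subset => //; first by apply: bigsetU_measurable => x _; exact: measurable_mball.
by move=> z /big_setUP[x xs]; exact: sA.
Qed.

(* Fubini: the balls [w x] of the same radius [s] may overlap a lot, but the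
   weights [m (ball x)] of disjoint balls control the overlap. *)
Lemma chain_fubini (s : seq (X * R)) (w : X * R -> X) (rho : R) :
  0 < rho -> rho <= r -> uniq s ->
  {in s &, forall x y, x != y -> x.2 + y.2 <= mdist x.1 y.1} ->
  (forall x, x \in s -> x.2 < rho -> mdist (w x) x0 + rho <= r) ->
  (forall x, x \in s -> x.2 < rho -> mdist (w x) x.1 + x.2 <= rho) ->
  \sum_(x <- s) m (ball x.1 x.2) * chain_weight (w x) x.2 rho <=
    K ^+ 2 * \int[vol X]_(z in bset U) q z.
Proof.
move=> rho0 rhor us seps wr wx.
pose P (x : X * R) := x.2 < rho.
have -> : \sum_(x <- s) m (ball x.1 x.2) * chain_weight (w x) x.2 rho =
    \sum_(x <- s | P x) m (ball x.1 x.2) * mean_energy (w x) rho.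
  rewrite [RHS]big_mkcond/=; apply: eq_bigr => x _; rewrite /chain_weight /P.
  by case: ifP => // _; rewrite mulr0.
rewrite -big_filter; set s' := [seq x <- s | P x].
have s'P x : x \in s' -> [/\ x \in s & x.2 < rho] by rewrite mem_filter => /andP[].
pose a x : R := m (ball x.1 x.2) / m (ball (w x) rho).
have a0 x : 0 <= a x by rewrite divr_ge0// fine_ge0.
have mq : measurable_fun (bset U) (fun z : borel X => (q z)%:E) by case/integrableP : qi.
have mqW x : measurable_fun (bset U) (fun z : borel X => ((q \_ (ball (w x) rho)) z)%:E).
  apply/measurable_EFinP/measurable_restrict => //.
  by move/measurable_EFinP : mq; apply: measurable_funS => // z [].
have q0W x (z : X) : 0 <= (q \_ (ball (w x) rho)) z by rewrite /patch; case: ifP.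
rewrite -lee_fin EFinM fineK; last by apply: integrable_fin_num.
apply: (@le_trans _ _ (\int[vol X]_(z in bset U) (\sum_(x <- s') (a x)%:E * ((q \_ (ball (w x) rho)) z)%:E)))%E.
  rewrite ge0_integral_sum//; last 2 first.
  - by move=> x; apply: measurable_funeM; exact: mqW.
  - by move=> x z _; rewrite -EFinM lee_fin mulr_ge0.
  rewrite -sumEFin big_seq [leRHS]big_seq; apply: lee_sum => x xs.
  have [xs0 xrho] := s'P x xs.
  rewrite ge0_integralZl_EFin//; last by move=> z _; rewrite lee_fin.
  rewrite /a /mean_energy mulrA EFinM lee_wpmul2l ?lee_fin ?divr_ge0 ?fine_ge0//.
  rewrite fineK; last by apply: integrable_fin_num => //; exact/qiB/wr.
  have := @integral_mkcondr _ _ _ (vol X) (bset U) (bset (ball (w x) rho)) (fun z => (q z)%:E).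
  have -> : U `&` ball (w x) rho = ball (w x) rho by apply: setIidr; exact/BU/wr.
  by move=> ->; rewrite restrict_EFin.
rewrite -ge0_integralZl_EFin ?exprn_ge0 ?(ltW K0)//; last by move=> z _; rewrite lee_fin.
apply: ge0_le_integral => //.
- by move=> z _; rewrite sume_ge0// => x _; rewrite -EFinM lee_fin mulr_ge0.
- by apply: emeasurable_sum => x; apply: measurable_funeM; exact: mqW.
- exact: measurable_funeM.
move=> z Uz; under eq_bigr do rewrite -EFinM.
rewrite sumEFin -EFinM lee_fin.
pose Q (x : X * R) := `[< ball (w x) rho z >].
have -> : \sum_(x <- s') a x * (q \_ (ball (w x) rho)) z = (\sum_(x <- s' | Q x) a x) * q z.
  rewrite mulr_suml [RHS]big_mkcond/=; apply: eq_bigr => x _; rewrite /Q /patch.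
  by case: asboolP => [h|h]; [rewrite mem_set|rewrite memNset//; exact: mulr0].
rewrite ler_wpM2r// -big_filter; set s2 := [seq x <- s' | Q x].
have s2P x : x \in s2 -> [/\ x \in s, x.2 < rho & ball (w x) rho z].
  by rewrite mem_filter => /andP[/asboolP h /s'P[]].
have zr : mdist z x0 < r by rewrite metric_sym -in_ball.
have mz : 0 < m (ball z (2 * rho)).
  by rewrite fine_gt0// vpos ?Bfin// mulr_gt0.
(* The small balls whose chain ball contains [z] all lie in the ball of radius [2 * rho] about [z],
   whose volume is at most [K ^+ 2] times that of any of these chain balls. *)
apply: (@le_trans _ _ (\sum_(x <- s2) K ^+ 2 * (m (ball x.1 x.2) / m (ball z (2 * rho))))).
  rewrite big_seq [leRHS]big_seq; apply: ler_sum => x /s2P[xs xrho].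
  rewrite in_ball => wz; have wxr := wr x xs xrho.
  have mw := mpos rho0 wxr.
  rewrite /a mulrCA ler_wpM2l ?fine_ge0//.
  rewrite -[leLHS]mul1r ler_pdivrMr// mulrAC ler_pdivlMr// mul1r.
  apply: vol_ball_double => //; last by lra.
  have E2 : 2 * rho <= 4 * r by lra.
  exact: le_lt_trans E2 rRh.
rewrite -mulr_sumr -mulr_suml ler_piMr ?exprn_ge0 ?(ltW K0)// ler_pdivrMr// mul1r.
apply: sum_vol_sep => //.
- by rewrite !filter_uniq.
- by move=> x y /s2P[xs _ _] /s2P[ys _ _]; exact: seps.
- move=> x /s2P[xs xrho]; rewrite in_ball => wz.
  apply: mball_sub; have := wx x xs xrho.
  by have := metric_triangle z (w x) x.1; rewrite (metric_sym z (w x)); lra.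
Qed.

Lemma sum_Rintegral_sep (s : seq (X * R)) (h : X -> R) : uniq s ->
  {in s &, forall x y, x != y -> x.2 + y.2 <= mdist x.1 y.1} ->
  (forall x, x \in s -> ball x.1 x.2 `<=` U) ->
  integ U h -> (forall x, 0 <= h x) ->
  \sum_(x <- s) \int[vol X]_(z in bset (ball x.1 x.2)) h z <= \int[vol X]_(z in bset U) h z.
Proof.
move=> us seps sU hi h0.
have mh : measurable_fun (bset U) (fun z : borel X => (h z)%:E) by case/integrableP : hi.
rewrite -lee_fin -sumEFin fineK; last exact: integrable_fin_num.
have E : (\sum_(x <- s) (\int[vol X]_(z in bset (ball x.1 x.2)) h z)%:E =
    \sum_(x <- s) \int[vol X]_(z in bset (ball x.1 x.2)) (h z)%:E)%E.
  rewrite big_seq [RHS]big_seq; apply: eq_bigr => x xs.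
  rewrite fineK//; apply: integrable_fin_num => //.
  exact: integrableS mU (mB _ _) (sU _ xs) hi.
have subU : \big[setU/set0]_(x <- s) ball x.1 x.2 `<=` U.
  by move=> z /big_setUP[x xs]; exact: sU.
have mbig : measurable (bset (\big[setU/set0]_(x <- s) ball x.1 x.2)).
  by apply: bigsetU_measurable => x _; exact: measurable_mball.
rewrite E -(@ge0_integral_bigsetU _ _ _ (vol X) _ (fun x : X * R => ball x.1 x.2 : set (borel X)))//.
- by apply: ge0_subset_integral => // z _; rewrite lee_fin.
- move=> x y /= xs ys [z [xz yz]]; apply/eqP/negPn/negP => xy.
  suff : (ball x.1 x.2 `&` ball y.1 y.2) z by rewrite (sep_ball_disjoint (seps _ _ xs ys xy)).
  by split.
- exact: measurable_funS mh.
- by move=> z _; rewrite lee_fin.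
Qed.

(** The inequality [v ^ (1 / p) <= 1 + v] makes the right-hand side of Poincare additive over
    disjoint balls. The total oscillation is then proportional to the cap [theta] on the radii,
    hence as small as desired. *)
Lemma sum_L1_le (s : seq (X * R)) (theta : R) : uniq s -> 0 <= theta ->
  {in s &, forall x y, x != y -> x.2 + y.2 <= mdist x.1 y.1} ->
  (forall x, x \in s -> [/\ 0 < x.2, x.2 <= theta & mdist x.1 x0 + x.2 <= r]) ->
  \sum_(x <- s) \int[vol X]_(z in bset (ball x.1 x.2)) `|f z - mean (ball x.1 x.2) f| <=
  tau * theta * (m U + \int[vol X]_(z in bset U) q z).
Proof.
move=> us th0 seps sP.
apply: (@le_trans _ _ (\sum_(x <- s) tau * theta *
    (m (ball x.1 x.2) + \int[vol X]_(z in bset (ball x.1 x.2)) q z))).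
  rewrite big_seq [leRHS]big_seq; apply: ler_sum => x /sP[x20 xth xr].
  have mx := mpos x20 xr; set Q := \int[vol X]_(z in bset (ball x.1 x.2)) q z.
  have Q0 : 0 <= Q by apply: Rintegral_ge0 => z _; exact: q0.
  apply: (le_trans (HP x20 xr)); apply: ler_pM.
  - by rewrite mulr_ge0// ltW.
  - by rewrite mulr_ge0 ?powR_ge0// ltW.
  - by rewrite ler_wpM2l// ltW.
  apply: (@le_trans _ _ (m (ball x.1 x.2) * (1 + (m (ball x.1 x.2))^-1 * Q))).
    rewrite ler_wpM2l ?(ltW mx)// -/Q; set v := _^-1 * Q.
    have v0 : 0 <= v by rewrite mulr_ge0// invr_ge0 ltW.
    have [v1|v1] := leP v 1.
      apply: (@le_trans _ _ 1); last by rewrite lerDl.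
      have E1 : 1 `^ p^-1 = 1 :> R by rewrite powR1.
      by rewrite -[leRHS]E1 ge0_ler_powR ?nnegrE ?invr_ge0 ?(ltW p0).
    apply: (@le_trans _ _ v); last by rewrite lerDr.
    rewrite -[leRHS]powRr1// ler_powR ?(ltW v1)// invf_le1//; exact: ltW.
  by rewrite mulrDr mulr1 mulVKf// gt_eqF.
rewrite -mulr_sumr ler_wpM2l//; first by rewrite mulr_ge0// ltW.
rewrite big_split/= lerD//; first by apply: sum_vol_sep => // x /sP[_ _]; exact: BU.
by apply: sum_Rintegral_sep => // x /sP[_ _]; exact: BU.
Qed.

(** From the outside in: the first [2 ^ (p - 1)] splits [f] into its mean and the oscillation, the
    second splits a mean into [M0] and the chain sum, the third is Jensen's inequality for the
    weights [2 ^ -n] of mass at most two. [2 * K ^+ 2] is that mass times the overlap bound, and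
    [K ^+ 2 * tau] comes from one step of the chain. *)
Definition chain_const : R :=
  2 `^ (p - 1) * (2 `^ (p - 1) * (1 + (K ^+ 2 * tau) `^ p * (2 `^ (p - 1) * (2 * K ^+ 2)))).

Local Notation Q := (\int[vol X]_(z in bset U) q z).

(** In the [M0] term the volumes of [E] in disjoint balls add up to at most the volume of [E]. In
    the gradient term whole balls are used and the sums are exchanged: each scale [rho / 2 ^ n]
    contributes at most [K ^+ 2] times the energy on [U], with weight [2 ^ -n]. *)
Lemma sum_mean_powR_le (s : seq (X * R)) (E : set X) (rho M0 : R) :
  0 < rho -> rho <= r -> 0 <= M0 -> measurable (bset E) -> E `<=` U ->
  (forall w', mdist w' x0 + rho <= r -> `|mean (ball w' rho) f| <= M0) ->
  uniq s -> {in s &, forall x y, x != y -> x.2 + y.2 <= mdist x.1 y.1} ->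
  (forall x, x \in s -> [/\ 0 < x.2, x.2 <= rho & mdist x.1 x0 + x.2 <= r]) ->
  \sum_(x <- s) m (E `&` ball x.1 x.2) * `|mean (ball x.1 x.2) f| `^ p <=
  2 `^ (p - 1) * (M0 `^ p * m E +
    (K ^+ 2 * tau) `^ p * (2 `^ (p - 1) * (2 * K ^+ 2)) * (rho `^ p * Q)).
Proof.
move=> rho0 rhor M00 mE EU HM us seps sP.
(* A positive lower bound [a] for the finitely many radii yields one chain length [N] for all
   balls. *)
have [a a0 aP] := @seq_pos_lower R _ s (fun x => x.2) (fun x xs => let: And3 h _ _ := sP x xs in h).
have [N NP] : exists N, rho / 2 ^+ N <= a.
  exists (Num.truncn (rho / a)).+1; rewrite ler_pdivrMr ?exprn_gt0// mulrC -ler_pdivrMr//.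
  apply: (@le_trans _ _ (Num.truncn (rho / a)).+1%:R); first by rewrite ltW// truncnS_gt.
  by rewrite -natrX ler_nat ltnW// ltn_expl.
have H x : exists w : nat -> X, x \in s -> [/\
    forall n, x.2 < rho / 2 ^+ n -> mdist (w n) x0 + rho / 2 ^+ n <= r,
    forall n, x.2 < rho / 2 ^+ n -> mdist (w n) x.1 + x.2 <= rho / 2 ^+ n &
    `|mean (ball x.1 x.2) f| `^ p <= 2 `^ (p - 1) * (M0 `^ p +
      (K ^+ 2 * tau * rho) `^ p * (2 `^ (p - 1) *
        \sum_(n <- iota 0 N) 2^-1 ^+ n * chain_weight (w n) x.2 (rho / 2 ^+ n)))].
  have [xs|xs] := boolP (x \in s); last by exists (fun=> x0).
  have [x20 xrho xr] := sP x xs.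
  have [|w wP] := @chain_ball_bound x.1 x.2 rho M0 N x20 xrho rhor xr _ M00 HM.
    by rewrite (le_trans NP)// ltW// aP.
  by exists w.
have {H} /choice[w wP] := H.
have mBfin x : (mu (ball x.1 x.2) < +oo)%E by exact: Bfin.
pose S x := \sum_(n <- iota 0 N) 2^-1 ^+ n * chain_weight (w x n) x.2 (rho / 2 ^+ n).
have S0 x : 0 <= S x.
  by apply: sumr_ge0 => n _; rewrite mulr_ge0 ?chain_weight_ge0// exprn_ge0// invr_ge0.
pose C := (K ^+ 2 * tau * rho) `^ p * 2 `^ (p - 1).
have C0 : 0 <= C by rewrite mulr_ge0 ?powR_ge0.
have mEB x : m (E `&` ball x.1 x.2) <= m (ball x.1 x.2).
  rewrite fine_le ?(vol_ball_fin HX)//.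
    rewrite ge0_fin_numE//; apply: le_lt_trans (mBfin x); apply: vol_subset => //.
    exact: measurableI.
  by apply: vol_subset => //; exact: measurableI.
apply: (@le_trans _ _ (\sum_(x <- s) 2 `^ (p - 1) * (m (E `&` ball x.1 x.2) * M0 `^ p +
    C * (m (ball x.1 x.2) * S x)))).
  rewrite big_seq [leRHS]big_seq; apply: ler_sum => x xs; have [_ _ h] := wP x xs.
  apply: (le_trans (ler_wpM2l _ h)); first by rewrite fine_ge0.
  rewrite mulrCA ler_wpM2l ?powR_ge0// mulrDr lerD2l -/(S x) mulrA -/C mulrCA.
  by rewrite ler_wpM2l// ler_wpM2r.
rewrite -mulr_sumr ler_wpM2l ?powR_ge0// big_split/= -mulr_suml lerD//.
  rewrite mulrC ler_wpM2l ?powR_ge0//.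
  have Efin : (mu E < +oo)%E by apply: le_lt_trans Ufin; exact: vol_subset.
  rewrite -lee_fin -sumEFin fineK ?ge0_fin_numE//.
  rewrite (eq_bigr (fun x => mu (E `&` ball x.1 x.2))); last first.
    move=> x _; rewrite fineK// ge0_fin_numE//; apply: le_lt_trans Efin.
    by apply: vol_subset => //; exact: measurableI.
  rewrite -(@measure_seq_disjoint _ _ _ (vol X) _ s (fun x => E `&` ball x.1 x.2))//.
  - apply: vol_subset => //; last by move=> z /big_setUP[x _ []].
    by apply: bigsetU_measurable => x _; exact: measurableI.
  - by move=> x; exact: measurableI.
  - by move=> x y xs ys xy; rewrite setIACA (sep_ball_disjoint (seps _ _ xs ys xy)) setI0.
rewrite -mulr_sumr.
have T1 : \sum_(x <- s) m (ball x.1 x.2) * S x <= 2 * K ^+ 2 * Q.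
  under eq_bigr do rewrite mulr_sumr.
  rewrite exchange_big/=.
  apply: (@le_trans _ _ (\sum_(n <- iota 0 N) 2^-1 ^+ n * (K ^+ 2 * Q))).
    apply: ler_sum => n _; under eq_bigr do rewrite mulrCA.
    rewrite -mulr_sumr ler_wpM2l ?exprn_ge0 ?invr_ge0//.
    have rn0 : 0 < rho / 2 ^+ n by rewrite divr_gt0// exprn_gt0.
    apply: (chain_fubini rn0) => //.
    - apply: le_trans rhor; rewrite ler_pdivrMr ?exprn_gt0// ler_peMr ?(ltW rho0)//.
      by rewrite exprn_ege1// ler1n.
    - by move=> x xs; have [h _ _] := wP x xs; exact: h.
    - by move=> x xs; have [_ h _] := wP x xs; exact: h.
  rewrite -mulr_suml -mulrA ler_wpM2r//.
    by rewrite mulr_ge0 ?exprn_ge0 ?(ltW K0)//; apply: Rintegral_ge0 => z _; exact: q0.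
  have -> : \sum_(n <- iota 0 N) 2^-1 ^+ n = series (geometric 1 2^-1) N :> R.
    rewrite /series/= /index_iota subn0; apply: eq_bigr => n _; by rewrite mul1r.
  rewrite geometric_seriesE; last by rewrite lt_eqF// invf_lt1// ltr1n.
  have E2 : 1 - 2^-1 = 2^-1 :> R by field.
  by rewrite /= E2 mul1r ler_pdivrMr ?invr_gt0// mulfV// gerBl exprn_ge0// invr_ge0.
apply: (le_trans (ler_wpM2l C0 T1)).
have Kt : 0 <= K ^+ 2 * tau by rewrite mulr_ge0 ?exprn_ge0 ?ltW.
rewrite /C (powRM p Kt (ltW rho0)).
rewrite le_eqVlt; apply/orP; left; apply/eqP; ring.
Qed.

(** With [c] the mean, [min |f| M <= |c| + min |f - c| M], and the [p]-th power of the last term is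
    at most [M ^ (p - 1) * |f - c|]. The truncation thus reduces the [p]-th power to the [L^1]
    oscillation that the Poincare inequality controls. *)
Lemma truncation_ball_le (E : set X) (y : X) (t M : R) : 0 <= M ->
  measurable (bset E) -> 0 < t -> mdist y x0 + t <= r ->
  (pint (vol X) p (bset (E `&` ball y t)) (fun z => Num.min `|f z| M)%R <=
   (2 `^ (p - 1) * (m (E `&` ball y t) * `|mean (ball y t) f| `^ p +
     M `^ (p - 1) * \int[vol X]_(z in bset (ball y t)) `|f z - mean (ball y t) f|))%:E)%E.
Proof.
move=> M0 mE t0 yt; set c := mean _ _; set B := ball y t.
have mEB : measurable (bset (E `&` B)) by apply: measurableI => //; exact: mB.
have EBB : E `&` B `<=` B by move=> z [].
have EBfin : (mu (E `&` B) < +oo)%E by apply: le_lt_trans (Bfin y t); exact: vol_subset.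
have mfB : measurable_fun (bset B) (f : borel X -> R).
  exact: (measurable_funS mU (BU yt) mf).
have mfE : measurable_fun (bset (E `&` B)) (f : borel X -> R).
  exact: (measurable_funS (mB y t) EBB mfB).
have mfc : measurable_fun (bset (E `&` B)) (fun z : borel X => (`|f z - c|)%:E).
  by apply/measurable_EFinP; apply: measurableT_comp => //; exact: measurable_funB.
apply: (@le_trans _ _ (\int[vol X]_(z in bset (E `&` B))
    ((2 `^ (p - 1))%:E * ((`|c| `^ p)%:E + (M `^ (p - 1))%:E * (`|f z - c|)%:E)))%E).
  apply: ge0_le_integral => //.
  - apply: measurable_EFin_powR_norm; apply: measurable_minr => //.
    exact: measurableT_comp.
  - by apply: measurable_funeM; apply: emeasurable_funD => //; exact: measurable_funeM.
  move=> z _; rewrite [leRHS](_ : _ = (2 `^ (p - 1) * (`|c| `^ p + M `^ (p - 1) * `|f z - c|))%:E)// lee_fin.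
  have m0 : 0 <= Num.min `|f z| M by rewrite le_min normr_ge0.
  have m0' : 0 <= Num.min `|f z - c| M by rewrite le_min normr_ge0.
  rewrite (ger0_norm m0).
  apply: (@le_trans _ _ ((`|c| + Num.min `|f z - c| M) `^ p)).
    rewrite ge0_ler_powR ?nnegrE ?(ltW p0) ?addr_ge0//.
    have h : `|f z| <= `|c| + `|f z - c|.
      by have := ler_normD c (f z - c); rewrite addrC subrK.
    have [?|?] := leP `|f z| M; have [?|?] := leP `|f z - c| M => //; have := normr_ge0 c; lra.
  apply: (le_trans (powRD_le p1 _ _)) => //.
  rewrite ler_wpM2l ?powR_ge0// lerD2l powR_split// ler_pM ?powR_ge0//; last by rewrite ge_min lexx.
  rewrite ge0_ler_powR ?nnegrE// ?subr_ge0 ?(ltW p1)//.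
  by rewrite ge_min lexx orbT.
rewrite ge0_integralZl_EFin ?powR_ge0//; last 2 first.
- by move=> z _; rewrite -EFinM -EFinD lee_fin addr_ge0 ?mulr_ge0 ?powR_ge0.
- by apply: emeasurable_funD => //; exact: measurable_funeM.
rewrite EFinM lee_wpmul2l ?lee_fin ?powR_ge0//.
rewrite ge0_integralD//; last 2 first.
- by move=> z _; rewrite -EFinM lee_fin mulr_ge0 ?powR_ge0.
- exact: measurable_funeM.
rewrite EFinD leeD//.
  by rewrite integral_cst// EFinM fineK ?ge0_fin_numE// muleC.
rewrite ge0_integralZl_EFin ?powR_ge0// EFinM lee_wpmul2l ?lee_fin ?powR_ge0//.
rewrite fineK; last first.
  apply: (integrable_fin_num (mB y t)); apply: (@integrable_normr _ _ _ (vol X) _ (fun z => f z - c)).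
    exact: mB.
  by apply: integrable_subr_cst => //; exact: fiB.
apply: ge0_subset_integral => //; first exact: mB.
by apply/measurable_EFinP; apply: measurableT_comp => //; exact: measurable_funB.
Qed.

(** The level [M] enters only through errors that a fine enough packing makes smaller than [eps], so
    the main term does not depend on it. *)
Lemma truncation_le (E : set X) (rho M0 M eps : R) :
  0 < rho -> rho <= r -> 0 <= M0 -> measurable (bset E) -> E `<=` U ->
  (forall w', mdist w' x0 + rho <= r -> `|mean (ball w' rho) f| <= M0) ->
  0 < M -> 0 < eps ->
  (pint (vol X) p (bset E) (fun z => Num.min `|f z| M)%R <=
   (2 `^ (p - 1) * (2 `^ (p - 1) * (M0 `^ p * m E +
    (K ^+ 2 * tau) `^ p * (2 `^ (p - 1) * (2 * K ^+ 2)) * (rho `^ p * Q))) + eps)%:E)%E.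
Proof.
move=> rho0 rhor M00 mE EU HM Mgt eps0.
set B0 := 2 `^ (p - 1) * (_ + _).
have Q0 : 0 <= Q by apply: Rintegral_ge0 => z _; exact: q0.
pose c1 := 2 `^ (p - 1) * (M `^ (p - 1) * (tau * (m U + Q))) + 1.
have c10 : 0 < c1.
  by rewrite ltr_wpDl// !mulr_ge0 ?powR_ge0 ?(ltW tau0)// addr_ge0// fine_ge0.
(* Radii below [theta] make the [L^1] oscillation cost at most [eps / 2]; the set missed by the
   packing has volume at most [eps2], costing at most [M ^ p * eps2 = eps / 2]. *)
pose theta := Num.min rho (eps / 2 / c1).
have th0 : 0 < theta by rewrite lt_min rho0 !divr_gt0.
have thc : c1 * theta <= eps / 2.
  by rewrite mulrC -ler_pdivlMr// ge_min lexx orbT.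
pose eps2 := eps / 2 / M `^ p.
have Mp0 : 0 < M `^ p by exact: powR_gt0.
have eps20 : 0 < eps2 by rewrite !divr_gt0.
pose T z := Num.min theta (r - mdist z x0).
have T0 z : U z -> 0 < T z by rewrite in_ball metric_sym lt_min th0 subr_gt0.
have USN : U `<=` U `|` set0 by rewrite setU0.
have [s [e e0 [us sP seps sU]]] := @vitali R X K Rh HX U set0 T measurable0 (measure0 _) T0 U eps2
  (@mdist_open_ball _ _ x0 r) Ufin USN eps20.
have seps' : {in s &, forall x y, x != y -> x.2 + y.2 <= mdist x.1 y.1}.
  by move=> x y xs ys xy; have := seps x y xs ys xy; lra.
have sP' x : x \in s -> [/\ 0 < x.2, x.2 <= theta & mdist x.1 x0 + x.2 <= r].
  move=> /sP[_ x20]; rewrite lt_min => /andP[h1 h2]; split=> //; lra.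
have sPr x : x \in s -> [/\ 0 < x.2, x.2 <= rho & mdist x.1 x0 + x.2 <= r].
  by move=> /sP'[? h ?]; split=> //; apply: le_trans h _; rewrite ge_min lexx.
pose BB := \big[setU/set0]_(x <- s) ball x.1 x.2.
have mBB : measurable (bset BB) by apply: bigsetU_measurable => x _; exact: measurable_mball.
have BBU : BB `<=` U by move=> z /big_setUP[x /sP'[_ _ xr]]; exact: BU xr z.
pose D := U `\` BB.
have mD : measurable (bset D) by exact: measurableD.
have muD : (mu D <= eps2%:E)%E.
  have EBB : mu BB = (\sum_(x <- s) mu (ball x.1 x.2))%E.
    apply: (@measure_seq_disjoint _ _ _ (vol X) _ s (fun x => ball x.1 x.2)) => //.
    by move=> x y xs ys xy; apply: sep_ball_disjoint; exact: seps'.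
  have BBfin : mu BB \is a fin_num.
    by rewrite ge0_fin_numE//; apply: le_lt_trans Ufin; exact: vol_subset.
  have -> : mu D = (mu U - mu BB)%E.
    have h := @measureD _ (borel X) R (vol X) U BB mU mBB Ufin.
    by rewrite (setIidr BBU) in h; exact: h.
  by rewrite leeBlDl// EBB.
pose h z := Num.min `|f z| M.
have mh : measurable_fun (bset E) (h : borel X -> R).
  by apply: measurable_minr => //; apply: measurableT_comp => //; exact: measurable_funS mf.
have cover : E `<=` \big[setU/set0]_(x <- s) ball x.1 x.2 `|` D.
  by move=> z /EU Uz; have [?|?] := pselect (BB z); [left|right; split].
apply: (le_trans (@integral_seq_cover_le _ _ _ (vol X) _ s (fun x => ball x.1 x.2) _ D _ mE mD _ _ _ cover)).
- by move=> x; exact: measurable_mball.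
- exact: measurable_EFin_powR_norm.
- by move=> z _; rewrite lee_fin powR_ge0.
have -> : 2 `^ (p - 1) * B0 + eps = (2 `^ (p - 1) * B0 + eps / 2) + eps / 2 by lra.
rewrite EFinD leeD//.
  apply: (@le_trans _ _ (\sum_(x <- s) (2 `^ (p - 1) * (m (E `&` ball x.1 x.2) *
      `|mean (ball x.1 x.2) f| `^ p + M `^ (p - 1) *
      \int[vol X]_(z in bset (ball x.1 x.2)) `|f z - mean (ball x.1 x.2) f|))%:E)%E).
    rewrite big_seq [leRHS]big_seq; apply: lee_sum => x /sP'[x20 _ xr].
    by apply: truncation_ball_le => //; exact: ltW.
  rewrite sumEFin lee_fin -mulr_sumr big_split/= -mulr_sumr mulrDr lerD//.
    by rewrite ler_wpM2l ?powR_ge0//; exact: sum_mean_powR_le.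
  apply: le_trans thc.
  apply: (@le_trans _ _ (2 `^ (p - 1) * (M `^ (p - 1) * (tau * theta * (m U + Q))))).
    do 2 (rewrite ler_wpM2l ?powR_ge0//).
    by apply: sum_L1_le => //; exact: ltW.
  have -> : 2 `^ (p - 1) * (M `^ (p - 1) * (tau * theta * (m U + Q))) = (c1 - 1) * theta.
    by rewrite /c1; ring.
  by rewrite ler_wpM2r ?(ltW th0)//; lra.
have mED : measurable (bset (E `&` D)) by exact: measurableI.
apply: (@le_trans _ _ (\int[vol X]_(z in bset (E `&` D)) (cst (M `^ p)%:E z))%E).
  apply: ge0_le_integral => //.
  - by apply: measurable_funS mE _ (measurable_EFin_powR_norm p mh) => z [].
  - move=> z _; rewrite lee_fin ger0_norm; last by rewrite le_min normr_ge0 ltW.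
    by rewrite ge0_ler_powR ?nnegrE ?(ltW p0) ?(ltW Mgt)// ?le_min ?normr_ge0 ?(ltW Mgt)// ge_min lexx orbT.
rewrite integral_cst; last exact: measurableI.
apply: (@le_trans _ _ ((M `^ p)%:E * eps2%:E)%E).
  rewrite lee_wpmul2l ?lee_fin ?powR_ge0//; apply: le_trans muD.
  by apply: vol_subset => // z [].
by rewrite -EFinM lee_fin /eps2 mulrC divfK// gt_eqF.
Qed.

(** The bound for truncations is uniform in the level, so monotone convergence along the levels
    [n + 1] removes it. The constant is enlarged so that one factor serves both terms. *)
Lemma chain_estimate (E : set X) (rho M0 : R) :
  0 < rho -> rho <= r -> 0 <= M0 -> measurable (bset E) -> E `<=` U ->
  (forall w', mdist w' x0 + rho <= r -> `|mean (ball w' rho) f| <= M0) ->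
  (pint (vol X) p (bset E) f <= (chain_const * (M0 `^ p * m E + rho `^ p * Q))%:E)%E.
Proof.
move=> rho0 rhor M00 mE EU HM.
have Q0 : 0 <= Q by apply: Rintegral_ge0 => z _; exact: q0.
pose h (n : nat) z := Num.min `|f z| n.+1%:R.
have mfE : measurable_fun (bset E) (f : borel X -> R) by exact: measurable_funS mf.
have mh n : measurable_fun (bset E) (fun z : borel X => (`|h n z| `^ p)%:E).
  apply: measurable_EFin_powR_norm; apply: measurable_minr => //; exact: measurableT_comp.
have h0 n z : 0 <= h n z by rewrite le_min normr_ge0 ler0n.
have ndh z : E z -> {homo (fun n => (`|h n z| `^ p)%:E) : n k / (n <= k)%N >-> (n <= k)%E}.
  move=> _ n k nk; rewrite lee_fin ge0_ler_powR ?nnegrE ?(ltW p0)// !ger0_norm//.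
  by rewrite le_min !ge_min lexx/= ler_nat ltnS nk orbT.
have h0' n : forall z, E z -> (0 <= (`|h n z| `^ p)%:E)%E by move=> z _; rewrite lee_fin powR_ge0.
have cv := @cvg_monotone_convergence _ _ _ (vol X) (bset E) mE (fun n z => (`|h n z| `^ p)%:E) mh h0' ndh.
have Elim z : limn (fun n => (`|h n z| `^ p)%:E) = (`|f z| `^ p)%:E.
  apply/cvg_lim => //; apply: cvg_near_cst; exists (Num.truncn `|f z|) => // n /= fn.
  rewrite /h min_l ?normr_id// ltW// (lt_le_trans (truncnS_gt _))// ler_nat ltnS//.
rewrite /pint; under eq_integral do rewrite -Elim.
have -> : (\int[vol X]_(z in bset E) limn (fun n => (`|h n z| `^ p)%:E) = limn
   (fun n => \int[vol X]_(z in bset E) (`|h n z| `^ p)%:E))%E by apply/esym/cvg_lim.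
apply: lime_le; first by apply/cvg_ex; eexists; exact: cv.
apply: nearW => n; apply/lee_addgt0Pr => eps eps0.
apply: (le_trans (truncation_le rho0 rhor M00 mE EU HM (ltr0Sn _ n) eps0)).
rewrite -EFinD lee_fin lerD2r /chain_const -[leRHS]mulrA ler_wpM2l ?powR_ge0//.
have mE0 : 0 <= m E by rewrite fine_ge0.
set C := (K ^+ 2 * tau) `^ p * _.
have C0 : 0 <= C by rewrite !mulr_ge0 ?powR_ge0 ?exprn_ge0 ?(ltW K0).
have a0 : 0 <= M0 `^ p * m E by rewrite mulr_ge0// powR_ge0.
have b0 : 0 <= rho `^ p * Q by rewrite mulr_ge0// powR_ge0.
have -> : 2 `^ (p - 1) * (1 + C) * (M0 `^ p * m E + rho `^ p * Q) =
    2 `^ (p - 1) * (M0 `^ p * m E + C * (rho `^ p * Q)) +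
    2 `^ (p - 1) * (C * (M0 `^ p * m E) + rho `^ p * Q) by ring.
by rewrite lerDl mulr_ge0 ?powR_ge0// addr_ge0// mulr_ge0.
Qed.

End chain.


(** * Sobolev functions on a ball *)

Lemma pint_cst d (T : measurableType d) (R : realType) (mu : {measure set T -> \bar R})
    (p : R) (D : set T) (c : R) : measurable D ->
  pint mu p D (cst c) = ((`|c| `^ p)%:E * mu D)%E.
Proof. by move=> mD; rewrite -(integral_cst mu mD). Qed.

Section sobolev_balls.
Context {R : realType} {X : pmmSpace R} (K Rh : R) (HX : doubling_space X K Rh).
Local Notation mu A := (vol X (A : set (borel X))).
Local Notation m A := (fine (vol X (A : set (borel X)))).
Local Notation bset A := (A : set (borel X)).
Local Notation integ A f := ((vol X).-integrable (bset A) (EFin \o (f : borel X -> R))).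
Local Notation I p U h := (pint (vol X) p (bset U) h).

Context (x0 : X) (r p : R) (tau : R -> R).
Local Notation U := (ball x0 r).
Hypotheses (p1 : 1 < p) (tau0 : 0 < tau r) (r0 : 0 < r) (rRh : 4 * (r + 1) <= Rh).
Hypothesis v1 : mu (ball x0 1) = 1%E.
Hypothesis WP : weak_poincare X p tau.

Let K0 : 0 < K. Proof. by apply: lt_le_trans (ds_ge1 HX); exact: ltr01. Qed.

Let p0 : 0 < p. Proof. exact: lt_trans p1. Qed.

Let mB y t : measurable (bset (ball y t)). Proof. exact: measurable_mball. Qed.

Let Bfin y t : (mu (ball y t) < +oo)%E. Proof. exact: vol_ball_lty HX _ _. Qed.

Let BU y t : mdist y x0 + t <= r -> ball y t `<=` U.
Proof. by rewrite metric_sym; exact: mball_sub. Qed.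

Lemma ball_vol_lower t z : 0 < t -> mdist z x0 < r ->
  (((K ^+ (Num.truncn ((r + 1) / t)).+1)^-1)%:E <= mu (ball z t))%E.
Proof.
move=> t0 zr; apply: (vol_ball_lower HX _ v1 t0); last by rewrite lerD2r ltW.
have r1 : 0 < r + 1 by rewrite addr_gt0.
by rewrite r1 (le_trans _ rRh)// ler_peMl ?(ltW r1)// ler1n.
Qed.

Lemma ball_vol_gt0 z t : mdist z x0 < r -> 0 < t -> (0 < mu (ball z t))%E.
Proof.
move=> zr t0; apply: lt_le_trans (ball_vol_lower t0 zr).
by rewrite lte_fin invr_gt0 exprn_gt0.
Qed.

(** Always the gradient of the large ball [U], made real-valued, so that a single function serves
    all smaller balls. *)
Definition grad_energy (f : X -> R) (x : X) : R := `|fine (min_grad U p f x)| `^ p.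

Context (f : X -> R).
Hypothesis fH : H1p U p f.

Let gL : inLp U p%:E (min_grad U p f).
Proof. by have [[]] := min_gradP p1 (mB x0 r) fH. Qed.

Let gE V : measurable (bset V) -> V `<=` U ->
  (\int[vol X]_(x in bset V) (`|min_grad U p f x| `^ p) =
   \int[vol X]_(x in bset V) (grad_energy f x)%:E)%E.
Proof.
move=> mV VU; apply: (inLp_fine p1 mV).
exact: (inLp_subset p1 (mB x0 r) mV VU gL).
Qed.

Lemma grad_energy_integrable : integ U (grad_energy f).
Proof.
have [mg gfin] := gL; apply/integrableP; split.
  apply: measurable_EFin_powR_norm.
  by apply: (@measurableT_comp _ _ _ _ _ _ (@fine R)).
rewrite (eq_integral (fun x : borel X => (grad_energy f x)%:E)); last first.
  by move=> x _ /=; rewrite ger0_norm// powR_ge0.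
by rewrite -gE// -LpN_lty.
Qed.

Let fL : measurable_fun (bset U) (f : borel X -> R) /\ (I p U f < +oo)%E.
Proof. by apply/(inLp_pint p1) => //; exact: fH.1. Qed.

Let fi : integ U f.
Proof. by apply: (pint_lty_integrable p1) => //; case: fL. Qed.

(** [min_grad_subset] exchanges the gradient of the small ball for that of [U]; multiplying by the
    volume gives the form required by the chain estimate. *)
Lemma sobolev_poincare y t : 0 < t -> mdist y x0 + t <= r ->
  \int[vol X]_(x in bset (ball y t)) `|f x - mean (ball y t) f| <=
  tau r * t * (m (ball y t) *
    ((m (ball y t))^-1 * \int[vol X]_(x in bset (ball y t)) grad_energy f x) `^ p^-1).
Proof.
move=> t0 yt; set B := ball y t; have BsU : B `<=` U by exact: BU.
have d0 : 0 <= mdist y x0 by exact: mdist_ge0.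
have mpos : 0 < m B.
  by rewrite fine_gt0// ball_vol_gt0 ?Bfin//; lra.
have tr : 0 < t <= r by apply/andP; split; lra.
have := WP r0 tr (H1p_subset p1 (mB x0 r) (mB y t) BsU fH).
have iq : integ B (grad_energy f) := integrableS (mB x0 r) (mB y t) BsU grad_energy_integrable.
have fiB : integ B f := integrableS (mB x0 r) (mB y t) BsU fi.
have ifm : integ B (fun x => `|f x - mean B f|).
  apply: (@integrable_normr _ _ _ (vol X) _ (fun z => f z - mean B f)); first exact: mB.
  by apply: integrable_subr_cst => //; [exact: mB|exact: Bfin].
have Eq : (\int[vol X]_(x in bset B) (grad_energy f x)%:E =
   (\int[vol X]_(x in bset B) grad_energy f x)%:E)%E.
  by rewrite /Rintegral fineK//; apply: (integrable_fin_num (mB y t) iq).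
have Ef : (\int[vol X]_(x in bset B) (`|f x - mean B f|)%:E =
   (\int[vol X]_(x in bset B) `|f x - mean B f|)%:E)%E.
  by rewrite /Rintegral fineK//; apply: (integrable_fin_num (mB y t) ifm).
rewrite /emean -/B Ef -EFinM => h.
have h2 : ((\int[vol X]_(x in bset B) (`|min_grad B p f x| `^ p)) <=
    (\int[vol X]_(x in bset B) grad_energy f x)%:E)%E.
  rewrite -Eq; have hm := min_grad_subset p1 (mB x0 r) (mB y t) BsU fH.
  by rewrite -(gE (mB y t) BsU).
set Q := \int[vol X]_(x in bset B) grad_energy f x in h2 *.
have {}h := le_trans h _.
have : (((m B)^-1 * \int[vol X]_(x in bset B) `|f x - mean B f|)%R%:E <=
   ((tau r * t) * ((m B)^-1 * Q) `^ p^-1)%R%:E)%E.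
  apply: h; rewrite [leRHS]EFinM lee_wpmul2l ?lee_fin ?mulr_ge0 ?(ltW t0) ?(ltW tau0)//.
  rewrite -poweR_EFin; apply: le_poweRV => //.
    rewrite mule_ge0// ?lee_fin ?invr_ge0 ?(ltW mpos)//.
    by apply: integral_ge0 => x _; exact: poweR_ge0.
  by rewrite [leRHS]EFinM lee_wpmul2l// lee_fin invr_ge0 ltW.
rewrite lee_fin ler_pdivrMl// => h3; apply: (le_trans h3).
by rewrite le_eqVlt; apply/orP; left; apply/eqP; ring.
Qed.

Lemma H1p_norm_bound (C : R) : (H1p_norm U p f <= C%:E)%E ->
  [/\ 0 <= C, (I p U f <= (C `^ p)%:E)%E &
      \int[vol X]_(x in bset U) grad_energy f x <= C `^ p].
Proof.
rewrite /H1p_norm LpN_pint ?gt_eqF// LpNE ?gt_eqF// => h.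
have a0 : (0 <= I p U f)%E by exact: pint_ge0.
have b0 : (0 <= \int[vol X]_(x in bset U) (`|min_grad U p f x| `^ p))%E.
  by apply: integral_ge0 => x _; exact: poweR_ge0.
have C0 : 0 <= C.
  by rewrite -lee_fin; apply: le_trans h; rewrite adde_ge0// poweR_ge0.
split=> //.
  by rewrite -lee_poweRV//; apply: le_trans h; rewrite leeDl// poweR_ge0.
rewrite -lee_fin /Rintegral fineK; last exact: (integrable_fin_num (mB x0 r) grad_energy_integrable).
by rewrite -gE// -lee_poweRV//; apply: le_trans h; rewrite leeDr// poweR_ge0.
Qed.

Lemma sobolev_chain_estimate (E : set X) (rho M0 : R) :
  0 < rho -> rho <= r -> 0 <= M0 -> measurable (bset E) -> E `<=` U ->
  (forall w', mdist w' x0 + rho <= r -> `|mean (ball w' rho) f| <= M0) ->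
  (I p E f <= (chain_const K p (tau r) * (M0 `^ p * m E +
     rho `^ p * \int[vol X]_(x in bset U) grad_energy f x))%:E)%E.
Proof.
have r4 : 4 * r < Rh by have := r0; have := rRh; lra.
apply: (chain_estimate HX p1 tau0 r4 ball_vol_gt0 fL.1 fL.2 grad_energy_integrable _ sobolev_poincare).
by move=> x; exact: powR_ge0.
Qed.

(** At scale [rho = t] the only ball of that radius to be considered is [ball y t] itself, on which
    [f - c] has mean zero; the chain estimate therefore applies with [M0 = 0]. *)
Lemma ball_Lp_poincare y t : 0 < t -> mdist y x0 + t <= r ->
  (I p (ball y t) (fun x => f x - mean (ball y t) f)%R <=
   (chain_const K p (tau r) *
     (t `^ p * \int[vol X]_(x in bset (ball y t)) grad_energy f x))%:E)%E.
Proof.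
move=> t0 yt; set B := ball y t; set c := mean B f; have BsU : B `<=` U by exact: BU.
have fiU := fi.
have iq : integ B (grad_energy f) := integrableS (mB x0 r) (mB y t) BsU grad_energy_integrable.
have fiB : integ B f := integrableS (mB x0 r) (mB y t) BsU fi.
have mfB : measurable_fun (bset B) (f : borel X -> R).
  exact: (measurable_funS (mB x0 r) BsU fL.1).
have d0 : 0 <= mdist y x0 by exact: mdist_ge0.
have r4 : 4 * t < Rh by have := r0; have := rRh; lra.
have vp z s : mdist z y < t -> 0 < s -> (0 < mu (ball z s))%E.
  by move=> zy s0; apply: ball_vol_gt0 => //; have := metric_triangle z y x0; lra.
have sub w s : 0 < s -> mdist w y + s <= t -> mdist w x0 + s <= r.
  by move=> s0 ws; have := metric_triangle w y x0; lra.
have meanB w s : 0 < s -> mdist w y + s <= t ->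
    mean (ball w s) (fun x => f x - c) = mean (ball w s) f - c.
  move=> s0 ws; rewrite (mean_sub c (mB w s)).
  - by [].
  - by rewrite Bfin vp//; lra.
  - by apply: integrableS fiU => //; apply: BU; exact: sub.
have HPc w s : 0 < s -> mdist w y + s <= t ->
    \int[vol X]_(x in bset (ball w s)) `|f x - c - mean (ball w s) (fun x => f x - c)| <=
    tau r * s * (m (ball w s) *
    ((m (ball w s))^-1 * \int[vol X]_(x in bset (ball w s)) grad_energy f x) `^ p^-1).
  move=> s0 ws; rewrite meanB//; apply: le_trans (sobolev_poincare s0 (sub w s s0 ws)).
  rewrite le_eqVlt; apply/orP; left; apply/eqP.
  by apply: eq_Rintegral => x _; congr (`| _ |); ring.
have := @chain_estimate R X K Rh HX y t p (tau r) (fun x => f x - c) (grad_energy f) p1 tau0 r4 vp.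
have mfc : measurable_fun (bset B) ((fun x => f x - c) : borel X -> R).
  by apply: measurable_funB.
have fcfin : (I p B (fun x => f x - c)%R < +oo)%E.
  have h := @pintD_le _ (borel X) R (vol X) p p1 (bset B) f (cst (- c)) (mB y t) mfB (measurable_cst _).
  apply: (le_lt_trans h); rewrite lte_mul_pinfty ?lee_fin ?powR_ge0//.
  apply: lte_add_pinfty.
    by apply: le_lt_trans fL.2; exact: (@subset_pint _ (borel X) R (vol X) p _ _ f (mB y t) (mB x0 r) fL.1 BsU).
  rewrite (@pint_cst _ (borel X)); last exact: mB.
  by rewrite lte_mul_pinfty ?lee_fin ?powR_ge0//; exact: Bfin.
move=> /(_ mfc fcfin iq (fun x => powR_ge0 _ _) HPc B t 0 t0 (lexx _) (lexx _) (mB y t)).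
move=> h; have {}h := h (fun x Bx => Bx) _.
have {}h := h _; rewrite powR0 ?gt_eqF// mul0r add0r in h; apply: h.
move=> w wt; have wy : mdist w y = 0.
  by have := mdist_ge0 w y; lra.
rewrite (mdist_positivity _ _ wy) (meanB y t) ?mdistxx ?add0r//.
by rewrite subrr normr0.
Qed.

(** From [|f| <= 1 + |f| ^ p] and the lower volume bound. The right-hand side depends on the space
    and the function only through the constants [K] and [C], so it bounds means along the whole
    sequence. *)
Lemma mean_norm_le (C : R) (w : X) (rho : R) : (H1p_norm U p f <= C%:E)%E ->
  0 < rho -> mdist w x0 + rho <= r ->
  `|mean (ball w rho) f| <= 1 + K ^+ (Num.truncn ((r + 1) / rho)).+1 * C `^ p.
Proof.
move=> /H1p_norm_bound[C0 fC _] rho0 wr; set N := (_ .+1); set B := ball w rho.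
have BsU : B `<=` U by exact: BU.
have fiB : integ B f := integrableS (mB x0 r) (mB w rho) BsU fi.
have wr' : mdist w x0 < r by lra.
have vB := ball_vol_lower rho0 wr'.
have B0 : (0 < mu B < +oo)%E by rewrite ball_vol_gt0 ?Bfin.
have mB0 : 0 < m B by rewrite fine_gt0.
have KN : (m B)^-1 <= K ^+ N.
  rewrite invf_ple ?posrE ?exprn_gt0// -lee_fin fineK//.
  by rewrite ge0_fin_numE//; case/andP : B0.
have h1 := mean_dist_le 0 (mB w rho) B0 fiB; rewrite subr0 in h1.
apply: (le_trans h1).
have mfB : measurable_fun (bset B) (f : borel X -> R).
  exact: (measurable_funS (mB x0 r) BsU fL.1).
have fB : (I p B f <= (C `^ p)%:E)%E.
  by apply: le_trans fC; exact: (@subset_pint _ (borel X) R (vol X) p _ _ f (mB w rho) (mB x0 r) fL.1 BsU).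
have h2 : (\int[vol X]_(x in bset B) (`|f x - 0|)%:E <= mu B + (C `^ p)%:E)%E.
  apply: (@le_trans _ _ (\int[vol X]_(x in bset B) (1%E + (`|f x| `^ p)%:E))%E).
    apply: ge0_le_integral => //.
    - exact: mB.
    - apply/measurable_EFinP; apply: measurableT_comp => //.
      by apply: measurable_funB => //.
    - by apply: emeasurable_funD => //; exact: measurable_EFin_powR_norm.
    move=> x _; rewrite -EFinD lee_fin subr0.
    have [f1|f1] := leP `|f x| 1; first by rewrite (le_trans f1)// lerDl powR_ge0.
    rewrite -[leLHS]add0r lerD// -[leLHS]powRr1// ler_powR//; exact: ltW.
  rewrite ge0_integralD//; last 2 first.
  - exact: mB.
  - exact: measurable_EFin_powR_norm.
  rewrite (@integral_cst _ (borel X) _ (vol X) _ (mB w rho) 1%E) mul1e leeD2l//.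
have h3 : \int[vol X]_(x in bset B) `|f x - 0| <= m B + C `^ p.
  rewrite -lee_fin /Rintegral fineK.
    by rewrite EFinD fineK// ge0_fin_numE//; case/andP : B0.
  rewrite ge0_fin_numE; last exact: integral_ge0.
  by apply: (le_lt_trans h2); rewrite lte_add_pinfty ?ltry//; case/andP : B0.
apply: (@le_trans _ _ ((m B)^-1 * (m B + C `^ p))).
  by rewrite ler_wpM2l// invr_ge0 ltW.
by rewrite mulrDr mulVf ?gt_eqF// lerD2l ler_wpM2r// powR_ge0.
Qed.

End sobolev_balls.

(** The threshold [e] is chosen before the space and the function. A small [rho] makes the gradient
    term at most [delta / 2]; this fixes the bound [M0] on means at scale [rho], and [e] then makes
    the volume term at most [delta / 2]. *)
Lemma sobolev_equi_integrable {R : realType} (K Rh r p : R) (tau : R -> R) (C delta : R) :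
  1 < p -> 0 < tau r -> 0 < r -> 4 * (r + 1) <= Rh -> 1 <= K -> 0 < delta ->
  exists2 e : R, 0 < e & forall (X : pmmSpace R) (x0 : X) (f : X -> R) (E : set X),
    doubling_space X K Rh -> vol X (ball x0 1 : set (borel X)) = 1%E ->
    weak_poincare X p tau -> H1p (ball x0 r) p f ->
    (H1p_norm (ball x0 r) p f <= C%:E)%E ->
    measurable (E : set (borel X)) -> E `<=` ball x0 r ->
    (vol X (E : set (borel X)) <= e%:E)%E ->
    (pint (vol X) p (E : set (borel X)) f <= delta%:E)%E.
Proof.
move=> p1 tau0 r0 rRh K1 delta0; have p0 : 0 < p by exact: lt_trans p1.
have K0 : 0 < K by exact: lt_le_trans K1.
have cc0 : 0 <= chain_const K p (tau r).
  by rewrite /chain_const !(mulr_ge0, addr_ge0, powR_ge0, exprn_ge0)// ltW.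
set c := chain_const _ _ _ in cc0.
pose b := delta / 2 / (c * C `^ p + 1).
have b0 : 0 < b by rewrite !divr_gt0// ltr_wpDl// mulr_ge0// powR_ge0.
pose rho := Num.min r (b `^ p^-1).
have rho0 : 0 < rho by rewrite lt_min r0 powR_gt0.
have rhor : rho <= r by rewrite ge_min lexx.
have rhob : rho `^ p <= b.
  have -> : b = (b `^ p^-1) `^ p by rewrite -powRrM mulVf ?gt_eqF// powRr1// ltW.
  by rewrite ge0_ler_powR ?nnegrE ?(ltW p0) ?(ltW rho0) ?powR_ge0// ge_min lexx orbT.
pose M0 := 1 + K ^+ (Num.truncn ((r + 1) / rho)).+1 * C `^ p.
have M00 : 0 <= M0 by rewrite addr_ge0// mulr_ge0 ?exprn_ge0 ?powR_ge0// ltW.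
pose e := delta / 2 / (c * M0 `^ p + 1).
have e0 : 0 < e by rewrite !divr_gt0// ltr_wpDl// mulr_ge0// powR_ge0.
exists e => // X x0 f E HX v1 WP fH fC mE EU Ee.
have [C0 _ Q] := H1p_norm_bound p1 fH fC.
have HM w' : mdist w' x0 + rho <= r -> `|mean (ball w' rho) f| <= M0.
  move=> wr; exact: (mean_norm_le HX p1 r0 rRh v1 fH fC rho0 wr).
apply: (le_trans (sobolev_chain_estimate HX p1 tau0 r0 rRh v1 WP fH rho0 rhor M00 mE EU HM)).
have mEe : fine (vol X (E : set (borel X))) <= e.
  by rewrite -lee_fin fineK// ge0_fin_numE// (le_lt_trans Ee)// ltry.
rewrite lee_fin mulrDr (_ : delta = delta / 2 + delta / 2); last by lra.
apply: lerD.
  apply: (@le_trans _ _ (c * (M0 `^ p * e))).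
    by rewrite !ler_wpM2l// powR_ge0.
  rewrite mulrA /e mulrA ler_pdivrMr; last by rewrite ltr_wpDl// mulr_ge0// powR_ge0.
  by rewrite mulrC ler_wpM2l ?lerDl// ltW// divr_gt0.
apply: (@le_trans _ _ (c * (b * C `^ p))).
  rewrite ler_wpM2l// ler_pM ?powR_ge0//.
  by apply: Rintegral_ge0 => x _; exact: powR_ge0.
rewrite mulrCA /b mulrAC ler_pdivrMr; last by rewrite ltr_wpDl// mulr_ge0// powR_ge0.
by rewrite ler_wpM2l ?lerDl// ltW// divr_gt0.
Qed.



(** * Convergence of integrals under strong convergence *)

Section near_step_functions.
Context d (T : measurableType d) (R : realType) (mu : {measure set T -> \bar R}).
Context (p : R) (p1 : 1 < p).
Local Notation Ip := (pint mu p).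

Let p0 : 0 < p. Proof. exact: lt_trans p1. Qed.

Lemma pint_ae_bounded (D : set T) (u : T -> R) (M : R) : measurable D ->
  measurable_fun D u -> {ae mu, forall x, D x -> `|u x| <= M} ->
  (Ip D u <= (M `^ p)%:E * mu D)%E.
Proof.
move=> mD mu_ uM; rewrite -integral_cst//; apply: ae_ge0_le_integral => //.
- exact: measurable_EFin_powR_norm.
- by move=> x _; rewrite lee_fin powR_ge0.
apply: filterS uM => x + Dx => /(_ Dx) uM.
by rewrite lee_fin ge0_ler_powR ?nnegrE ?(ltW p0)// (le_trans _ uM).
Qed.

(** The Lipschitz constant of [t ^ p] on [[0, M]]. *)
Let lip M := p * M `^ (p - 1).

Lemma pint_near_cst (D : set T) (u : T -> R) (M c : R) : measurable D ->
  measurable_fun D u -> {ae mu, forall x, D x -> `|u x| <= M} -> `|c| <= M ->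
  (Ip D u <= (`|c| `^ p)%:E * mu D + (lip M)%:E * \int[mu]_(x in D) `|u x - c|%:E)%E /\
  ((`|c| `^ p)%:E * mu D <= Ip D u + (lip M)%:E * \int[mu]_(x in D) `|u x - c|%:E)%E.
Proof.
move=> mD mu_ uM cM; have L0 : 0 <= lip M by rewrite mulr_ge0 ?(ltW p0)// powR_ge0.
have mc : measurable_fun D (fun x => (`|u x - c|)%:E).
  by apply/measurable_EFinP; apply: measurableT_comp => //; exact: measurable_funB.
have mp : measurable_fun D (fun x => (`|u x| `^ p)%:E) by exact: measurable_EFin_powR_norm.
have ae : {ae mu, forall x, D x -> `|(`|u x| `^ p) - `|c| `^ p| <= lip M * `|u x - c|}.
  apply: filterS uM => x + Dx => /(_ Dx) uM.
  apply: (le_trans (powR_lipschitz p1 (C := M) _ _)); rewrite ?normr_ge0 ?uM ?cM//.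
  by rewrite ler_wpM2l//; exact: ler_dist_dist.
have c0 : (0 <= (`|c| `^ p)%:E)%E by rewrite lee_fin powR_ge0.
split.
  rewrite -integral_cst// -ge0_integralZl_EFin// -ge0_integralD//; last 2 first.
  - by move=> x _; rewrite -EFinM lee_fin mulr_ge0.
  - exact: measurable_funeM.
  apply: ae_ge0_le_integral => //.
  - by move=> x _; rewrite adde_ge0// -EFinM lee_fin mulr_ge0.
  - by apply: emeasurable_funD => //; exact: measurable_funeM.
  apply: filterS ae => x + Dx => /(_ Dx); rewrite ler_norml => /andP[_ h].
  by rewrite /= -EFinM -EFinD lee_fin -lerBlDl.
rewrite -integral_cst// -ge0_integralZl_EFin// /pint -ge0_integralD//; last 2 first.
- by move=> x _; rewrite -EFinM lee_fin mulr_ge0.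
- exact: measurable_funeM.
apply: ae_ge0_le_integral => //.
- by move=> x _; rewrite adde_ge0// ?lee_fin ?powR_ge0// mulr_ge0.
- by apply: emeasurable_funD => //; exact: measurable_funeM.
apply: filterS ae => x + Dx => /(_ Dx); rewrite ler_norml => /andP[h _].
by rewrite /= -EFinM -EFinD lee_fin; lra.
Qed.

Context (I : eqType) (s : seq I) (F : I -> set T) (B : set T).
Hypotheses (mB : measurable B) (mF : forall i, measurable (F i)) (us : uniq s).
Hypothesis tF : {in s &, forall i j, i != j -> F i `&` F j = set0}.
Hypothesis FB : forall i, i \in s -> F i `<=` B.

Let FB' : \big[setU/set0]_(i <- s) F i `<=` B.
Proof. by move=> x /big_setUP[i /FB]; exact. Qed.

Let mU : measurable (\big[setU/set0]_(i <- s) F i).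
Proof. by apply: bigsetU_measurable. Qed.

Lemma measure_seq_disjoint_le : (\sum_(i <- s) mu (F i) <= mu B)%E.
Proof. by rewrite -measure_seq_disjoint// le_measure ?inE. Qed.

Lemma integral_seq_disjoint_le (g : T -> \bar R) : measurable_fun B g ->
  (forall x, B x -> 0 <= g x)%E ->
  (\sum_(i <- s) \int[mu]_(x in F i) g x <= \int[mu]_(x in B) g x)%E.
Proof.
move=> mg g0; rewrite -ge0_integral_bigsetU//.
- exact: ge0_subset_integral.
- move=> i j /= si sj [x Fx]; apply/eqP/negPn/negP => ij.
  by move: Fx; rewrite tF.
- exact: measurable_funS mg.
- by move=> x Ux; apply: g0; exact: FB'.
Qed.

(** On [F i] the function may be replaced by the constant [c i] at a cost of [lip M * e] per unit of
    volume, and the leftover of volume at most [eta] contributes at most [M ^ p * eta]. The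
    comparison sum involves only constants and volumes, which is what passes to the limit. *)
Lemma pint_near_step (u : T -> R) (c : I -> R) (M e eta : R) : 0 <= e ->
  (mu B < +oo)%E -> (mu B <= \sum_(i <- s) mu (F i) + eta%:E)%E ->
  measurable_fun B u -> {ae mu, forall x, B x -> `|u x| <= M} ->
  (forall i, i \in s -> `|c i| <= M) ->
  (forall i, i \in s -> \int[mu]_(x in F i) `|u x - c i|%:E <= e%:E * mu (F i))%E ->
  (Ip B u <= \sum_(i <- s) (`|c i| `^ p)%:E * mu (F i) +
     ((lip M * e)%:E * mu B + (M `^ p * eta)%:E))%E /\
  (\sum_(i <- s) (`|c i| `^ p)%:E * mu (F i) <= Ip B u + (lip M * e)%:E * mu B)%E.
Proof.
move=> e0 Bfin Beta mu_ uM cM cu; have L0 : 0 <= lip M by rewrite mulr_ge0 ?(ltW p0)// powR_ge0.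
have mp : measurable_fun B (fun x => (`|u x| `^ p)%:E) by exact: measurable_EFin_powR_norm.
have p0' x : (0 <= (`|u x| `^ p)%:E)%E by rewrite lee_fin powR_ge0.
have aeF i : i \in s -> {ae mu, forall x, F i x -> `|u x| <= M}.
  by move=> si; apply: filterS uM => x + Fx; apply; exact: FB Fx.
have muF i : i \in s -> measurable_fun (F i) u.
  by move=> si; apply: measurable_funS mu_ => //; exact: FB.
have Le0 : 0 <= lip M * e by rewrite mulr_ge0.
have sumle : (\sum_(i <- s) (lip M)%:E * (e%:E * mu (F i)) <= (lip M * e)%:E * mu B)%E.
  rewrite -ge0_sume_distrr//; last by move=> i _; rewrite mule_ge0.
  rewrite -ge0_sume_distrr// muleA -EFinM.
  by apply: lee_wpmul2l; [rewrite lee_fin|exact: measure_seq_disjoint_le].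
split; last first.
  apply: (@le_trans _ _ (\sum_(i <- s) (Ip (F i) u + (lip M)%:E * (e%:E * mu (F i))))%E).
    rewrite big_seq [leRHS]big_seq; apply: lee_sum => i si.
    have [_ h] := pint_near_cst (mF i) (muF i si) (aeF i si) (cM i si).
    by apply: (le_trans h); rewrite leeD2l// lee_wpmul2l ?lee_fin// cu.
  rewrite big_split/= leeD//; exact: integral_seq_disjoint_le.
pose D := B `\` \big[setU/set0]_(i <- s) F i.
have mD : measurable D by exact: measurableD.
have muD : (mu D <= eta%:E)%E.
  have Ufin : mu (\big[setU/set0]_(i <- s) F i) \is a fin_num.
    by rewrite ge0_fin_numE//; apply: le_lt_trans Bfin; rewrite le_measure ?inE.
  rewrite /D measureD// (setIidr FB') leeBlDl//.
  by apply: (le_trans Beta); rewrite -measure_seq_disjoint.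
have cover : B `<=` \big[setU/set0]_(i <- s) F i `|` D.
  by move=> x Bx; have [?|?] := pselect ((\big[setU/set0]_(i <- s) F i) x); [left|right].
have h := @integral_seq_cover_le _ _ _ mu _ s F B D _ mB mD mF mp (fun x _ => p0' x) cover.
apply: (le_trans h) => {h}.
rewrite [leRHS]addeA; apply: leeD.
  apply: (@le_trans _ _ (\sum_(i <- s) ((`|c i| `^ p)%:E * mu (F i) +
      (lip M)%:E * (e%:E * mu (F i))))%E); last by rewrite big_split/= leeD2l.
  rewrite big_seq [leRHS]big_seq; apply: lee_sum => i si; rewrite setIidr; last exact: FB.
  have [h _] := pint_near_cst (mF i) (muF i si) (aeF i si) (cM i si).
  by apply: (le_trans h); rewrite leeD2l// lee_wpmul2l ?lee_fin// cu.
have DB : D `<=` B by move=> x [].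
rewrite setIidr//; apply: (@le_trans _ _ ((M `^ p)%:E * mu D)%E).
  apply: pint_ae_bounded => //; first exact: measurable_funS mu_.
  by apply: filterS uM => x + Dx; apply; exact: DB.
by rewrite EFinM lee_wpmul2l// lee_fin powR_ge0.
Qed.

End near_step_functions.

Section essential_bounds.
Context {R : realType} {X : pmmSpace R}.
Local Notation bset A := (A : set (borel X)).

Lemma LpN_oo_ae (U : set X) (f : X -> R) (C : R) : (LpN U +oo (EFin \o f) <= C%:E)%E ->
  (0 < vol X [set: borel X])%E ->
  {ae vol X, forall x : borel X, U x -> `|f x| <= C}.
Proof.
rewrite /LpN unlock => + X0; rewrite X0 => /ess_supP; apply: filterS => x + Ux.
by rewrite /= /patch mem_set// lee_fin.
Qed.

Lemma LpN_oo_le (U : set X) (f : X -> R) (C : R) : 0 <= C ->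
  (forall x, U x -> `|f x| <= C) -> (LpN U +oo (EFin \o f) <= C%:E)%E.
Proof.
move=> C0 fC; rewrite /LpN unlock; case: ifP => _; last by rewrite lee_fin.
apply/ess_supP; apply: nearW => x /=; rewrite /patch; case: ifPn => [xU|_].
  by rewrite lee_fin fC// -in_setE.
by rewrite abse0 lee_fin.
Qed.

End essential_bounds.


(** * Points, distances and volumes along Gromov-Hausdorff convergence *)

Lemma near_seq (T : Type) (I : eqType) (F : set_system T) {FF : Filter F} (s : seq I)
    (P : I -> T -> Prop) :
  (forall x, x \in s -> \forall i \near F, P x i) ->
  \forall i \near F, forall x, x \in s -> P x i.
Proof.
elim: s => [|y s IH] H; first by apply: nearW => i x; rewrite in_nil.
have h1 : \forall i \near F, P y i by apply: H; rewrite mem_head.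
have h2 : \forall i \near F, forall x, x \in s -> P x i.
  by apply: IH => x xs; apply: H; rewrite in_cons xs orbT.
by apply: filterS2 h1 h2 => i Py Ps x; rewrite in_cons => /predU1P[->//|/Ps].
Qed.

Lemma cvg_sum_seq {R : realType} (I : eqType) (s : seq I) (u : I -> nat -> R) (l : I -> R) :
  (forall x, x \in s -> u x n @[n --> \oo] --> l x) ->
  \sum_(x <- s) u x n @[n --> \oo] --> \sum_(x <- s) l x.
Proof.
elim: s => [|y s IH] H.
  by rewrite big_nil; under eq_fun do rewrite big_nil; exact: cvg_cst.
rewrite big_cons; under eq_fun do rewrite big_cons.
apply: cvgD; first by apply: H; rewrite mem_head.
by apply: IH => x xs; apply: H; rewrite in_cons xs orbT.
Qed.

Section convergence_theory.
Context {R : realType} (X : nat -> pmmSpace R) (Xoo : pmmSpace R).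
Context (rad eps : nat -> R) (psi : forall i, X i -> Xoo).
Local Notation mu i A := (vol (X i) (A : set (borel (X i)))).
Local Notation muoo A := (vol Xoo (A : set (borel Xoo))).
Local Notation bset A := (A : set (borel _)).

(* The junk value [base (X i)] occurs for finitely many [i] only. *)
Definition approx_pt (z : Xoo) (i : nat) : X i :=
  xget (base (X i)) [set x | ball (base (X i)) (rad i) x /\ mdist z (psi x) < eps i].

Hypothesis pmGH : pmGH_cvg rad psi eps.

Let eps0 e : 0 < e -> \forall i \near \oo, eps i < e.
Proof.
move=> e0; have [/cvgrPdist_lt/(_ e e0) + _ _ _] := pmGH; apply: filterS => i.
by rewrite sub0r normrN; apply: le_lt_trans; exact: ler_norm.
Qed.

Let rad_gt A : \forall i \near \oo, A < rad i.
Proof. by have [_ /cvgryPgt/(_ A) + _ _] := pmGH. Qed.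

Lemma cvg_ptsP (y : forall i, X i) (z : Xoo) : cvg_pts rad psi y z <->
  (\forall i \near \oo, ball (base (X i)) (rad i) (y i)) /\
  forall e, 0 < e -> \forall i \near \oo, mdist (psi (y i)) z < e.
Proof.
split=> -[yr yz]; split=> //.
  move=> e e0; have /cvg_ballP/(_ e e0) := yz; apply: filterS => i.
  by rewrite in_ball metric_sym.
by apply/cvg_ballP => e /yz; apply: filterS => i; rewrite in_ball metric_sym.
Qed.

Lemma approx_pt_cvg z : cvg_pts rad psi (approx_pt z) z.
Proof.
have [_ _ _ [_ dense _ _]] := pmGH.
have near_ok : \forall i \near \oo, ball (base (X i)) (rad i) (approx_pt z i) /\
    mdist z (psi (approx_pt z i)) < eps i.
  apply: filterS (rad_gt (mdist (base Xoo) z)) => i zi.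
  have [|x xr zx] := dense i z; first by rewrite in_ball.
  have := @xgetPex _ (base (X i)) [set x | ball (base (X i)) (rad i) x /\ mdist z (psi x) < eps i].
  by apply; exists x.
apply/cvg_ptsP; split; first by apply: filterS near_ok => i [].
move=> e /eps0; apply: filterS2 near_ok => i [_ h1] h2.
by rewrite metric_sym (lt_trans h1).
Qed.

Lemma base_cvg : cvg_pts rad psi (fun i => base (X i)) (base Xoo).
Proof.
have [_ _ _ [_ _ bc _]] := pmGH; split=> //.
by apply: filterS (rad_gt 0) => i r0; rewrite in_ball mdistxx.
Qed.

Lemma mdist_cvg y y' z z' : cvg_pts rad psi y z -> cvg_pts rad psi y' z' ->
  forall e, 0 < e -> \forall i \near \oo, `|mdist (y i) (y' i) - mdist z z'| < e.
Proof.
move=> /cvg_ptsP[yr yz] /cvg_ptsP[yr' yz'] e e0.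
have [_ _ _ [iso _ _ _]] := pmGH.
have e3 : 0 < e / 3 by rewrite divr_gt0.
near=> i.
have h1 : ball (base (X i)) (rad i) (y i) by near: i.
have h2 : ball (base (X i)) (rad i) (y' i) by near: i.
have h3 : mdist (psi (y i)) z < e / 3 by near: i; exact: yz.
have h4 : mdist (psi (y' i)) z' < e / 3 by near: i; exact: yz'.
have h5 : eps i < e / 3 by near: i; exact: eps0.
have h6 := iso i _ _ h1 h2; move: h6; rewrite !ltr_norml => /andP[h6 h7].
have t1 := metric_triangle (psi (y i)) z (psi (y' i)).
have t2 := metric_triangle z z' (psi (y' i)).
have t3 := metric_triangle z (psi (y i)) z'.
have t4 := metric_triangle (psi (y i)) (psi (y' i)) z'.
have s1 := metric_sym z (psi (y i)); have s2 := metric_sym z' (psi (y' i)).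
apply/andP; split; lra.
Unshelve. all: by end_near. Qed.

Context (K Rh r : R).
Hypotheses (HX : forall i, doubling_space (X i) K Rh) (HXoo : doubling_space Xoo K Rh).
Hypothesis r0 : 0 < r.
Local Notation m i A := (fine (mu i A)).
Local Notation moo A := (fine (muoo A)).
Local Notation B i := (ball (base (X i)) r).
Local Notation Boo := (ball (base Xoo) r).

Lemma vol_cvg y z t : 0 < t -> cvg_pts rad psi y z ->
  m i (ball (y i) t) @[i --> \oo] --> moo (ball z t).
Proof.
move=> t0 yz; have [_ _ _ [_ _ _ vc]] := pmGH.
by apply: fine_cvg; rewrite fineK ?(vol_ball_fin HXoo)//; exact: vc.
Qed.

(* The common value [c] makes [u i] and [uoo] simultaneously close to a constant
   on small balls about [z]. *)
Definition near_cst_at (u : forall i, X i -> R) (uoo : Xoo -> R) (M : R) (z : Xoo) :=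
  forall e, 0 < e -> exists2 t0 : R, 0 < t0 & forall t, 0 < t < t0 ->
    exists c : R, [/\ `|c| <= M,
      (\forall i \near \oo, (\int[vol (X i)]_(x in bset (ball (approx_pt z i) t))
          `|u i x - c|%:E <= e%:E * mu i (ball (approx_pt z i) t))%E) &
      (\int[vol Xoo]_(x in bset (ball z t)) `|uoo x - c|%:E <= e%:E * muoo (ball z t))%E].

Context (p : R).
Hypothesis p1 : 1 < p.

(* Both functions are nearly constant on the balls of a Vitali covering of almost
   all of the limit ball, and the volumes of these balls converge. *)
Lemma near_cst_pint_cvg (u : forall i, X i -> R) (uoo : Xoo -> R) (M : R) :
  (forall i, measurable_fun (bset (B i)) (u i : borel (X i) -> R)) ->
  measurable_fun (bset Boo) (uoo : borel Xoo -> R) ->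
  (forall i, {ae vol (X i), forall x : borel (X i), B i x -> `|u i x| <= M}) ->
  {ae vol Xoo, forall x : borel Xoo, Boo x -> `|uoo x| <= M} ->
  {ae vol Xoo, forall z : borel Xoo, Boo z -> near_cst_at u uoo M z} ->
  forall delta, 0 < delta -> \forall i \near \oo,
    (pint (vol (X i)) p (bset (B i)) (u i) <=
       pint (vol Xoo) p (bset Boo) uoo + delta%:E)%E /\
    (pint (vol Xoo) p (bset Boo) uoo <=
       pint (vol (X i)) p (bset (B i)) (u i) + delta%:E)%E.
Proof.
have A1 (b v w b' t : R) : b <= v + t -> `|v - w| < t / 2 -> `|b - b'| < Num.min (t / 2) 1 ->
    b' <= w + 2 * t.
  by rewrite lt_min !ltr_norml => ? /andP[? ?] /andP[/andP[? ?] _]; lra.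
have A2 (a b t : R) : `|a - b| < Num.min t 1 -> b <= a + 1.
  by rewrite lt_min !ltr_norml => /andP[_ /andP[? ?]]; lra.
have A3 (d a b x y : R) : `|a - b| < d / 4 -> x <= d / 4 -> y <= d / 4 ->
    b + (x + y) <= a + d * 3 / 4.
  by rewrite ltr_norml => /andP[? ?] ? ?; lra.
have A4 (d : R) : d = d / 4 + d * 3 / 4 by lra.
have A5 (a b t q t' : R) : `|a - b| < q -> t + q < t' - b -> a + t <= t'.
  by rewrite ltr_norml => /andP[? ?] ?; lra.
have A6 (a b t q t' : R) : `|a - b| < q -> t + t' + 2 * q < b -> t + t' <= a.
  by rewrite ltr_norml => /andP[? ?] ?; lra.
move=> mu_ muoo_ uM uooM [N [mN N0 NG]] delta delta0.
have p0 : 0 < p by exact: lt_trans p1.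
pose L := p * M `^ (p - 1).
have L0 : 0 <= L by rewrite mulr_ge0 ?(ltW p0)// powR_ge0.
have V0 : 0 <= moo Boo by rewrite fine_ge0.
(* Being within [e] of a constant on average costs [L * e] times the volume, and [moo Boo + 1]
   bounds the volumes of the balls in [X i] for large [i]. The packing misses a volume of at most
   [eta] in the limit, hence at most [2 * eta] in [X i], at a cost of [M ^ p * (2 * eta)]. *)
pose e := delta / 4 / (L * (moo Boo + 1) + 1).
have LV0 : 0 <= L * (moo Boo + 1) by rewrite mulr_ge0// addr_ge0.
have e0 : 0 < e by rewrite !divr_gt0// ltr_wpDl.
have Le : L * (moo Boo + 1) * e <= delta / 4.
  by rewrite /e mulrC mulrAC ler_pdivrMr ?ltr_wpDl// ler_wpM2l ?lerDl// ltW// divr_gt0.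
have Mp0 : 0 <= M `^ p by exact: powR_ge0.
pose eta := delta / 8 / (M `^ p + 1).
have eta0 : 0 < eta by rewrite !divr_gt0// ltr_wpDl.
have Meta : M `^ p * (2 * eta) <= delta / 4.
  have : M `^ p * eta <= delta / 8.
    by rewrite /eta mulrC mulrAC ler_pdivrMr ?ltr_wpDl// ler_wpM2l ?lerDl// ltW// divr_gt0.
  by lra.
have /choice[T0 T0P] : forall z, exists t0, near_cst_at u uoo M z -> 0 < t0 /\
    forall t, 0 < t < t0 -> exists c : R, [/\ `|c| <= M,
      (\forall i \near \oo, (\int[vol (X i)]_(x in bset (ball (approx_pt z i) t))
          `|u i x - c|%:E <= e%:E * mu i (ball (approx_pt z i) t))%E) &
      (\int[vol Xoo]_(x in bset (ball z t)) `|uoo x - c|%:E <= e%:E * muoo (ball z t))%E].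
  move=> z; have [/(_ e e0)[t0 t00 H]|nz] := pselect (near_cst_at u uoo M z).
    by exists t0.
  by exists 0.
pose G := [set z | Boo z /\ near_cst_at u uoo M z].
pose T z := Num.min (T0 z) (r - mdist (base Xoo) z).
have T_gt0 z : G z -> 0 < T z.
  by move=> [+ /T0P[T00 _]]; rewrite in_ball lt_min T00 subr_gt0.
have BGN : Boo `<=` G `|` N.
  move=> z Bz; have [nz|nz] := pselect (near_cst_at u uoo M z); first by left.
  by right; apply: NG => /= h; apply: nz; exact: h.
have [s [e' e'0 [us sP seps sU]]] := @vitali R Xoo K Rh HXoo G N T mN N0 T_gt0 Boo eta
  (@mdist_open_ball _ _ _ r) (vol_ball_lty HXoo _ _) BGN eta0.
have /choice[c cP] : forall x : Xoo * R, exists c : R, x \in s ->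
   [/\ `|c| <= M,
      (\forall i \near \oo, (\int[vol (X i)]_(y in bset (ball (approx_pt x.1 i) x.2))
          `|u i y - c|%:E <= e%:E * mu i (ball (approx_pt x.1 i) x.2))%E) &
      (\int[vol Xoo]_(y in bset (ball x.1 x.2)) `|uoo y - c|%:E <=
         e%:E * muoo (ball x.1 x.2))%E].
  move=> x; have [xs|_] := boolP (x \in s); last by exists 0.
  have [[_ Gx] x20 xT] := sP x xs; have [_ /(_ x.2)] := T0P _ Gx.
  case=> [|c cP]; last by exists c.
  by rewrite x20; move: xT; rewrite lt_min => /andP[h _]; lra.
have FBoo x : x \in s -> ball x.1 x.2 `<=` Boo.
  move=> /sP[_ _]; rewrite lt_min => /andP[_ h]; apply: mball_sub; lra.
have tFoo : {in s &, forall x y, x != y -> ball x.1 x.2 `&` ball y.1 y.2 = set0}.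
  by move=> x y xs ys xy; apply: sep_ball_disjoint; have := seps x y xs ys xy; lra.
have [ub_oo lb_oo] := @pint_near_step _ (borel Xoo) R (vol Xoo) p p1 _ s
  (fun x => ball x.1 x.2) Boo (measurable_mball _ _) (fun x => measurable_mball _ _) us tFoo
  FBoo uoo c M e eta (ltW e0) (vol_ball_lty HXoo _ _) sU muoo_ uooM
  (fun x xs => let: And3 h _ _ := cP x xs in h) (fun x xs => let: And3 _ _ h := cP x xs in h).
pose S i := \sum_(x <- s) `|c x| `^ p * m i (ball (approx_pt x.1 i) x.2).
pose Soo := \sum_(x <- s) `|c x| `^ p * moo (ball x.1 x.2).
have S_cvg : S i @[i --> \oo] --> Soo.
  apply: cvg_sum_seq => x /sP[_ x20 _]; apply: cvgMr.
  exact: vol_cvg x20 (approx_pt_cvg _).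
pose V i := \sum_(x <- s) m i (ball (approx_pt x.1 i) x.2).
pose Voo := \sum_(x <- s) moo (ball x.1 x.2).
have V_cvg : V i @[i --> \oo] --> Voo.
  by apply: cvg_sum_seq => x /sP[_ x20 _]; exact: vol_cvg x20 (approx_pt_cvg _).
have B_cvg := vol_cvg r0 base_cvg.
have sumoo (h : Xoo * R -> R) : (\sum_(x <- s) (h x)%:E * muoo (ball x.1 x.2) =
    (\sum_(x <- s) h x * moo (ball x.1 x.2))%:E)%E.
  rewrite -sumEFin; apply: eq_bigr => x _.
  by rewrite EFinM fineK ?(vol_ball_fin HXoo).
have sumi i (h : Xoo * R -> R) : (\sum_(x <- s) (h x)%:E * mu i (ball (approx_pt x.1 i) x.2) =
    (\sum_(x <- s) h x * m i (ball (approx_pt x.1 i) x.2))%:E)%E.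
  rewrite -sumEFin; apply: eq_bigr => x _.
  by rewrite EFinM fineK ?(vol_ball_fin (HX i)).
have Boofin := vol_ball_fin HXoo (base Xoo) r.
have sU' : moo Boo <= Voo + eta.
  rewrite -lee_fin EFinD fineK//; apply: (le_trans sU); rewrite leeD2r// /Voo -sumEFin.
  by apply: lee_sum => x _; rewrite fineK ?(vol_ball_fin HXoo).
rewrite sumoo -/Soo -(fineK Boofin) -EFinM in ub_oo lb_oo.
near=> i.
(* The margin [e'] of the packing exceeds the error in the distances for large [i], so the
   transported balls stay inside [B i] and remain disjoint. *)
have FB : forall x, x \in s -> ball (approx_pt x.1 i) x.2 `<=` B i.
  near: i; apply: near_seq => x xs; have [_ _] := sP x xs.
  rewrite lt_min => /andP[_ h].
  apply: filterS (mdist_cvg base_cvg (approx_pt_cvg x.1) e'0) => i h'.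
  exact: mball_sub (A5 _ _ _ _ _ h' h).
have tF : {in s &, forall x y, x != y ->
    ball (approx_pt x.1 i) x.2 `&` ball (approx_pt y.1 i) y.2 = set0}.
  suff H : forall x, x \in s -> forall y, y \in s -> x != y ->
      ball (approx_pt x.1 i) x.2 `&` ball (approx_pt y.1 i) y.2 = set0.
    by move=> x y xs ys; exact: H.
  near: i; apply: near_seq => x xs; apply: near_seq => y ys.
  have [->|xy] := eqVneq x y; first by apply: nearW.
  have h := seps x y xs ys xy.
  apply: filterS (mdist_cvg (approx_pt_cvg x.1) (approx_pt_cvg y.1) e'0) => i h' _.
  apply: (@sep_ball_disjoint _ _ (approx_pt x.1 i, x.2) (approx_pt y.1 i, y.2)) => /=.
  exact: A6 h' h.
have cu : forall x, x \in s -> (\int[vol (X i)]_(y in bset (ball (approx_pt x.1 i) x.2))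
          `|u i y - c x|%:E <= e%:E * mu i (ball (approx_pt x.1 i) x.2))%E.
  by near: i; apply: near_seq => x xs; have [] := cP x xs.
have hS : `|Soo - S i| < delta / 4.
  by near: i; have /cvgrPdist_lt := S_cvg; apply; rewrite divr_gt0.
have hV : `|Voo - V i| < eta / 2.
  by near: i; have /cvgrPdist_lt := V_cvg; apply; rewrite divr_gt0.
have hB : `|moo Boo - m i (B i)| < Num.min (eta / 2) 1.
  by near: i; have /cvgrPdist_lt := B_cvg; apply; rewrite lt_min ltr01 divr_gt0.
have Bifin := vol_ball_fin (HX i) (base (X i)) r.
have sUi : (mu i (B i) <= \sum_(x <- s) mu i (ball (approx_pt x.1 i) x.2) + (2 * eta)%:E)%E.
  have -> : (\sum_(x <- s) mu i (ball (approx_pt x.1 i) x.2) = (V i)%:E)%E.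
    by rewrite /V -sumEFin; apply: eq_bigr => x _; rewrite fineK ?(vol_ball_fin (HX i)).
  rewrite -(fineK Bifin) -EFinD lee_fin.
  exact: A1 sU' hV hB.
have [ub lb] := @pint_near_step _ (borel (X i)) R (vol (X i)) p p1 _ s
  (fun x => ball (approx_pt x.1 i) x.2) (B i) (measurable_mball _ _)
  (fun x => measurable_mball _ _) us tF
  FB (u i) c M e (2 * eta) (ltW e0) (vol_ball_lty (HX i) _ _) sUi (mu_ i) (uM i)
  (fun x xs => let: And3 h _ _ := cP x xs in h) cu.
rewrite sumi -/(S i) in ub lb.
have Bi1 : m i (B i) <= moo Boo + 1.
  exact: A2 hB.
have LeBi : L * e * m i (B i) <= delta / 4.
  apply: (le_trans _ Le); rewrite mulrAC ler_wpM2r ?(ltW e0)//.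
  by rewrite ler_wpM2l.
have LeBoo : L * e * moo Boo <= delta / 4.
  apply: (le_trans _ Le); rewrite mulrAC ler_wpM2r ?(ltW e0)//.
  by rewrite ler_wpM2l// lerDl.
have Meta' : M `^ p * eta <= delta / 4.
  by apply: (le_trans _ Meta); rewrite ler_wpM2l// ler_peMl ?ler1n// ltW.
rewrite -(fineK Bifin) -EFinM in ub lb.
split.
  apply: (le_trans ub); apply: (@le_trans _ _ (Soo%:E + (delta * 3 / 4)%:E)%E).
    by rewrite -!EFinD lee_fin; exact: A3 hS LeBi Meta.
  have -> : ((delta%:E : \bar R) = (delta / 4)%:E + (delta * 3 / 4)%:E)%E.
    by rewrite -EFinD -A4.
  rewrite addeA leeD2r//; apply: (le_trans lb_oo).
  by rewrite leeD2l// lee_fin.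
apply: (le_trans ub_oo); apply: (@le_trans _ _ ((S i)%:E + (delta * 3 / 4)%:E)%E).
  by rewrite -!EFinD lee_fin; apply: A3 LeBoo Meta'; rewrite distrC.
have -> : ((delta%:E : \bar R) = (delta / 4)%:E + (delta * 3 / 4)%:E)%E.
  by rewrite -EFinD -A4.
rewrite addeA leeD2r//; apply: (le_trans lb).
by rewrite leeD2l// lee_fin.
Unshelve. all: by end_near. Qed.

End convergence_theory.


(** * Averages and strong convergence at a point *)

Lemma cvg0_nearP {R : realType} (T : Type) (F : set_system T) {FF : Filter F}
    (u : T -> \bar R) : (\forall t \near F, 0 <= u t)%E ->
  u t @[t --> F] --> 0%E <-> forall e : R, 0 < e -> \forall t \near F, (u t <= e%:E)%E.
Proof.
move=> u0; split=> [u_cvg e e0|H].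
  have /fine_cvgP[h1 /cvgrPdist_le /(_ e e0) h2] : u t @[t --> F] --> 0%:E by [].
  apply: filterS2 h1 h2 => t h1 h2; rewrite -(fineK h1) lee_fin.
  by move: h2; rewrite /= sub0r normrN; apply: le_trans; exact: ler_norm.
have fin e : 0 < e -> \forall t \near F, u t \is a fin_num /\ 0 <= fine (u t) <= e.
  move=> e0; apply: filterS2 u0 (H e e0) => t t0 te.
  have tf : u t \is a fin_num by rewrite ge0_fin_numE// (le_lt_trans te) ?ltry.
  by split=> //; rewrite fine_ge0//= -lee_fin fineK.
apply/fine_cvgP; split; first by apply: filterS (fin _ ltr01) => t [].
apply/cvgrPdist_le => e e0; apply: filterS (fin e e0) => t [_ /andP[t0 te]].
by rewrite sub0r normrN ger0_norm.
Qed.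

Lemma at_right0P {R : realType} (P : R -> Prop) :
  (\forall t \near 0^'+, P t) <-> exists2 t0 : R, 0 < t0 & forall t, 0 < t < t0 -> P t.
Proof.
split=> [/nbhs_ballP[e /= e0 He]|[t0 t00 H]].
  exists e => // t /andP[ht te]; apply: He => //.
  by rewrite /ball/= sub0r normrN gtr0_norm.
apply/nbhs_ballP; exists t0 => //= t; rewrite /ball/= sub0r normrN => h ht.
by apply: H; rewrite ht/= -(gtr0_norm ht).
Qed.

Section mean_ae.
Context {R : realType} {X : pmmSpace R}.
Local Notation mu A := (vol X (A : set (borel X))).
Local Notation m A := (fine (vol X (A : set (borel X)))).
Local Notation bset A := (A : set (borel X)).
Local Notation integ A f := ((vol X).-integrable (bset A) (EFin \o (f : borel X -> R))).

Lemma emean_le (A : set X) (h : X -> \bar R) (e : R) : (0 < mu A < +oo)%E ->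
  (emean A h <= e%:E)%E = (\int[vol X]_(x in bset A) h x <= e%:E * mu A)%E.
Proof.
move=> /andP[A0 Afin]; have mA0 : 0 < m A by rewrite fine_gt0// A0.
have -> : (e%:E * mu A = e%:E * (m A)%:E)%E by rewrite fineK// ge0_fin_numE.
by rewrite /emean lee_pdivrMl// muleC.
Qed.

Lemma integrable_ae_bounded (A : set X) (f : X -> R) (M : R) : measurable (bset A) ->
  (mu A < +oo)%E -> measurable_fun (bset A) (f : borel X -> R) ->
  {ae vol X, forall x : borel X, A x -> `|f x| <= M} -> integ A f.
Proof.
move=> mA Afin mf fM; apply/integrableP; split; first exact/measurable_EFinP.
apply: (@le_lt_trans _ _ (\int[vol X]_(x in bset A) (cst (`|M|)%:E x))%E).
  apply: ae_ge0_le_integral => //.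
  - by apply: measurableT_comp => //; exact/measurable_EFinP.
  - by move=> x _; rewrite lee_fin.
  - by apply: filterS fM => x + Ax => /(_ Ax) h; rewrite lee_fin (le_trans h)// ler_norm.
by rewrite integral_cst// lte_mul_pinfty// lee_fin.
Qed.

Lemma mean_near (A : set X) (f : X -> R) (c e : R) : measurable (bset A) ->
  (0 < mu A < +oo)%E -> integ A f ->
  (\int[vol X]_(x in bset A) `|f x - c|%:E <= e%:E * mu A)%E -> `|mean A f - c| <= e.
Proof.
move=> mA Av fi h; have /andP[A0 Afin] := Av.
have mA0 : 0 < m A by rewrite fine_gt0// A0.
apply: (le_trans (mean_dist_le c mA Av fi)); rewrite ler_pdivrMl// mulrC -lee_fin.
have Afin' : mu A \is a fin_num by rewrite ge0_fin_numE// ltW.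
rewrite EFinM (fineK Afin') /Rintegral fineK//.
rewrite ge0_fin_numE; last exact: integral_ge0.
by apply: le_lt_trans h _; rewrite -(fineK Afin') -EFinM ltry.
Qed.

Lemma mean_ae_bounded (A : set X) (f : X -> R) (M : R) : measurable (bset A) ->
  (0 < mu A < +oo)%E -> measurable_fun (bset A) (f : borel X -> R) ->
  {ae vol X, forall x : borel X, A x -> `|f x| <= M} -> `|mean A f| <= M.
Proof.
move=> mA Av mf fM; have /andP[A0 Afin] := Av.
rewrite -[mean A f]subr0; apply: mean_near => //.
  exact: integrable_ae_bounded fM.
rewrite -integral_cst//; apply: ae_ge0_le_integral => //.
- by apply/measurable_EFinP; apply: measurableT_comp => //; exact: measurable_funB.
- move=> x _ /=; rewrite lee_fin; have [//|M0] := leP 0 M; exfalso.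
  have : mu A = 0%E; last by move: A0 => /[swap] ->; rewrite ltxx.
  case: fM => N [mN N0 NP]; apply: (@subset_measure0 _ _ _ (vol X) A N) => // y Ay.
  by apply: NP => /= /(_ Ay); apply/negP; rewrite -ltNge (lt_le_trans M0).
- by apply: filterS fM => x + Ax => /(_ Ax); rewrite /= subr0 lee_fin.
Qed.

Lemma integral_dist_triangle (A : set X) (f g : X -> R) (h : X -> R) :
  measurable (bset A) -> measurable_fun (bset A) (f : borel X -> R) ->
  measurable_fun (bset A) (g : borel X -> R) ->
  measurable_fun (bset A) (h : borel X -> R) ->
  (forall x, A x -> `|h x| <= `|f x| + `|g x|) ->
  (\int[vol X]_(x in bset A) `|h x|%:E <= \int[vol X]_(x in bset A) `|f x|%:E +
    \int[vol X]_(x in bset A) `|g x|%:E)%E.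
Proof.
move=> mA mf mg mh hfg.
have ma (k : X -> R) : measurable_fun (bset A) (k : borel X -> R) ->
    measurable_fun (bset A) (fun x : borel X => `|k x|%:E).
  by move=> mk; apply/measurable_EFinP; exact: measurableT_comp.
rewrite -ge0_integralD//; [|exact: ma|exact: ma].
apply: ge0_le_integral => //; first exact: ma.
by apply: emeasurable_funD; exact: ma.
Qed.

Lemma integral_dist_le (A : set X) (f : X -> R) (e : R) : measurable (bset A) -> 0 <= e ->
  measurable_fun (bset A) (f : borel X -> R) -> (forall x, A x -> `|f x| <= e) ->
  (\int[vol X]_(x in bset A) `|f x|%:E <= e%:E * mu A)%E.
Proof.
move=> mA e0 mf fe; rewrite -integral_cst//; apply: ge0_le_integral => //.
  by apply/measurable_EFinP; exact: measurableT_comp.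
Qed.

End mean_ae.

Section strong_convergence.
Context {R : realType} (X : nat -> pmmSpace R) (Xoo : pmmSpace R).
Context (rad eps : nat -> R) (psi : forall i, X i -> Xoo).
Local Notation mu i A := (vol (X i) (A : set (borel (X i)))).
Local Notation muoo A := (vol Xoo (A : set (borel Xoo))).
Local Notation bset A := (A : set (borel _)).
Hypothesis pmGH : pmGH_cvg rad psi eps.
Context (K Rh r : R).
Hypotheses (HX : forall i, doubling_space (X i) K Rh) (HXoo : doubling_space Xoo K Rh).
Hypotheses (r0 : 0 < r) (rRh : 4 * (r + 1) <= Rh).
Hypothesis v1 : forall i, mu i (ball (base (X i)) 1) = 1%E.
Hypothesis v1oo : muoo (ball (base Xoo) 1) = 1%E.
Local Notation B i := (ball (base (X i)) r).
Local Notation Boo := (ball (base Xoo) r).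

Lemma ball_sub_near (y : forall i, X i) (z : Xoo) (t : R) : cvg_pts rad psi y z ->
  mdist (base Xoo) z + t < r -> \forall i \near \oo, ball (y i) t `<=` B i.
Proof.
move=> yz zt; have e0 : 0 < r - (mdist (base Xoo) z + t) by rewrite subr_gt0.
apply: filterS (mdist_cvg pmGH (base_cvg pmGH) yz e0) => i.
by rewrite ltr_norml => /andP[_ h]; apply: mball_sub; lra.
Qed.

Let pos_i i z t : mdist z (base (X i)) < r -> 0 < t -> (0 < mu i (ball z t) < +oo)%E.
Proof.
by move=> zr t0; rewrite (ball_vol_gt0 (HX i) r0 rRh (v1 i))//= (vol_ball_lty (HX i)).
Qed.

Let pos_oo z t : mdist z (base Xoo) < r -> 0 < t -> (0 < muoo (ball z t) < +oo)%E.
Proof.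
by move=> zr t0; rewrite (ball_vol_gt0 HXoo r0 rRh v1oo)//= (vol_ball_lty HXoo).
Qed.

Let pos_near (y : forall i, X i) (z : Xoo) t : cvg_pts rad psi y z -> Boo z -> 0 < t ->
  \forall i \near \oo, (0 < mu i (ball (y i) t) < +oo)%E.
Proof.
rewrite in_ball => yz zr t0; have e0 : 0 < r - mdist (base Xoo) z by rewrite subr_gt0.
apply: filterS (mdist_cvg pmGH (base_cvg pmGH) yz e0) => i.
by rewrite ltr_norml => /andP[_ h]; apply: pos_i => //; rewrite metric_sym; lra.
Qed.

(** The constants for [u] and [v] on a common ball are subtracted. The choice of [t0] also keeps the
    balls inside those of radius [r], where the functions are known to be measurable. *)
Lemma near_cst_atB (u v : forall i, X i -> R) (uoo voo : Xoo -> R) (M M' : R) (z : Xoo) :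
  Boo z ->
  (forall i, measurable_fun (bset (B i)) (u i : borel (X i) -> R)) ->
  measurable_fun (bset Boo) (uoo : borel Xoo -> R) ->
  (forall i, measurable_fun (bset (B i)) (v i : borel (X i) -> R)) ->
  measurable_fun (bset Boo) (voo : borel Xoo -> R) ->
  near_cst_at rad eps psi u uoo M z -> near_cst_at rad eps psi v voo M' z ->
  near_cst_at rad eps psi (fun i x => u i x - v i x) (fun x => uoo x - voo x) (M + M') z.
Proof.
rewrite in_ball => zr mu_ muoo_ mv mvoo gu gv e e0; have e2 : 0 < e / 2 by rewrite divr_gt0.
have [t1 t10 H1] := gu _ e2; have [t2 t20 H2] := gv _ e2.
exists (Num.min (Num.min t1 t2) (r - mdist (base Xoo) z)).
  by rewrite !lt_min t10 t20 subr_gt0.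
move=> t; rewrite !lt_min => /andP[t0 /andP[/andP[tt1 tt2] tr]].
have [|c1 [c1M u1 uoo1]] := H1 t; first by rewrite t0.
have [|c2 [c2M u2 uoo2]] := H2 t; first by rewrite t0.
have half (a : \bar R) : (0 <= a)%E -> ((e / 2)%:E * a + (e / 2)%:E * a = e%:E * a)%E.
  by move=> a0; rewrite -ge0_muleDl ?lee_fin ?(ltW e2)// -EFinD -splitr.
have ineq (a b c d : R) : `|a - b - (c - d)| <= `|a - c| + `|b - d|.
  by rewrite (_ : a - b - (c - d) = (a - c) - (b - d)); [exact: ler_normB|ring].
exists (c1 - c2); split; first by rewrite (le_trans (ler_normB _ _))// lerD.
- have sub : \forall i \near \oo, ball (approx_pt rad eps psi z i) t `<=` B i.
    by apply: ball_sub_near (approx_pt_cvg pmGH z) _; lra.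
  apply: filterS3 u1 u2 sub => i h1 h2 hs; rewrite -half//.
  have mm (k : X i -> R) c : measurable_fun (bset (B i)) (k : borel (X i) -> R) ->
      measurable_fun (bset (ball (approx_pt rad eps psi z i) t))
        ((fun x => k x - c) : borel (X i) -> R).
    move=> mk; apply: measurable_funB => //.
    exact: (measurable_funS (measurable_mball _ _) hs mk).
  apply: le_trans (leeD h1 h2); apply: integral_dist_triangle.
  + exact: measurable_mball.
  + exact: mm.
  + exact: mm.
  + by apply: mm; exact: measurable_funB.
  + by move=> x _; exact: ineq.
have hs : ball z t `<=` Boo by apply: mball_sub; lra.
have mm (k : Xoo -> R) c : measurable_fun (bset Boo) (k : borel Xoo -> R) ->
    measurable_fun (bset (ball z t)) ((fun x => k x - c) : borel Xoo -> R).
  move=> mk; apply: measurable_funB => //.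
  exact: (measurable_funS (measurable_mball _ _) hs mk).
rewrite -half//; apply: le_trans (leeD uoo1 uoo2); apply: integral_dist_triangle.
+ exact: measurable_mball.
+ exact: mm.
+ exact: mm.
+ by apply: mm; exact: measurable_funB.
+ by move=> x _; exact: ineq.
Qed.

Let emean_ge0 (Y : pmmSpace R) (A : set Y) (h : Y -> R) :
  (0 <= emean A (fun x => `|h x|%:E))%E.
Proof. by rewrite mule_ge0 ?lee_fin ?invr_ge0 ?fine_ge0//; exact: integral_ge0. Qed.

Let limn_esup_ge0 (h : nat -> \bar R) : (forall n, 0 <= h n)%E -> (0 <= limn_esup h)%E.
Proof. by move=> h0; apply: le_trans (limn_einf_sup _); exact: limn_einf_ge0. Qed.

(** The constant is the mean of [uoo] over [ball z t]. The first half of strong convergence puts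
    [u i] near it; the second puts [uoo] near the mean of [u i], which the first half has placed
    near the constant. For the statement about [uoo], a single good index [i] suffices. *)
Lemma strong_cvg_near_cst (u : forall i, X i -> R) (uoo : Xoo -> R) (M : R) (z : Xoo) :
  Boo z ->
  (forall i, measurable_fun (bset (B i)) (u i : borel (X i) -> R)) ->
  measurable_fun (bset Boo) (uoo : borel Xoo -> R) ->
  (forall i, {ae vol (X i), forall x : borel (X i), B i x -> `|u i x| <= M}) ->
  {ae vol Xoo, forall x : borel Xoo, Boo x -> `|uoo x| <= M} ->
  strong_cvg_at rad psi u uoo z -> near_cst_at rad eps psi u uoo M z.
Proof.
move=> Bz mu_ muoo_ uM uooM su e e0; have zr := Bz; rewrite in_ball in zr.
have az := approx_pt_cvg pmGH z; have [s1 s2] := su _ az.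
have e4 : 0 < e / 4 by rewrite divr_gt0.
have e42 : e / 4 < e / 2 by lra.
have /at_right0P[t1 t10 H1] : \forall t \near 0^'+, (limn_esup (fun i =>
    emean (ball (approx_pt rad eps psi z i) t)
      (fun x => `|u i x - mean (ball z t) uoo|%:E)) <= (e / 4)%:E)%E.
  apply: (iffLR (cvg0_nearP _) s1 _ e4).
  by apply: nearW => t; apply: limn_esup_ge0.
have /at_right0P[t2 t20 H2] : \forall t \near 0^'+, (limn_esup (fun i => emean (ball z t)
       (fun x => `|uoo x - mean (ball (approx_pt rad eps psi z i) t) (u i)|%:E))
       <= (e / 4)%:E)%E.
  apply: (iffLR (cvg0_nearP _) s2 _ e4).
  by apply: nearW => t; apply: limn_esup_ge0.
exists (Num.min (Num.min t1 t2) (r - mdist (base Xoo) z)).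
  by rewrite !lt_min t10 t20 subr_gt0.
move=> t; rewrite !lt_min => /andP[t0 /andP[/andP[tt1 tt2] tr]].
have tt1' : 0 < t < t1 by rewrite t0.
have tt2' : 0 < t < t2 by rewrite t0.
have e42' : ((e / 4)%:E < (e / 2)%:E)%E by rewrite lte_fin.
have [N1 N1P] := limn_esup_lt (le_lt_trans (H1 t tt1') e42').
have [N2 N2P] := limn_esup_lt (le_lt_trans (H2 t tt2') e42').
set c := mean (ball z t) uoo in N1P.
have hs : ball z t `<=` Boo by apply: mball_sub; lra.
have mball_ i x s : measurable (bset (ball (x : X i) s)) by exact: measurable_mball.
have mballoo x s : measurable (bset (ball (x : Xoo) s)) by exact: measurable_mball.
have zr' : mdist z (base Xoo) < r by rewrite metric_sym.
have vz := pos_oo zr' t0.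
have moo_ : measurable_fun (bset (ball z t)) (uoo : borel Xoo -> R).
  exact: (measurable_funS (measurable_mball _ _) hs muoo_).
exists c; split.
- apply: mean_ae_bounded => //.
  by apply: filterS uooM => x + zx; apply; exact: hs.
- have n1 : \forall i \near \oo, (N1 <= i)%N by exists N1.
  apply: filterS2 n1 (pos_near az Bz t0) => i iN vi; rewrite -emean_le//.
  by apply: (le_trans (ltW (N1P i iN))); rewrite lee_fin; lra.
have sub : \forall i \near \oo, ball (approx_pt rad eps psi z i) t `<=` B i.
  by apply: ball_sub_near az _; lra.
have n12 : \forall i \near \oo, (N1 <= i)%N /\ (N2 <= i)%N.
  by exists (maxn N1 N2) => // i /=; rewrite geq_max => /andP[].
have [i [[i1 i2] [vi si]]] := filter_ex (filterI n12 (filterI (pos_near az Bz t0) sub)).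
have h2 := ltW (N2P i i2); rewrite emean_le// in h2.
have h1 := ltW (N1P i i1); rewrite emean_le// in h1.
have mi : measurable_fun (bset (ball (approx_pt rad eps psi z i) t)) (u i : borel (X i) -> R).
  exact: (measurable_funS (measurable_mball _ _) si (mu_ i)).
have aei : {ae vol (X i), forall x : borel (X i),
    ball (approx_pt rad eps psi z i) t x -> `|u i x| <= M}.
  by apply: filterS (uM i) => x + zx; apply; exact: si.
have vifin : (mu i (ball (approx_pt rad eps psi z i) t) < +oo)%E by case/andP : vi.
have h3 := mean_near (mball_ i _ t) vi (integrable_ae_bounded (mball_ i _ t) vifin mi aei) h1.
set mi' := mean _ (u i) in h2 h3.
have -> : (e%:E * muoo (ball z t) = (e / 2)%:E * muoo (ball z t) +
    (e / 2)%:E * muoo (ball z t))%E.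
  by rewrite -ge0_muleDl ?lee_fin ?divr_ge0 ?(ltW e0)// -EFinD -splitr.
have h4 := @integral_dist_le _ _ _ (cst (mi' - c)) _ (mballoo z t) (ltW (lt_trans e4 e42))
  (measurable_cst _) (fun _ _ => h3).
apply: le_trans (leeD h2 h4); apply: integral_dist_triangle => //.
- exact: measurable_funB.
- exact: measurable_funB.
- by move=> x _; rewrite /= (_ : uoo x - c = (uoo x - mi') + (mi' - c)); [exact: ler_normD|ring].
Qed.

(** Uniform closeness to [uoo z] on small balls passes to the means, so both averages in the
    definition are at most [e]. The hypothesis ranges over all [y] tending to [z] because the
    definition does. *)
Lemma uniform_strong_cvg (u : forall i, X i -> R) (uoo : Xoo -> R) (z : Xoo) :
  Boo z ->
  (forall i, measurable_fun (bset (B i)) (u i : borel (X i) -> R)) ->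
  measurable_fun (bset Boo) (uoo : borel Xoo -> R) ->
  (forall e, 0 < e -> exists2 t0 : R, 0 < t0 &
     (forall x, ball z t0 x -> `|uoo x - uoo z| <= e) /\
     forall y : forall i, X i, cvg_pts rad psi y z ->
       \forall i \near \oo, forall x, ball (y i) t0 x -> `|u i x - uoo z| <= e) ->
  strong_cvg_at rad psi u uoo z.
Proof.
move=> Bz mu_ muoo_ H y yz; have zr := Bz; rewrite in_ball in zr.
have zr' : mdist z (base Xoo) < r by rewrite metric_sym.
have mball_ i x s : measurable (bset (ball (x : X i) s)) by exact: measurable_mball.
have mballoo x s : measurable (bset (ball (x : Xoo) s)) by exact: measurable_mball.
have key e : 0 < e -> exists2 t0 : R, 0 < t0 & forall t, 0 < t < t0 ->
    \forall i \near \oo,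
      (emean (ball (y i) t) (fun x => `|u i x - mean (ball z t) uoo|%:E) <= e%:E)%E /\
      (emean (ball z t) (fun x => `|uoo x - mean (ball (y i) t) (u i)|%:E) <= e%:E)%E.
  move=> e0; have e2 : 0 < e / 2 by rewrite divr_gt0.
  have [t1 t10 [Hoo Hi]] := H _ e2.
  exists (Num.min t1 (r - mdist (base Xoo) z)); first by rewrite lt_min t10 subr_gt0.
  move=> t; rewrite lt_min => /andP[t0 /andP[tt1 tr]].
  have hs : ball z t `<=` Boo by apply: mball_sub; lra.
  have vz := pos_oo zr' t0; have vzfin : (muoo (ball z t) < +oo)%E by case/andP : vz.
  have moo_ : measurable_fun (bset (ball z t)) (uoo : borel Xoo -> R).
    exact: (measurable_funS (measurable_mball _ _) hs muoo_).
  have uoo_near x : ball z t x -> `|uoo x - uoo z| <= e / 2.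
    by move=> zx; apply: Hoo; move: zx; apply: le_ball; exact: ltW.
  have Moo x : ball z t x -> `|uoo x| <= e / 2 + `|uoo z|.
    by move=> /uoo_near h; rewrite -[X in `|X|](subrK (uoo z)) (le_trans (ler_normD _ _))// lerD2r.
  have ioo : (vol Xoo).-integrable (bset (ball z t)) (EFin \o (uoo : borel Xoo -> R)).
    by apply: (integrable_ae_bounded (mballoo z t) vzfin moo_ (M := e / 2 + `|uoo z|)); apply: aeW.
  have coo : `|mean (ball z t) uoo - uoo z| <= e / 2.
    apply: mean_near => //; apply: integral_dist_le => //; first exact: ltW.
    exact: measurable_funB.
  have sub : \forall i \near \oo, ball (y i) t `<=` B i by apply: ball_sub_near yz _; lra.
  have near3 : \forall i \near \oo, forall x, ball (y i) t1 x -> `|u i x - uoo z| <= e / 2.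
    exact: Hi.
  apply: filterS3 sub (pos_near yz Bz t0) near3 => i si vi ni.
  have vifin : (mu i (ball (y i) t) < +oo)%E by case/andP : vi.
  have mi : measurable_fun (bset (ball (y i) t)) (u i : borel (X i) -> R).
    exact: (measurable_funS (measurable_mball _ _) si (mu_ i)).
  have ui_near x : ball (y i) t x -> `|u i x - uoo z| <= e / 2.
    by move=> zx; apply: ni; move: zx; apply: le_ball; exact: ltW.
  have Mi x : ball (y i) t x -> `|u i x| <= e / 2 + `|uoo z|.
    by move=> /ui_near h; rewrite -[X in `|X|](subrK (uoo z)) (le_trans (ler_normD _ _))// lerD2r.
  have ii : (vol (X i)).-integrable (bset (ball (y i) t)) (EFin \o (u i : borel (X i) -> R)).
    by apply: (integrable_ae_bounded (mball_ i (y i) t) vifin mi (M := e / 2 + `|uoo z|)); apply: aeW.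
  have ci : `|mean (ball (y i) t) (u i) - uoo z| <= e / 2.
    apply: mean_near => //; apply: integral_dist_le => //; first exact: ltW.
    exact: measurable_funB.
  have tri (a b c : R) : `|a - c| <= e / 2 -> `|b - c| <= e / 2 -> `|a - b| <= e.
    move=> h1 h2; rewrite (splitr e) (_ : a - b = (a - c) + (c - b)); last by ring.
    by rewrite (le_trans (ler_normD _ _))// lerD// distrC.
  split; rewrite emean_le//; apply: integral_dist_le => //; rewrite ?(ltW e0)//.
  - exact: measurable_funB.
  - by move=> x zx; apply: tri coo; exact: ui_near.
  - exact: measurable_funB.
  - by move=> x zx; apply: tri ci; exact: uoo_near.
split; (apply/cvg0_nearP; first by apply: nearW => t; apply: limn_esup_ge0);
  move=> e /key[t0 t00 Ht]; apply/at_right0P; exists t0 => // t /Ht [N _ NP];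
  apply: limn_esup_le; exists N => n /NP [] //.
Qed.

End strong_convergence.


(** The points [fun n => a' n i] lie in a product of segments, compact by Tychonoff. Given a cluster
    point [l], the index [s k] is chosen so that the coordinates up to [k] lie within [1 / (k + 1)]
    of [l]. *)
Lemma diagonal_subsequence {R : realType} (a : nat -> nat -> R) (C : nat -> R) :
  (forall n, \forall i \near \oo, `|a n i| <= C n) ->
  exists s : nat -> nat, {homo s : m n / (m < n)%N} /\ forall n, cvgn (fun i => a n (s i)).
Proof.
(* For each [n] the bound may fail for finitely many [i]; there the value is set to zero, which puts
   every index in the compact product and changes no limit. *)
move=> aC; pose a' n i := if `|a n i| <= C n then a n i else 0.
have a'C n i : `|a' n i| <= `|C n|.
  by rewrite /a'; case: ifP => [h|_]; rewrite ?normr0// (le_trans h)// ler_norm.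
have a'a n : \forall i \near \oo, a' n i = a n i.
  by apply: filterS (aC n) => i h; rewrite /a' h.
pose A n : set R := `[- `|C n|, `|C n|]%classic.
have /(_ _)/= cA := @tychonoff nat (fun=> R) A.
have {}cA : compact [set f : prod_topology (fun=> R) | forall n, A n (f n)].
  by apply: cA => n; exact: segment_compact.
pose g i : prod_topology (fun _ : nat => R) := fun n => a' n i.
have gA : (g @ \oo) [set f : prod_topology (fun=> R) | forall n, A n (f n)].
  by exists 0%N => // i _ n; rewrite /A/= in_itv/= -ler_norml; exact: a'C.
have [l [_ lcl]] := cA (g @ \oo) _ gA.
have step m N : exists i, (N <= i)%N /\ forall n, (n <= m)%N -> `|l n - a' n i| < m.+1%:R^-1.
  have m0 : 0 < m.+1%:R^-1 :> R by rewrite invr_gt0.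
  pose U : set (prod_topology (fun _ : nat => R)) :=
    [set f | forall n : 'I_m.+1, `|l (n : nat) - f (n : nat)| < m.+1%:R^-1].
  have nU : nbhs (l : prod_topology (fun=> R)) U.
    apply: (@filter_forall _ 'I_m.+1 (fun n (f : prod_topology (fun _ : nat => R)) =>
      `|l (n : nat) - f (n : nat)| < m.+1%:R^-1) (nbhs l)) => n.
    have /cvgrPdist_lt/(_ _ m0) : (f : prod_topology (fun _ : nat => R)) n @[f --> l] --> l n.
      exact: (@proj_continuous nat (fun=> R) n l).
    by [].
  have [|f [[i Ni <-] fU]] := lcl (g @` [set i | (N <= i)%N]) U _ nU.
    by exists N => // i /= Ni; exists i.
  exists i; split=> // n nm; exact: (fU (Ordinal (ltnSE nm : n < m.+1)%N)).
have /choice[h hP] : forall mN : nat * nat, exists i, (mN.2 <= i)%N /\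
    forall n, (n <= mN.1)%N -> `|l n - a' n i| < mN.1.+1%:R^-1 by move=> [m N]; exact: step.
pose s := fix s k := if k is k'.+1 then h (k, (s k').+1) else h (0, 0)%N.
exists s; split.
  apply: homo_ltn => [? ? ?|k]; first exact: ltn_trans.
  by have [] := hP (k.+1, (s k).+1).
have sinc k : (k <= s k)%N.
  elim: k => // k IH; have [/= + _] := hP (k.+1, (s k).+1); apply: leq_trans; exact: leq_ltn_trans IH _.
have sl n k : (n <= k)%N -> `|l n - a' n (s k)| < k.+1%:R^-1.
  by case: k => [|k] nk; [have [_] := hP (0, 0)%N|have [_] := hP (k.+1, (s k).+1)]; apply.
move=> n; apply/cvg_ex; exists (l n); apply/cvgrPdist_lt => e e0.
have [N _ NP] := a'a n; near=> k.
rewrite -(NP (s k)); last by rewrite /= (leq_trans _ (sinc k))//; near: k; exists N.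
apply: (lt_trans (sl n k _)); first by near: k; exists n.
by near: k; exact: near_infty_natSinv_lt (PosNum e0).
Unshelve. all: by end_near. Qed.

(** * Approximation by bump functions *)

Section bump.
Context {R : realType}.
Implicit Types a e t : R.

(** A cut-off in the distance [t] to a centre: one up to [a], zero from [a + e] on, and affine on
    the collar between. *)
Definition bump a e t : R := Num.max 0 (Num.min 1 ((a + e - t) / e)).

Lemma bump_itv a e t : 0 <= bump a e t <= 1.
Proof. by rewrite /bump le_max lexx/= ge_max ler01 ge_min lexx. Qed.

Lemma bump_inner a e t : 0 < e -> t <= a -> bump a e t = 1.
Proof.
move=> e0 ta; rewrite /bump min_l ?max_r ?ler01// ler_pdivlMr// mul1r; lra.
Qed.

Lemma bump_outer a e t : 0 < e -> a + e <= t -> bump a e t = 0.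
Proof.
move=> e0 ta; have h : (a + e - t) / e <= 0 by rewrite ler_pdivrMr// mul0r; lra.
by rewrite /bump min_r ?max_l// (le_trans h).
Qed.

Lemma bump_lipschitz a e t t' : 0 < e -> `|bump a e t - bump a e t'| <= e^-1 * `|t - t'|.
Proof.
move=> e0; have -> : e^-1 * `|t - t'| = `|(a + e - t) / e - (a + e - t') / e|.
  rewrite -mulrBl normrM (gtr0_norm (_ : 0 < e^-1)) ?invr_gt0// mulrC; congr (_ * _).
  by rewrite distrC; congr (`| _ |); ring.
rewrite /bump; move: (_ / e) (_ / e) => x y.
have h1 : y - x <= `|y - x| by exact: ler_norm.
have h2 : x - y <= `|y - x| by rewrite distrC ler_norm.
rewrite ler_norml; apply/andP; split.
all: have [?|?] := leP 1 x; have [?|?] := leP 1 y; rewrite ?(max_r (@ler01 R)).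
all: try have [?|?] := leP 0 x; try have [?|?] := leP 0 y; lra.
Qed.

End bump.

Section step_functions.
Context {R : realType} {I : eqType} {Y : pmetricType R}.
Implicit Types (s : seq I) (a c : I -> R) (e : R) (q : I -> Y).

(** The index set is kept apart from the centres [q], so that one packing with the same radii gives
    functions on the limit space and on every [X i]. *)
Definition step_fun s a e c q (y : Y) : R := \sum_(x <- s) c x * bump (a x) e (mdist y (q x)).

Lemma step_fun_bounded s a e c q y : `|step_fun s a e c q y| <= \sum_(x <- s) `|c x|.
Proof.
apply: (le_trans (ler_norm_sum _ _ _)); apply: ler_sum => x _.
have /andP[b0 b1] := bump_itv (a x) e (mdist y (q x)).
by rewrite normrM (ger0_norm b0) ler_piMr.
Qed.

Lemma step_fun_lipschitz s a e c q y y' : 0 < e ->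
  `|step_fun s a e c q y - step_fun s a e c q y'| <=
  (\sum_(x <- s) `|c x|) * e^-1 * mdist y y'.
Proof.
move=> e0; rewrite /step_fun -sumrB -mulrA mulr_suml.
apply: (le_trans (ler_norm_sum _ _ _)); apply: ler_sum => x _.
rewrite -mulrBr normrM ler_wpM2l// (le_trans (bump_lipschitz _ _ _ e0))//.
rewrite ler_wpM2l ?invr_ge0 ?(ltW e0)// ler_norml.
have t1 := metric_triangle y y' (q x); have t2 := metric_triangle y' y (q x).
rewrite (metric_sym y' y) in t2; apply/andP; split; lra.
Qed.

Lemma step_fun_measurable s a e c q : 0 < e ->
  measurable_fun [set: borel Y] (step_fun s a e c q : borel Y -> R).
Proof.
move=> e0; apply: continuous_borel => y; apply/cvgrPdist_lt => d d0.
pose L := (\sum_(x <- s) `|c x|) * e^-1 + 1.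
have L0 : 0 < L by rewrite ltr_wpDl// mulr_ge0 ?invr_ge0 ?(ltW e0)// sumr_ge0.
apply/nbhs_ballP; exists (d / L) => /=; first exact: divr_gt0.
move=> y'; rewrite in_ball ltr_pdivlMr// => yy'.
apply: le_lt_trans yy'; apply: (le_trans (step_fun_lipschitz _ _ _ _ _ _ e0)).
by rewrite mulrC ler_wpM2l ?mdist_ge0// lerDl.
Qed.

Lemma step_fun_in s a e c q x y : uniq s ->
  {in s &, forall x x', x != x' -> a x + a x' + 2 * e <= mdist (q x) (q x')} -> 0 < e ->
  x \in s -> mdist y (q x) < a x + e ->
  step_fun s a e c q y = c x * bump (a x) e (mdist y (q x)).
Proof.
move=> us sep e0 xs yx; rewrite /step_fun (bigD1_seq x)//= big_seq_cond big1 ?addr0//.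
move=> x' /andP[xs' xx']; rewrite bump_outer ?mulr0//.
have := sep x x' xs xs'; rewrite eq_sym => /(_ xx').
have := metric_triangle (q x) y (q x'); rewrite (metric_sym (q x) y); lra.
Qed.

Lemma step_fun_out s a e c q y : 0 < e -> (forall x, x \in s -> a x + e <= mdist y (q x)) ->
  step_fun s a e c q y = 0.
Proof.
by move=> e0 out; rewrite /step_fun big_seq big1// => x xs; rewrite bump_outer ?mulr0 ?out.
Qed.

(** With [b] the value of the bump, [t - c x * b = b * (t - c x) + (1 - b) * t]; the second term is
    present only in the collar, since [b] is one on the inner ball. *)
Lemma step_fun_dist s a e c q x y (t : R) : uniq s ->
  {in s &, forall x x', x != x' -> a x + a x' + 2 * e <= mdist (q x) (q x')} -> 0 < e ->
  x \in s -> mdist y (q x) < a x + e ->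
  `|t - step_fun s a e c q y| <= `|t - c x| + (if mdist y (q x) <= a x then 0 else `|t|).
Proof.
move=> us sep e0 xs yx; rewrite (step_fun_in c us sep e0 xs yx); case: (leP (mdist y (q x)) (a x)) => [h|_].
  by rewrite bump_inner// mulr1 addr0.
have /andP[] := bump_itv (a x) e (mdist y (q x)); move: (bump _ _ _) => b b0 b1.
rewrite (_ : t - c x * b = b * (t - c x) + (1 - b) * t); last by ring.
apply: (le_trans (ler_normD _ _)); rewrite !normrM (ger0_norm b0) (ger0_norm (_ : 0 <= 1 - b)) ?subr_ge0//.
by apply: lerD; rewrite ler_piMl// gerBl.
Qed.

End step_functions.

(** The sets [O i] are to be the supports of the bumps and [D] the complement of the inner balls. On
    [O i] the error is the oscillation of [f] plus [f] on the collar; as the [O i] are disjoint, [f]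
    on [D] is counted once inside them, with the convexity factor, and once outside. *)
Lemma pint_step_approx d (T : measurableType d) (R : realType)
    (mu : {measure set T -> \bar R}) (p : R) (I : eqType) (s : seq I) (O : I -> set T)
    (B D : set T) (c : I -> R) (f u : T -> R) : 1 < p ->
  measurable B -> measurable D -> (forall i, measurable (O i)) -> uniq s ->
  {in s &, forall i j, i != j -> O i `&` O j = set0} ->
  (forall i, i \in s -> O i `<=` B) -> D `<=` B ->
  measurable_fun B f -> measurable_fun B u ->
  (forall i x, i \in s -> O i x -> `|f x - u x| <= `|f x - c i| + `|(f \_ D) x|) ->
  (forall x, B x -> (forall i, i \in s -> ~ O i x) -> D x /\ u x = 0) ->
  (pint mu p B (fun x => f x - u x)%R <=
   (2 `^ (p - 1))%:E * \sum_(i <- s) pint mu p (O i) (fun x => f x - c i)%R +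
   ((2 `^ (p - 1))%:E * pint mu p D f + pint mu p D f))%E.
Proof.
move=> p1 mB mD mO us tO OB DB mf mu_ fu out; have p0 : 0 < p by exact: lt_trans p1.
have mfu : measurable_fun B (fun x => f x - u x) by exact: measurable_funB.
have mfD : measurable_fun B (f \_ D).
  by apply: measurable_funTS; apply/(measurable_restrictT _ mD).1; exact: measurable_funS mf.
pose E := B `\` \big[setU/set0]_(i <- s) O i.
have mE : measurable E by apply: measurableD => //; apply: bigsetU_measurable.
have cover : B `<=` \big[setU/set0]_(i <- s) O i `|` E.
  by move=> x Bx; have [?|?] := pselect ((\big[setU/set0]_(i <- s) O i) x); [left|right].
have h := @integral_seq_cover_le _ _ _ mu _ s O B E _ mB mE mO
  (measurable_EFin_powR_norm p mfu) (fun x _ => powR_ge0 _ _) cover.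
apply: (le_trans h) => {h}; rewrite [leRHS]addeA; apply: leeD; last first.
  rewrite setIidr; last by move=> x [].
  have ED : E `<=` D.
    move=> x [Bx nO]; have [] // := out x Bx; move=> i si Ox; apply: nO.
    by apply/big_setUP; exists i.
  apply: (@le_trans _ _ (pint mu p E f)); last first.
    by apply: subset_pint => //; exact: measurable_funS mf.
  rewrite le_eqVlt; apply/orP; left; apply/eqP; apply: eq_integral => x; rewrite inE => -[Bx nO].
  have [|_ ->] := out x Bx; last by rewrite subr0.
  by move=> i si Ox; apply: nO; apply/big_setUP; exists i.
have sumD : (\sum_(i <- s) pint mu p (O i) (f \_ D) <= pint mu p D f)%E.
  apply: (@le_trans _ _ (pint mu p B (f \_ D))).
    apply: (@integral_seq_disjoint_le _ _ _ mu _ s O B mB mO us tO OB) => //.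
    exact: measurable_EFin_powR_norm.
  rewrite le_eqVlt; apply/orP; left; apply/eqP.
  rewrite /pint [RHS]integral_mkcond [LHS]integral_mkcond; apply: eq_integral => x _.
  rewrite /patch; case: (boolP (x \in B)) => xB; case: (boolP (x \in D)) => xD //.
  - by rewrite normr0 powR0 ?gt_eqF.
  - by move: xB; rewrite notin_setE => /(_ (DB _ (set_mem xD))).
apply: (@le_trans _ _ (\sum_(i <- s) (2 `^ (p - 1))%:E *
    (pint mu p (O i) (fun x => f x - c i)%R + pint mu p (O i) (f \_ D)))%E); last first.
  rewrite -ge0_sume_distrr; last by move=> i _; rewrite adde_ge0// pint_ge0.
  rewrite big_split/= ge0_muleDr.
  - by rewrite leeD2l// lee_wpmul2l// lee_fin powR_ge0.
  - by rewrite sume_ge0// => i _; exact: pint_ge0.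
  - by rewrite sume_ge0// => i _; exact: pint_ge0.
rewrite big_seq [leRHS]big_seq; apply: lee_sum => i si; rewrite setIidr; last exact: OB.
have mfO : measurable_fun (O i) f by apply: measurable_funS mf => //; exact: OB.
have mfDO : measurable_fun (O i) (f \_ D) by apply: measurable_funS mfD => //; exact: OB.
have mfc : measurable_fun (O i) (fun x => `|f x - c i|).
  by apply: measurableT_comp => //; exact: measurable_funB.
have mfa : measurable_fun (O i) (fun x => `|(f \_ D) x|) by exact: measurableT_comp.
have abs (k : T -> R) : pint mu p (O i) (fun x => `|k x|) = pint mu p (O i) k.
  by apply: eq_integral => x _; rewrite normr_id.
have h := @pintD_le _ _ _ mu p p1 (O i) _ _ (mO i) mfc mfa.
rewrite !abs in h; apply: le_trans h; apply: le_pint => //.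
- by apply: measurable_funS mfu => //; exact: OB.
- exact: measurable_funD.
by move=> x Ox; rewrite [leRHS]ger0_norm ?addr_ge0//; exact: fu.
Qed.


(** * Approximation of Sobolev functions by finitely many means *)

Section levels.
Context {R : realType} (X : nat -> pmmSpace R) (Xoo : pmmSpace R).
Context (rad eps : nat -> R) (psi : forall i, X i -> Xoo).
Local Notation mu i A := (vol (X i) (A : set (borel (X i)))).
Local Notation muoo A := (vol Xoo (A : set (borel Xoo))).
Local Notation m i A := (fine (mu i A)).
Local Notation moo A := (fine (muoo A)).
Local Notation bset A := (A : set (borel _)).
Hypothesis pmGH : pmGH_cvg rad psi eps.
Context (K Rh r : R).
Hypotheses (HX : forall i, doubling_space (X i) K Rh) (HXoo : doubling_space Xoo K Rh).
Hypotheses (r0 : 0 < r) (rRh : 4 * (r + 1) <= Rh).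
Hypothesis v1 : forall i, mu i (ball (base (X i)) 1) = 1%E.
Hypothesis v1oo : muoo (ball (base Xoo) 1) = 1%E.
Local Notation B i := (ball (base (X i)) r).
Local Notation Boo := (ball (base Xoo) r).
Local Notation apx := (approx_pt rad eps psi).

Let apx_cvg z : cvg_pts rad psi (apx z) z. Proof. exact: approx_pt_cvg. Qed.

(** The packing lives in the limit space: centres are replaced by approximating points of [X i],
    radii and collar width are kept. *)
Definition step_at (s : seq (Xoo * R)) (e : R) (c : Xoo * R -> nat -> R) (i : nat) : X i -> R :=
  step_fun s snd e (fun x => c x i) (fun x => apx x.1 i).

(** Coefficients and distances to the centres converge, so the values along [y] do. For large [i]
    the functions share the Lipschitz constant [L = (S + 1) / e], which extends the closeness to a
    small ball about [y i]. *)
Lemma step_fun_strong_cvg (s : seq (Xoo * R)) (e : R) (c : Xoo * R -> nat -> R)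
    (coo : Xoo * R -> R) (z : Xoo) : 0 < e ->
  (forall x, x \in s -> c x i @[i --> \oo] --> coo x) -> Boo z ->
  strong_cvg_at rad psi (step_at s e c) (step_fun s snd e coo fst) z.
Proof.
move=> e0 cc Bz; apply: (uniform_strong_cvg pmGH HX HXoo r0 rRh v1 v1oo Bz).
- by move=> i; apply: measurable_funTS; exact: step_fun_measurable.
- by apply: measurable_funTS; exact: step_fun_measurable.
move=> d d0; pose S := \sum_(x <- s) `|coo x|.
have S0 : 0 <= S by exact: sumr_ge0.
pose L := (S + 1) * e^-1; have L0 : 0 < L by rewrite mulr_gt0 ?invr_gt0// ltr_wpDl.
exists (d / 2 / L); first by apply: divr_gt0 => //; exact: divr_gt0.
have lip1 (a b : R) (w : R) : 0 <= a -> a <= S + 1 -> 0 <= w -> w < d / 2 / L ->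
    b <= a * e^-1 * w -> b <= d / 2.
  move=> a0 aS w0 wd h; apply: (le_trans h); rewrite ltr_pdivlMr// in wd.
  apply: le_trans (ltW wd); rewrite mulrC ler_wpM2l// ler_wpM2r// invr_ge0 ltW//.
split.
  move=> x; rewrite in_ball => zx; apply: (@le_trans _ _ (d / 2)); last by lra.
  rewrite distrC; apply: (lip1 S _ _ S0 _ (mdist_ge0 _ _) zx); first by rewrite lerDl.
  exact: step_fun_lipschitz.
move=> y yz.
have Sc : \sum_(x <- s) `|c x i| @[i --> \oo] --> S.
  by apply: cvg_sum_seq => x xs; apply: cvg_norm; exact: cc.
have uc : step_at s e c (y i) @[i --> \oo] --> step_fun s snd e coo fst z.
  apply: cvg_sum_seq => x xs; apply: cvgM; first exact: cc.
  apply/cvgrPdist_lt => d' d'0; have ed' : 0 < d' * e by rewrite mulr_gt0.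
  apply: filterS (mdist_cvg pmGH yz (apx_cvg x.1) ed') => i h.
  apply: (le_lt_trans (bump_lipschitz _ _ _ e0)).
  by rewrite ltr_pdivrMl// mulrC distrC.
have nS : \forall i \near \oo, `|S - \sum_(x <- s) `|c x i| | < 1.
  by have /cvgrPdist_lt := Sc; apply.
have nu : \forall i \near \oo, `|step_fun s snd e coo fst z - step_at s e c (y i)| < d / 2.
  by have /cvgrPdist_lt := uc; apply; rewrite divr_gt0.
apply: filterS2 nS nu => i hS hu x; rewrite in_ball => yx.
have h1 : `|step_at s e c (y i) - step_at s e c x| <= d / 2.
  apply: (lip1 (\sum_(x <- s) `|c x i|) _ _ _ _ (mdist_ge0 _ _) yx).
  - exact: sumr_ge0.
  - by move: hS; rewrite ltr_norml => /andP[+ _]; lra.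
  - exact: step_fun_lipschitz.
rewrite (_ : step_at s e c x - _ = - (step_at s e c (y i) - step_at s e c x) -
  (step_fun s snd e coo fst z - step_at s e c (y i))); last by ring.
apply: (le_trans (ler_normB _ _)); rewrite normrN; lra.
Qed.

Context (p : R) (tau : R -> R) (f : forall i, X i -> R) (C : R).
Hypotheses (p1 : 1 < p) (tau0 : 0 < tau r).
Hypothesis WP : forall i, weak_poincare (X i) p tau.
Hypothesis fH : forall i, H1p (B i) p (@f i).
Hypothesis fC : forall i, (H1p_norm (B i) p (@f i) <= C%:E)%E.

(** The mean is taken over the whole support of the bump, of radius [x.2 + e], because the Poincare
    inequality is applied there. *)
Definition ball_mean (e : R) (x : Xoo * R) (i : nat) : R :=
  mean (ball (apx x.1 i) (x.2 + e)) (@f i).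

(* On the balls carrying the bumps the error is controlled by the Poincare
   inequality, on the small remaining set by equi-integrability. *)
Lemma exists_level (delta : R) : 0 < delta ->
  exists (s : seq (Xoo * R)) (e : R), [/\ 0 < e,
    (forall x, x \in s -> exists N : R, \forall i \near \oo, `|ball_mean e x i| <= N) &
    \forall i \near \oo, (pint (vol (X i)) p (bset (B i))
      (fun y => @f i y - step_at s e (ball_mean e) y)%R <= delta%:E)%E].
Proof.
move=> delta0; have p0 : 0 < p by exact: lt_trans p1.
have K1 : 1 <= K := ds_ge1 HXoo.
have K0 : 0 < K by exact: lt_le_trans K1.
have C0 : 0 <= C by have [] := H1p_norm_bound p1 (fH 0%N) (fC 0%N).
have P0 : 0 < 2 `^ (p - 1) :> R by rewrite powR_gt0.
(* The set [D] outside the inner balls is charged [2 ^ (p - 1) + 1] times, hence the denominator;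
   [e1] is the volume up to which equi-integrability applies. *)
have [e1 e10 EI] := @sobolev_equi_integrable R K Rh r p tau C
  (delta / 2 / (2 `^ (p - 1) + 1)) p1 tau0 r0 rRh K1
  (divr_gt0 (divr_gt0 delta0 (ltr0Sn _ 1)) (addr_gt0 P0 ltr01)).
set cc := chain_const K p (tau r).
have cc0 : 0 <= cc.
  by rewrite /cc /chain_const !(mulr_ge0, addr_ge0, powR_ge0, exprn_ge0)// ltW.
(* [b] will be [rho ^ p], where [rho] caps the radii of the supports; the Poincare errors then add
   up to at most [cc * (b * C ^ p)], which costs at most half of [delta]. *)
pose b := delta / 2 / (2 `^ (p - 1) * (cc * C `^ p) + 1).
have P1 : 0 <= 2 `^ (p - 1) * (cc * C `^ p).
  by apply: mulr_ge0; [exact: ltW|apply: mulr_ge0 => //; exact: powR_ge0].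
have b0 : 0 < b by rewrite !divr_gt0// ltr_wpDl.
have bP : 2 `^ (p - 1) * (cc * (b * C `^ p)) <= delta / 2.
  rewrite (_ : _ * _ = b * (2 `^ (p - 1) * (cc * C `^ p))); last by ring.
  rewrite /b mulrAC ler_pdivrMr; last by rewrite ltr_wpDl.
  by rewrite ler_wpM2l ?lerDl// ltW// divr_gt0.
pose rho := b `^ p^-1; have rho0 : 0 < rho by exact: powR_gt0.
have rhob : rho `^ p = b by rewrite -powRrM mulVf ?gt_eqF// powRr1// ltW.
pose T z := Num.min rho (r - mdist (base Xoo) z).
have T0 z : Boo z -> 0 < T z by rewrite in_ball lt_min rho0 subr_gt0.
have BBN : Boo `<=` Boo `|` set0 by rewrite setU0.
have e12 : 0 < e1 / 2 by rewrite divr_gt0.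
have [s [e e0 [us sP seps sU]]] := @vitali R Xoo K Rh HXoo Boo set0 T measurable0
  (measure0 _) T0 Boo (e1 / 2) (@mdist_open_ball _ _ _ r) (vol_ball_lty HXoo _ _) BBN e12.
exists s, e; split=> //.
  move=> x xs; have [Bx x20] := sP x xs; rewrite lt_min => /andP[_ xr].
  have xe0 : 0 < x.2 + e by rewrite addr_gt0.
  exists (1 + K ^+ (Num.truncn ((r + 1) / (x.2 + e))).+1 * C `^ p).
  have g0 : 0 < r - mdist (base Xoo) x.1 - (x.2 + e) by rewrite subr_gt0.
  apply: filterS (mdist_cvg pmGH (base_cvg pmGH) (apx_cvg x.1) g0) => i hi.
  apply: (mean_norm_le (HX i) p1 r0 rRh (v1 i) (fH i) (fC i) xe0).
  by rewrite metric_sym; move: hi; rewrite ltr_norml => /andP[_]; lra.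
have near_in : \forall i \near \oo, forall x, x \in s ->
    mdist (apx x.1 i) (base (X i)) + (x.2 + e) <= r.
  apply: near_seq => x xs; have [Bx x20] := sP x xs; rewrite lt_min => /andP[_ xr].
  have g0 : 0 < r - mdist (base Xoo) x.1 - (x.2 + e) by rewrite subr_gt0.
  apply: filterS (mdist_cvg pmGH (base_cvg pmGH) (apx_cvg x.1) g0) => i.
  by rewrite (metric_sym (apx _ _)) ltr_norml => /andP[_]; lra.
have near_sep : \forall i \near \oo, forall x, x \in s -> forall y, y \in s -> x != y ->
    x.2 + y.2 + 2 * e <= mdist (apx x.1 i) (apx y.1 i).
  apply: near_seq => x xs; apply: near_seq => y ys.
  have [->|xy] := eqVneq x y; first by apply: nearW.
  have g0 : 0 < mdist x.1 y.1 - (x.2 + y.2 + 2 * e) by rewrite subr_gt0; exact: seps.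
  apply: filterS (mdist_cvg pmGH (apx_cvg x.1) (apx_cvg y.1) g0) => i + _.
  by rewrite ltr_norml => /andP[+ _]; lra.
have near_vol : \forall i \near \oo,
    (m i (B i) <= \sum_(x <- s) m i (ball (apx x.1 i) x.2) + e1).
  have c1 : \sum_(x <- s) m i (ball (apx x.1 i) x.2) @[i --> \oo] -->
      \sum_(x <- s) moo (ball x.1 x.2).
    by apply: cvg_sum_seq => x /sP[_ x20 _]; exact: (vol_cvg pmGH HXoo x20 (apx_cvg _)).
  have c2 := vol_cvg pmGH HXoo r0 (base_cvg pmGH).
  have sU' : moo Boo <= \sum_(x <- s) moo (ball x.1 x.2) + e1 / 2.
    rewrite -lee_fin EFinD fineK ?(vol_ball_fin HXoo)//; apply: (le_trans sU).
    rewrite leeD2r// -sumEFin; apply: lee_sum => x _; by rewrite fineK ?(vol_ball_fin HXoo).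
  have e14 : 0 < e1 / 4 by rewrite divr_gt0.
  have /cvgrPdist_lt/(_ _ e14) n1 := c1; have /cvgrPdist_lt/(_ _ e14) n2 := c2.
  apply: filterS2 n1 n2 => i; rewrite !ltr_norml => /andP[? ?] /andP[? ?]; lra.
apply: filterS3 near_in near_sep near_vol => i hin hsep hvol.
(* [O x] supports the bump and [F x] is the inner ball on which it equals one; [D] consists of the
   collars and the part missed by the packing. *)
pose O (x : Xoo * R) := ball (apx x.1 i) (x.2 + e).
pose F (x : Xoo * R) := ball (apx x.1 i) x.2.
pose D := B i `\` \big[setU/set0]_(x <- s) F x.
have mO x : measurable (bset (O x)) by exact: measurable_mball.
have mF x : measurable (bset (F x)) by exact: measurable_mball.
have mB : measurable (bset (B i)) by exact: measurable_mball.
have mFU : measurable (bset (\big[setU/set0]_(x <- s) F x)).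
  by apply: bigsetU_measurable => x _; exact: mF.
have mD : measurable (bset D) by exact: measurableD.
have DB : D `<=` B i by move=> x [].
have OB x : x \in s -> O x `<=` B i.
  by move=> xs; apply: mball_sub; rewrite (metric_sym (base _)); exact: hin.
have FO x : F x `<=` O x by apply: le_ball; rewrite lerDl ltW.
have FB x : x \in s -> F x `<=` B i by move=> xs y /FO; exact: OB.
have tO : {in s &, forall x y, x != y -> O x `&` O y = set0}.
  move=> x y xs ys xy.
  apply: (@sep_ball_disjoint _ _ (apx x.1 i, x.2 + e) (apx y.1 i, y.2 + e)) => /=.
  by have := hsep x xs y ys xy; lra.
have tF : {in s &, forall x y, x != y -> F x `&` F y = set0}.
  move=> x y xs ys xy; rewrite -subset0 => z [/FO Oz /FO Oz'].
  by rewrite -(tO x y xs ys xy).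
have Bfin := vol_ball_fin (HX i) (base (X i)) r.
have muD : (mu i D <= e1%:E)%E.
  have E1 := @measure_seq_disjoint _ _ _ (vol (X i)) _ s F mF us tF.
  have Ffin x : mu i (F x) \is a fin_num by exact: vol_ball_fin (HX i) _ _.
  have FUB : \big[setU/set0]_(x <- s) F x `<=` B i by move=> y /big_setUP[x /FB]; exact.
  have E2 : mu i (\big[setU/set0]_(x <- s) F x) = (\sum_(x <- s) m i (F x))%:E.
    by rewrite -sumEFin; apply: etrans E1 _; apply: eq_bigr => x _; rewrite fineK.
  have h := @measureD _ (borel (X i)) R (vol (X i)) (B i) (\big[setU/set0]_(x <- s) F x) mB mFU
    (vol_ball_lty (HX i) _ _).
  rewrite (setIidr FUB) in h.
  have -> : mu i D = (mu i (B i) - mu i (\big[setU/set0]_(x <- s) F x))%E by exact: h.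
  by rewrite E2 -(fineK Bfin) -EFinB lee_fin lerBlDl.
have [fm _] : measurable_fun (bset (B i)) (@f i : borel (X i) -> R) /\
    (pint (vol (X i)) p (bset (B i)) (@f i) < +oo)%E.
  by apply/(inLp_pint p1) => //; exact: (fH i).1.
have smeas : measurable_fun (bset (B i)) (step_at s e (ball_mean e) (i := i) : borel (X i) -> R).
  by apply: measurable_funTS; exact: step_fun_measurable.
have hsep' : {in s &, forall x x', x != x' ->
    x.2 + x'.2 + 2 * e <= mdist (apx x.1 i) (apx x'.1 i)}.
  by move=> x y xs ys; exact: hsep.
have := @pint_step_approx _ (borel (X i)) R (vol (X i)) p _ s O (B i) D
  (fun x => ball_mean e x i) (@f i) (step_at s e (ball_mean e) (i := i)) p1 mB mD mO us tO OB DB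
  fm smeas.
move=> h; apply: (le_trans (h _ _)) => {h}.
- move=> x y xs; rewrite /O in_ball metric_sym => Oy.
  apply: (le_trans (step_fun_dist (fun x => ball_mean e x i) (@f i y) us hsep' e0 xs Oy)).
  rewrite lerD2l; case: (leP (mdist y (apx x.1 i)) x.2) => [_|xy]; first exact: normr_ge0.
  have Dy : D y.
    split; first by apply: (OB x xs); rewrite /O in_ball metric_sym.
    move=> /big_setUP[x' xs' Fy]; have [xx'|xx'] := eqVneq x x'.
      by move: Fy; rewrite -xx' /F in_ball metric_sym ltNge (ltW xy).
    suff : set0 y by [].
    rewrite -(tO x x' xs xs' xx'); split; last exact: FO.
    by rewrite /O in_ball metric_sym.
  by rewrite /patch mem_set.
- move=> y By nO; split.
    by split=> // /big_setUP[x xs /FO]; exact: nO.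
  apply: step_fun_out => // x xs; rewrite leNgt; apply/negP => h.
  by apply: (nO x xs); rewrite /O in_ball metric_sym.
have DEI : (pint (vol (X i)) p (bset D) (@f i) <= (delta / 2 / (2 `^ (p - 1) + 1))%:E)%E.
  exact: (EI (X i) (base (X i)) (@f i) D (HX i) (v1 i) (@WP i) (fH i) (fC i) mD DB muD).
have [_ _ Qle] := H1p_norm_bound p1 (fH i) (fC i).
have qi := grad_energy_integrable p1 (fH i).
set q := grad_energy (base (X i)) r p (@f i) in Qle qi.
have q0 x : 0 <= q x by exact: powR_ge0.
have Qsum : \sum_(x <- s) \int[vol (X i)]_(y in bset (O x)) q y <= C `^ p.
  apply: le_trans Qle; rewrite -lee_fin -sumEFin.
  have -> : (\int[vol (X i)]_(y in bset (B i)) q y)%:E =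
      (\int[vol (X i)]_(y in bset (B i)) (q y)%:E)%E.
    by rewrite /Rintegral fineK//; exact: (integrable_fin_num mB qi).
  have [mq _] := integrableP _ _ _ qi.
  apply: le_trans (@integral_seq_disjoint_le _ (borel (X i)) R (vol (X i)) _ s O (B i) mB mO us tO
    OB (EFin \o q) mq _); last by move=> x _; rewrite lee_fin.
  rewrite big_seq [leRHS]big_seq; apply: lee_sum => x xs.
  have qO := integrableS mB (mO x) (OB x xs) qi.
  by rewrite /Rintegral fineK//; exact: (integrable_fin_num (mO x) qO).
have PP : (\sum_(x <- s) pint (vol (X i)) p (bset (O x)) (fun y => @f i y - ball_mean e x i)%R <=
    (cc * (b * C `^ p))%:E)%E.
  apply: (@le_trans _ _ (\sum_(x <- s)
      (cc * (b * \int[vol (X i)]_(y in bset (O x)) q y))%:E)%E); last first.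
    by rewrite sumEFin lee_fin -mulr_sumr ler_wpM2l// -mulr_sumr ler_wpM2l// ltW.
  rewrite big_seq [leRHS]big_seq; apply: lee_sum => x xs.
  have [_ x20] := sP x xs; rewrite lt_min => /andP[xrho _].
  have xe0 : 0 < x.2 + e by rewrite addr_gt0.
  apply: (le_trans (ball_Lp_poincare (HX i) p1 tau0 r0 rRh (v1 i) (@WP i) (fH i) xe0 (hin x xs))).
  rewrite lee_fin ler_wpM2l// ler_wpM2r//; first by apply: Rintegral_ge0 => y _; exact: q0.
  by rewrite -rhob ge0_ler_powR ?nnegrE ?(ltW p0) ?(ltW rho0) ?(ltW xe0)// ltW.
rewrite (_ : delta = delta / 2 + delta / 2); last by lra.
rewrite EFinD; apply: leeD.
  apply: (@le_trans _ _ ((2 `^ (p - 1))%:E * (cc * (b * C `^ p))%:E)%E).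
    by apply: lee_wpmul2l => //; rewrite lee_fin ltW.
  by rewrite -EFinM lee_fin.
apply: (@le_trans _ _ ((2 `^ (p - 1))%:E * (delta / 2 / (2 `^ (p - 1) + 1))%:E +
    (delta / 2 / (2 `^ (p - 1) + 1))%:E)%E).
  by apply: leeD => //; apply: lee_wpmul2l => //; rewrite lee_fin ltW.
rewrite -EFinM -EFinD lee_fin le_eqVlt; apply/orP; left; apply/eqP; field.
by rewrite gt_eqF// addr_gt0.
Qed.

End levels.


(** * The limit function and strong convergence to it *)

Section assembly.
Context {R : realType} (X : nat -> pmmSpace R) (Xoo : pmmSpace R).
Context (rad eps : nat -> R) (psi : forall i, X i -> Xoo).
Local Notation mu i A := (vol (X i) (A : set (borel (X i)))).
Local Notation muoo A := (vol Xoo (A : set (borel Xoo))).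
Local Notation bset A := (A : set (borel _)).
Hypothesis pmGH : pmGH_cvg rad psi eps.
Context (K Rh r : R).
Hypotheses (HX : forall i, doubling_space (X i) K Rh) (HXoo : doubling_space Xoo K Rh).
Hypotheses (r0 : 0 < r) (rRh : 4 * (r + 1) <= Rh).
Hypothesis v1 : forall i, mu i (ball (base (X i)) 1) = 1%E.
Hypothesis v1oo : muoo (ball (base Xoo) 1) = 1%E.
Local Notation B i := (ball (base (X i)) r).
Local Notation Boo := (ball (base Xoo) r).
Context (p : R) (f : forall i, X i -> R) (C : R).
Hypothesis p1 : 1 < p.
Hypothesis fL : forall i, inLp (B i) p%:E (EFin \o @f i).
Hypothesis fC : forall i, (LpN (B i) p%:E (EFin \o @f i) <= C%:E)%E.
Context (S : nat -> seq (Xoo * R)) (E : nat -> R) (coo : nat -> Xoo * R -> R).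
Hypothesis E0 : forall k, 0 < E k.
Local Notation c k := (ball_mean rad eps psi f (E k)).
Hypothesis cc : forall k x, x \in S k -> c k x i @[i --> \oo] --> coo k x.

Unset Implicit Arguments.
Let u k i : X i -> R := step_at rad eps psi (S k) (E k) (c k) (i := i).
Let uoo k : Xoo -> R := step_fun (S k) snd (E k) (coo k) fst.

Hypothesis uf : forall k, \forall i \near \oo,
  (pint (vol (X i)) p (bset (B i)) (fun y => @f i y - u k i y)%R <= (k.+1%:R^-1)%:E)%E.

Let p0 : 0 < p. Proof. exact: lt_trans p1. Qed.

Let P0 : 0 < 2 `^ (p - 1) :> R. Proof. by rewrite powR_gt0. Qed.

Let mB i : measurable (bset (B i)). Proof. exact: measurable_mball. Qed.

Let mBoo : measurable (bset Boo). Proof. exact: measurable_mball. Qed.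

Let mf i : measurable_fun (bset (B i)) (@f i : borel (X i) -> R).
Proof. exact: measurable_inLp (fL i). Qed.

Let mu_ k i : measurable_fun (bset (B i)) (u k i : borel (X i) -> R).
Proof. by apply: measurable_funTS; exact: step_fun_measurable. Qed.

Let muoo_ k : measurable_fun (bset Boo) (uoo k : borel Xoo -> R).
Proof. by apply: measurable_funTS; exact: step_fun_measurable. Qed.

Set Implicit Arguments.

(** The sums of [|c k x i|] over the packing converge in [i], hence are bounded for all [i]
    together. *)
Let u_bounded k : exists M : R, [/\ 0 <= M, forall i y, `|u k i y| <= M &
  forall y, `|uoo k y| <= M].
Proof.
have Sc : \sum_(x <- S k) `|c k x i| @[i --> \oo] --> \sum_(x <- S k) `|coo k x|.
  by apply: cvg_sum_seq => x xs; apply: cvg_norm; exact: cc.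
have /cvg_seq_bounded/pinfty_ex_gt0[M M0 SM] : cvgn (fun i => \sum_(x <- S k) `|c k x i|).
  by apply/cvg_ex; exists (\sum_(x <- S k) `|coo k x|).
exists (Num.max M (\sum_(x <- S k) `|coo k x|)); split.
- by rewrite le_max (ltW M0).
- move=> i y; rewrite le_max; apply/orP; left; apply: (le_trans (step_fun_bounded _ _ _ _ _ _)).
  by apply: le_trans (SM i I); exact: ler_norm.
- by move=> y; rewrite le_max step_fun_bounded orbT.
Qed.

Let strong k z : Boo z -> strong_cvg_at rad psi (u k) (uoo k) z.
Proof.
by move=> Bz; exact: (step_fun_strong_cvg pmGH HX HXoo r0 rRh v1 v1oo (E0 k) (cc (k := k)) Bz).
Qed.

Let near_cst k M z : (forall i y, `|u k i y| <= M) -> (forall y, `|uoo k y| <= M) ->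
  Boo z -> near_cst_at rad eps psi (u k) (uoo k) M z.
Proof.
move=> uM uooM Bz.
have ae1 i : {ae vol (X i), forall x : borel (X i), B i x -> `|u k i x| <= M} by apply: aeW.
have ae2 : {ae vol Xoo, forall x : borel Xoo, Boo x -> `|uoo k x| <= M} by apply: aeW.
exact: (strong_cvg_near_cst pmGH HX HXoo r0 rRh v1 v1oo Bz (mu_ k) (muoo_ k) ae1 ae2 (strong k Bz)).
Qed.

(** Stated for a general bounded, strongly convergent [w]: it is applied to another step function,
    for the Cauchy property of the limits, and to an arbitrary [L^p]-approximate sequence. *)
Lemma step_dist_cvg k (w : forall i, X i -> R) (woo : Xoo -> R) (M : R) :
  (forall i, measurable_fun (bset (B i)) (w i : borel (X i) -> R)) ->
  measurable_fun (bset Boo) (woo : borel Xoo -> R) ->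
  (forall i, {ae vol (X i), forall x : borel (X i), B i x -> `|w i x| <= M}) ->
  {ae vol Xoo, forall x : borel Xoo, Boo x -> `|woo x| <= M} ->
  {ae vol Xoo, forall z : borel Xoo, Boo z -> strong_cvg_at rad psi w woo z} ->
  forall delta, 0 < delta -> \forall i \near \oo,
    (pint (vol (X i)) p (bset (B i)) (fun x => u k i x - w i x)%R <=
       pint (vol Xoo) p (bset Boo) (fun x => uoo k x - woo x)%R + delta%:E)%E /\
    (pint (vol Xoo) p (bset Boo) (fun x => uoo k x - woo x)%R <=
       pint (vol (X i)) p (bset (B i)) (fun x => u k i x - w i x)%R + delta%:E)%E.
Proof.
move=> mw mwoo wM wooM ws delta delta0; have [N [N0 uN uooN]] := u_bounded k.
apply: (near_cst_pint_cvg pmGH HX HXoo r0 p1 (M := N + M)) => //.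
- by move=> i; exact: measurable_funB.
- exact: measurable_funB.
- move=> i; apply: filterS (wM i) => x + Bx => /(_ Bx) h.
  by rewrite (le_trans (ler_normB _ _))// lerD.
- apply: filterS wooM => x + Bx => /(_ Bx) h.
  by rewrite (le_trans (ler_normB _ _))// lerD.
apply: filterS ws => z + Bz => /(_ Bz) h.
apply: (near_cst_atB pmGH Bz (mu_ k) (muoo_ k) mw mwoo); first exact: near_cst.
exact: (strong_cvg_near_cst pmGH HX HXoo r0 rRh v1 v1oo Bz mw mwoo wM wooM h).
Qed.

(** At one large index [i] both step functions are close to the same [f i], hence to each other;
    [step_dist_cvg] carries this over to the limit space. *)
Let uoo_cauchy (e : R) : 0 < e -> exists N, forall m n, (N <= m)%N -> (N <= n)%N ->
  (pint (vol Xoo) p (bset Boo) (fun x => uoo m x - uoo n x)%R <= e%:E)%E.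
Proof.
move=> e0; pose d := e / 2 / (2 `^ (p - 1) * 2).
have d0 : 0 < d by rewrite !divr_gt0// mulr_gt0.
have [N _ NP] := near_infty_natSinv_lt (PosNum d0).
exists N => m n Nm Nn; have [M [M0 uM uooM]] := u_bounded n.
have e2 : 0 < e / 2 by rewrite divr_gt0.
have ae1 i : {ae vol (X i), forall x : borel (X i), B i x -> `|u n i x| <= M} by apply: aeW.
have ae2 : {ae vol Xoo, forall x : borel Xoo, Boo x -> `|uoo n x| <= M} by apply: aeW.
have ae3 : {ae vol Xoo, forall z : borel Xoo, Boo z -> strong_cvg_at rad psi (u n) (uoo n) z}.
  by apply: aeW => z; exact: strong.
have h := @step_dist_cvg m (u n) (uoo n) M (mu_ n) (muoo_ n) ae1 ae2 ae3 _ e2.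
have [i [[_ h1] [h2 h3]]] := filter_ex (filterI h (filterI (uf m) (uf n))).
apply: (le_trans h1).
have h4 := @pintB_le _ (borel (X i)) R (vol (X i)) p p1 (B i) (u m i) (@f i) (u n i) (mB i)
  (mu_ m i) (mf i) (mu_ n i).
rewrite [leRHS](_ : _ = (e / 2)%:E + (e / 2)%:E)%E; last by rewrite -EFinD -splitr.
rewrite leeD2r//; apply: (le_trans h4).
rewrite pint_distrC; apply: (@le_trans _ _ ((2 `^ (p - 1))%:E * (d%:E + d%:E))%E).
  apply: lee_wpmul2l; first by rewrite lee_fin ltW.
  apply: leeD.
    by apply: (le_trans h2); rewrite lee_fin ltW//; exact: NP.
  by apply: (le_trans h3); rewrite lee_fin ltW//; exact: NP.
rewrite -EFinD -EFinM lee_fin le_eqVlt; apply/orP; left; apply/eqP.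
by rewrite /d; field; rewrite gt_eqF.
Qed.

(** For an approximate sequence [fa], the distance from [f i] to [fa i j] is estimated through
    [u k i]; the distance from [u k i] to [fa i j] is compared with that between their limits, which
    is estimated through [foo]. The step functions themselves form the approximate sequence whose
    existence is required. *)
Lemma step_limit_strong_cvg : exists foo : Xoo -> R,
  inLp Boo p%:E (EFin \o foo) /\ Lp_strong_cvg rad psi r p f foo.
Proof.
have [foo mfoo foo_lim] := @pint_complete _ (borel Xoo) R (vol Xoo) p p1 Boo uoo mBoo muoo_
  uoo_cauchy.
have pN0 : p != 0 by rewrite gt_eqF.
have fooL : inLp Boo p%:E (EFin \o foo).
  apply/(inLp_pint p1 _ mBoo); split=> //.
  have [N NP] := foo_lim 1 ltr01; have [M [M0 _ uM]] := u_bounded N.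
  have mfu : measurable_fun (bset Boo) ((fun x => foo x - uoo N x) : borel Xoo -> R).
    exact: measurable_funB.
  have h := @pintD_le _ (borel Xoo) R (vol Xoo) p p1 Boo _ _ mBoo mfu (muoo_ N).
  rewrite (@eq_pint _ (borel Xoo) R (vol Xoo) p Boo foo (fun x => foo x - uoo N x + uoo N x)).
    apply: (le_lt_trans h); rewrite lte_mul_pinfty ?lee_fin ?powR_ge0//.
    apply: lte_add_pinfty; first by rewrite pint_distrC (le_lt_trans (NP N _)) ?ltry.
    have ae : {ae vol Xoo, forall x : borel Xoo, Boo x -> `|uoo N x| <= M} by apply: aeW.
    apply: (le_lt_trans (@pint_ae_bounded _ (borel Xoo) R (vol Xoo) p p1 Boo (uoo N) M mBoo
      (muoo_ N) ae)).
    by rewrite lte_mul_pinfty ?lee_fin ?powR_ge0// (vol_ball_lty HXoo).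
  by move=> x _; rewrite subrK.
exists foo; split=> //; split.
- by split.
- by exists C.
- exists (fun i k => u k i), uoo; split.
  + move=> k; have [M [M0 uM uooM]] := u_bounded k; split.
      move=> i; split; first exact/measurable_EFinP.
      by apply: le_lt_trans (ltry M); apply: LpN_oo_le.
    split; first exact/measurable_EFinP.
    by apply: le_lt_trans (ltry M); apply: LpN_oo_le.
  + move=> k; have [M [M0 uM uooM]] := u_bounded k; exists M.
    by split=> [i|]; apply: LpN_oo_le.
  + by move=> k; apply: aeW => z; exact: strong.
  + have LE j : LpN Boo p%:E (fun x => (foo x - uoo j x)%:E) =
        (pint (vol Xoo) p (bset Boo) (fun x => foo x - uoo j x)%R `^ p^-1)%E.
      exact: (LpN_pint (fun x => foo x - uoo j x) pN0 mBoo).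
    under eq_fun do rewrite LE.
    apply/cvg0_poweRVP => //; first by move=> j; exact: pint_ge0.
    by move=> e /foo_lim[N NP]; exists N => n /NP; rewrite pint_distrC.
move=> fa faoo [faL faC fas fa_lim].
have LE j : LpN Boo p%:E (fun x => (foo x - faoo j x)%:E) =
    (pint (vol Xoo) p (bset Boo) (fun x => foo x - faoo j x)%R `^ p^-1)%E.
  exact: (LpN_pint (fun x => foo x - faoo j x) pN0 mBoo).
have {}fa_lim : forall e : R, 0 < e -> exists N, forall n, (N <= n)%N ->
    (pint (vol Xoo) p (bset Boo) (fun x => foo x - faoo n x)%R <= e%:E)%E.
  apply/(cvg0_poweRVP p0); first by move=> n; exact: pint_ge0.
  by move: fa_lim; under eq_fun do rewrite LE.
have mfa j i : measurable_fun (bset (B i)) (fa i j : borel (X i) -> R).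
  exact: measurable_inLp ((faL j).1 i).
have mfaoo j : measurable_fun (bset Boo) (faoo j : borel Xoo -> R).
  exact: measurable_inLp (faL j).2.
have posT (Y : pmmSpace R) : vol Y (ball (base Y) 1 : set (borel Y)) = 1%E ->
    (0 < vol Y [set: borel Y])%E.
  move=> vY; apply: (@lt_le_trans _ _ 1%E); first by rewrite lte_fin.
  by rewrite -vY; apply: vol_subset => //; exact: measurable_mball.
apply/cvg0_geP.
  by move=> j; apply: le_trans (limn_einf_sup _); apply: limn_einf_ge0 => i; exact: Lnorm_ge0.
(* Two nested triangle inequalities with factor [P] add up to [P * (d + (P * (d + d) + d)) = 2 * P *
   (1 + P) * d], which is [e ^ p]. *)
move=> e e0; pose P := 2 `^ (p - 1) : R; pose d := e `^ p / (2 * P * (1 + P)).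
have ep0 : 0 < e `^ p by exact: powR_gt0.
have d0 : 0 < d by rewrite divr_gt0// !mulr_gt0// addr_gt0.
have [N1 N1P] := fa_lim d d0; have [N2 N2P] := foo_lim d d0.
have [N3 _ N3P] := near_infty_natSinv_lt (PosNum d0).
pose k := maxn N2 N3; exists N1 => j N1j; apply: limn_esup_le.
have [M [faM faooM]] := faC j.
have aeM i : {ae vol (X i), forall x : borel (X i), B i x -> `|fa i j x| <= M}.
  exact: LpN_oo_ae (faM i) (posT _ (v1 i)).
have aeMoo : {ae vol Xoo, forall x : borel Xoo, Boo x -> `|faoo j x| <= M}.
  exact: LpN_oo_ae faooM (posT _ v1oo).
have [N4 _ N4P] := @step_dist_cvg k (fun i => fa i j) (faoo j) M (mfa j) (mfaoo j)
  aeM aeMoo (fas j) d d0.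
have [N5 _ N5P] := uf k.
exists (maxn N4 N5) => i; rewrite geq_max => /andP[iN4 iN5].
have -> : LpN (B i) p%:E (fun x => (f x - fa i j x)%:E) =
    (pint (vol (X i)) p (bset (B i)) (fun x => @f i x - fa i j x)%R `^ p^-1)%E.
  transitivity (LpN (B i) p%:E (EFin \o (fun x => @f i x - fa i j x))) => //.
  exact: LpN_pint.
rewrite lee_poweRV ?pint_ge0 ?(ltW e0)//.
have [h1 _] := N4P i iN4; have h2 := N5P i iN5.
have h3 := @pintB_le _ (borel (X i)) R (vol (X i)) p p1 (B i) (@f i) (u k i) (fa i j) (mB i)
  (mf i) (mu_ k i) (mfa j i).
have h4 := @pintB_le _ (borel Xoo) R (vol Xoo) p p1 Boo (uoo k) foo (faoo j) mBoo
  (muoo_ k) mfoo (mfaoo j).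
have kd : ((k.+1%:R^-1)%:E <= d%:E :> \bar R)%E.
  by rewrite lee_fin ltW//; apply: N3P; rewrite /= leq_maxr.
have h5 : (pint (vol Xoo) p (bset Boo) (fun x => uoo k x - faoo j x)%R <= (P * (d + d))%:E)%E.
  apply: (le_trans h4); rewrite EFinM EFinD; apply: lee_wpmul2l; first by rewrite lee_fin ltW.
  by apply: leeD; [apply: N2P; rewrite leq_maxl|exact: N1P].
apply: (le_trans h3); apply: (@le_trans _ _ (P%:E * (d%:E + ((P * (d + d))%:E + d%:E)))%E).
  apply: lee_wpmul2l; first by rewrite lee_fin ltW.
  apply: leeD; first exact: le_trans h2 kd.
  by apply: (le_trans h1); rewrite leeD2r.
rewrite -!EFinD -EFinM lee_fin le_eqVlt; apply/orP; left; apply/eqP.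
have P0' : 0 < P by [].
by rewrite /d; field; rewrite !gt_eqF// addr_gt0.
Qed.

End assembly.

(** * Passing to a subsequence of spaces *)

Section subsequences.
Context {R : realType} (X : nat -> pmmSpace R) (Xoo : pmmSpace R).
Context (rad eps : nat -> R) (psi : forall i, X i -> Xoo) (s : nat -> nat).
Hypothesis smon : {homo s : m n / (m < n)%N}.

Let s_ge j : (j <= s j)%N.
Proof. by elim: j => // j IH; apply: leq_ltn_trans IH _; exact: smon. Qed.

Let s_inj : injective s.
Proof.
move=> i j ij; have [h|h|//] := ltngtP i j.
  by have := smon h; rewrite ij ltnn.
by have := smon h; rewrite ij ltnn.
Qed.

Lemma near_subsequence (P : nat -> Prop) :
  (\forall i \near \oo, P i) -> \forall j \near \oo, P (s j).
Proof. by move=> [N _ NP]; exists N => // j /= Nj; apply: NP; exact: leq_trans (s_ge j). Qed.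

(* Convergence of volumes on the subsequence involves points of [X (s j)] only,
   so these must be completed to a full sequence. *)
Let extend (y0 : forall i, X i) (y : forall j, X (s j)) : exists y' : forall i, X i,
  (forall j, y' (s j) = y j) /\ forall i, (forall j, s j <> i) -> y' i = y0 i.
Proof.
pose y' i : X i := match pselect (exists j, s j = i) with
  | left P => let: exist j ji := cid P in eq_rect (s j) X (y j) i ji
  | right _ => y0 i end.
exists y'; split=> [j|i ni]; rewrite /y'; case: pselect => [P|nP] //.
(* As [s] is injective the chosen preimage is [j], and equality proofs between natural numbers are
   unique, so the transport is trivial. *)
- case: (cid P) => j' /= E; have jj := s_inj E; case: _ / jj E => E.
  by rewrite (eq_irrelevance E erefl).
- by exfalso; apply: nP; exists j.
- by exfalso; case: P => j; exact: ni.
Qed.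

Lemma pmGH_subsequence : pmGH_cvg rad psi eps ->
  pmGH_cvg (fun j => rad (s j)) (fun j => @psi (s j)) (fun j => eps (s j)).
Proof.
move=> pmGH; have [e0 r0 h1 [h2 h3 h4 h5]] := pmGH.
have soo : s j @[j --> \oo] --> \oo by move=> P; exact: near_subsequence.
split=> //.
- exact: (cvg_comp _ _ soo e0).
- exact: (cvg_comp _ _ soo r0).
- by move=> i x; exact: h1.
split=> //.
- by move=> i x y; exact: h2.
- by move=> i z; exact: h3.
- exact: (cvg_comp _ _ soo h4).
move=> r y yoo rpos yc.
have [y' [y's y'n]] := extend (approx_pt rad eps psi yoo) y.
have ac := approx_pt_cvg pmGH yoo.
have lift (P : forall i, X i -> Prop) : (\forall j \near \oo, P (s j) (y j)) ->
    (\forall i \near \oo, P i (approx_pt rad eps psi yoo i)) ->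
    \forall i \near \oo, P i (y' i).
  move=> [N _ NP] [N' _ NP']; exists (maxn (s N) N') => // i /=; rewrite geq_max => /andP[iN iN'].
  have [[j ji]|nj] := pselect (exists j, s j = i).
    case: _ / ji iN {iN'} => iN; rewrite y's; apply: NP => /=.
    by rewrite leqNgt; apply/negP => /smon; rewrite ltnNge iN.
  by rewrite y'n; [exact: NP'|move=> j ji; apply: nj; exists j].
have yc' : cvg_pts rad psi y' yoo.
  have /cvg_ptsP[a1 a2] := ac.
  have /cvg_ptsP[b1 b2] := yc.
  apply/cvg_ptsP; split.
    exact: (lift (fun i x => ball (base (X i)) (rad i) x)).
  by move=> e ee; apply: (lift (fun i x => mdist (psi x) yoo < e)); [exact: b2|exact: a2].
have := cvg_comp _ _ soo (h5 r y' yoo rpos yc').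
rewrite (_ : _ \o _ = fun j => vol (X (s j)) (ball (y j) r))//.
by apply/funext => j /=; rewrite y's.
Qed.

End subsequences.

(** * Extraction of the subsequence *)

Theorem proposition3p39 (R : realType) (X : nat -> pmmSpace R)
  (Xoo : pmmSpace R)
  (proper_X : forall i, proper_space (X i)) (proper_Xoo : proper_space Xoo)
  (geod_X : forall i, geodesic_space (X i)) (geod_Xoo : geodesic_space Xoo)
  (radon_X : forall i, radon_measure (X i)) (radon_Xoo : radon_measure Xoo)
  (r : R) (r_gt0 : 0 < r)
  (eps rad : nat -> R) (psi : forall i, X i -> Xoo)
  (pmGH : pmGH_cvg rad psi eps)
  (Xoo_nontriv : [set: Xoo] <> [set base Xoo])
  (doubling : forall Rhat : R, 0 < Rhat -> exists2 kappa : R, 0 <= kappa &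
     (forall i, doubling_up_to (X i) Rhat kappa) /\
     doubling_up_to Xoo Rhat kappa)
  (vol1 : (forall i, vol (X i) (ball (base (X i)) 1) = 1%E) /\
     vol Xoo (ball (base Xoo) 1) = 1%E)
  (p : R) (p_gt1 : 1 < p)
  (tau : R -> R) (tau_gt0 : forall s, 0 < s -> 0 < tau s)
  (poincare : forall i, weak_poincare (X i) p tau)
  (f : forall i, X i -> R)
  (f_H1p : forall i, H1p (ball (base (X i)) r) p (f i))
  (f_bounded : exists C : R, forall i,
     (H1p_norm (ball (base (X i)) r) p (f i) <= C%:E)%E) :
  exists foo : Xoo -> R, inLp (ball (base Xoo) r) p%:E (EFin \o foo) /\
  exists s : nat -> nat, {homo s : m n / (m < n)%N} /\
    Lp_strong_cvg (fun j => rad (s j)) (fun j => psi (s j)) r p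
      (fun j => f (s j)) foo.
Proof.
have [v1 v1oo] := vol1; have [C fC] := f_bounded; have tau0 := tau_gt0 r r_gt0.
(* The radius [4 * (r + 1)] allows chains of balls of radius up to [r], whose volumes are compared
   at four times the scale, and balls of radius [r + 1], which reach the unit ball about the base
   point. *)
have Rh0 : 0 < 4 * (r + 1) by rewrite mulr_gt0// addr_gt0.
have [kappa k0 [dbl dbloo]] := doubling _ Rh0.
pose K := 2 `^ kappa : R.
have K1 : 1 <= K by rewrite -(powRr0 (2 : R)) ler_powR// ler1n.
have HX i : doubling_space (X i) K (4 * (r + 1)) by split=> // z t; exact: dbl.
have HXoo : doubling_space Xoo K (4 * (r + 1)) by split=> // z t; exact: dbloo.
have lev k := exists_level pmGH HX HXoo r_gt0 (lexx _) v1 p_gt1 tau0 poincare f_H1p fC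
  (delta := k.+1%:R^-1) (etrans (invr_gt0 _) (ltr0Sn _ k)).
have /choice[SE SEP] : forall k, exists SE : seq (Xoo * R) * R, [/\ 0 < SE.2,
    (forall x, x \in SE.1 -> exists N : R, \forall i \near \oo,
       `|ball_mean rad eps psi f SE.2 x i| <= N) &
    \forall i \near \oo, (pint (vol (X i)) p (ball (base (X i)) r : set (borel (X i)))
      (fun y => f i y - step_at rad eps psi SE.1 SE.2 (ball_mean rad eps psi f SE.2) y)%R
      <= (k.+1%:R^-1)%:E)%E].
  by move=> k; have [S [e H]] := lev k; exists (S, e).
pose x0 : Xoo * R := (base Xoo, 0).
(* One index [n] codes a level [k] and the position [j] of a ball in its packing, so that a single
   diagonal argument makes all coefficients converge; codes out of range get the value zero. *)
pose a (n i : nat) : R := if (choice.unpickle n : option (nat * nat)) is Some (k, j) then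
  if (j < size (SE k).1)%N then
    ball_mean rad eps psi f (SE k).2 (nth x0 (SE k).1 j) i else 0 else 0.
have /choice[N aN] : forall n, exists N : R, \forall i \near \oo, `|a n i| <= N.
  move=> n; rewrite /a; case: (choice.unpickle n) => [[k j]|]; last first.
    by exists 0; apply: nearW => i; rewrite normr0.
  have [jk|_] := ltnP j (size (SE k).1); last by exists 0; apply: nearW => i; rewrite normr0.
  by have [_ + _] := SEP k; apply; exact: mem_nth.
have [s [smon sa]] := diagonal_subsequence aN.
pose coo k x := limn (fun j => ball_mean rad eps psi f (SE k).2 x (s j)).
have cc k x : x \in (SE k).1 ->
    ball_mean rad eps psi f (SE k).2 x (s j) @[j --> \oo] --> coo k x.
  move=> xs; have := sa (choice.pickle (k, index x (SE k).1)).
  by rewrite /a choice.pickleK index_mem xs nth_index.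
have fL i : inLp (ball (base (X i)) r) p%:E (EFin \o f i) := (f_H1p i).1.
have fLC i : (LpN (ball (base (X i)) r) p%:E (EFin \o f i) <= C%:E)%E.
  by apply: le_trans (fC i); rewrite leeDl// Lnorm_ge0.
have [foo [fooL H]] := @step_limit_strong_cvg R (fun j => X (s j)) Xoo (fun j => rad (s j))
  (fun j => eps (s j)) (fun j => psi (s j)) (pmGH_subsequence smon pmGH) K (4 * (r + 1)) r
  (fun j => HX (s j)) HXoo r_gt0 (lexx _) (fun j => v1 (s j)) v1oo p (fun j => f (s j)) C p_gt1
  (fun j => fL (s j)) (fun j => fLC (s j)) (fun k => (SE k).1) (fun k => (SE k).2) coo
  (fun k => let: And3 h _ _ := SEP k in h) cc
  (fun k => near_subsequence smon (let: And3 _ _ h := SEP k in h)).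
by exists foo; split=> //; exists s.
Qed.
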